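(* Consider the quantum Ising chain in a transverse field, $H=-J\sum_{i\in\mathbb{Z}}\sigma^x_i\sigma^x_{i+1}-h\sum_{i\in\mathbb{Z}}\sigma^z_i$, in the disordered regime $|J/h|<1$, and let $\omega$ be its unique ground state ($\beta=\infty$). Then the limit $$F(t)=\lim_{n\to\infty}\frac1n\log\omega\Bigl(\exp\bigl(t\textstyle\sum_{i=1}^n\sigma^z_i\bigr)\Bigr)$$ exists for every $t\in\mathbb{R}$ and $F$ is real-analytic in $t$.
   Context: $\sigma^x,\sigma^z$ are Pauli matrices with copies at each site of $\mathbb{Z}$ acting on $\mathbb{C}^2$; $J,h$ are real parameters (with $h\neq 0$). The ground state $\omega$ is the unique weak* limit of the finite-volume ground states as the volume increases to $\mathbb{Z}$. *)

(* Defs.v *)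
From Stdlib Require Import Reals Arith.
Open Scope R_scope.

(* Finite volume Lambda_L = {-L, ..., L}, N = 2L+1 sites.  Site i in Lambda_L
   is stored at bit position i + L.  A basis configuration (sigma^z basis) is
   a natural number c < 2^N; bit k of c = true means sigma^z_k = +1,
   bit k = false means sigma^z_k = -1. *)
Definition nsites (L : nat) : nat := (2 * L + 1)%nat.
Definition dim (L : nat) : nat := (2 ^ nsites L)%nat.

Fixpoint rsum (n : nat) (f : nat -> R) : R :=
  match n with
  | O => 0
  | S m => rsum m f + f m
  end.

Definition spin (c k : nat) : R := if Nat.testbit c k then 1 else -1.

(* sigma^x_k sigma^x_{k+1} maps basis vector |c> to |c xor (2^k + 2^(k+1))> *)
Definition flip2 (k c : nat) : nat := Nat.lxor c (2 ^ k + 2 ^ (S k)).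

(* Action of the finite-volume (open boundary) Hamiltonian
   H_L = -J sum_{i,i+1 in Lambda_L} s^x_i s^x_{i+1} - h sum_{i in Lambda_L} s^z_i
   on a (real) vector psi given by its coordinates in the z-basis. *)
Definition Hact (J h : R) (L : nat) (psi : nat -> R) (c : nat) : R :=
  - J * rsum (nsites L - 1) (fun k => psi (flip2 k c))
  - h * rsum (nsites L) (fun k => spin c k) * psi c.

Definition norm2 (L : nat) (psi : nat -> R) : R :=
  rsum (dim L) (fun c => psi c ^ 2).

Definition energy (J h : R) (L : nat) (psi : nat -> R) : R :=
  rsum (dim L) (fun c => psi c * Hact J h L psi c).

Definition is_ground_state (J h : R) (L : nat) (psi : nat -> R) : Prop :=
  norm2 L psi = 1 /\
  forall phi : nat -> R, norm2 L phi = 1 -> energy J h L psi <= energy J h L phi.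

Definition magn (L n c : nat) : R := rsum n (fun j => spin c (L + S j)).

(* < psi, exp(t sum_{i=1}^n sigma^z_i) psi >  (the observable is diagonal) *)
Definition expect_exp (L : nat) (psi : nat -> R) (n : nat) (t : R) : R :=
  rsum (dim L) (fun c => psi c ^ 2 * exp (t * magn L n c)).

Definition real_analytic (F : R -> R) : Prop :=
  forall t0 : R, exists r : R, 0 < r /\ exists a : nat -> R,
    forall t : R, Rabs (t - t0) < r ->
      infinite_sum (fun k => a k * (t - t0) ^ k) (F t).

(* Main.v *)
(** The Jordan-Wigner transformation turns the chain into free fermions: with the
    Majorana operators A_j, D_j one has H = - sum_jk M_jk A_j D_k, M = h - J S (S the
    shift).  Since |J| < |h|, M has a polar decomposition M = O P with P bounded below
    uniformly in the volume, and the ground state psi satisfies A(O v) psi = D(v) psi for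
    all v.  Multiplying by exp(t/2 sum sigma^z) this relation determines the two-point
    matrix Q(t) = <A D> of the tilted state on the block of n sites:
    Q = (sinh t + cosh t G)(cosh t + sinh t G)^-1, where G is the block of O^T.  Hence
    Q' = 1 - Q^2 and (log Z)' = tr Q, so the moments T_k = tr Q^k / n satisfy
    T_k' = k (T_(k-1) - T_(k+1)).  By Bessel's inequality Q is a contraction, so
    |T_k| <= 1, and all derivatives of (1/n) log Z are bounded by C 4^k k! uniformly in
    t, n and the volume.  At t = 0 the T_k converge because G is asymptotically a
    Toeplitz matrix; Taylor expansion with the uniform bounds propagates convergence to
    all t in steps of length 1/8 and shows that the limit is analytic. *)
Require Import Defs.
From Stdlib Require Import Reals Lra Lia Arith ZArith.
From Stdlib Require Import FunctionalExtensionality ClassicalEpsilon.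
From Coquelicot Require Import Coquelicot.
Open Scope R_scope.

(** * Finite sums *)

(** For t different from 0 the tilted state is controlled in the l^2 sense only: Bessel's inequality
    bounds Q, but no bound is at hand for the row sums of (cosh t + sinh t G)^-1, so the locality
    behind the Toeplitz structure cannot be read off directly. At t = 0 only polynomials in G occur,
    and G arises from the banded matrix M by sums, products and geometric limits. Hence the Toeplitz
    argument is made at t = 0 alone, and other values of t are reached through derivatives. For the
    same reason the polar factor comes from two contracting iterations and not from diagonalization:
    they involve sums and products only, so in the row-sum norm, which is submultiplicative and
    dominates entries, they give local approximants with an error uniform in the volume. The rate of
    contraction is governed by (|h| - |J|)^2 > 0. Finally, the volume tends to infinity before the
    block does, so every estimate has to be uniform in L >= n. *)

Lemma rsum_ext n f g : (forall k, (k < n)%nat -> f k = g k) -> rsum n f = rsum n g.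
Proof.
  induction n as [|n IH]; simpl; intros E; [reflexivity|].
  rewrite IH, E; auto with arith.
Qed.

Lemma rsum_zero n f : (forall k, (k < n)%nat -> f k = 0) -> rsum n f = 0.
Proof.
  induction n as [|n IH]; simpl; intros E; [reflexivity|].
  rewrite IH, E; auto with arith; lra.
Qed.

Lemma rsum_plus n f g : rsum n (fun k => f k + g k) = rsum n f + rsum n g.
Proof. induction n; simpl; lra. Qed.

Lemma rsum_minus n f g : rsum n (fun k => f k - g k) = rsum n f - rsum n g.
Proof. induction n; simpl; lra. Qed.

Lemma rsum_opp n f : rsum n (fun k => - f k) = - rsum n f.
Proof. induction n; simpl; lra. Qed.

Lemma rsum_scal n a f : rsum n (fun k => a * f k) = a * rsum n f.
Proof. induction n; simpl; lra. Qed.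

Lemma rsum_scal_r n a f : rsum n (fun k => f k * a) = rsum n f * a.
Proof. induction n; simpl; lra. Qed.

Lemma rsum_const n a : rsum n (fun _ => a) = INR n * a.
Proof. induction n; [simpl; lra|]. rewrite S_INR; simpl; lra. Qed.

Lemma rsum_le n f g : (forall k, (k < n)%nat -> f k <= g k) -> rsum n f <= rsum n g.
Proof.
  induction n as [|n IH]; simpl; intros E; [lra|].
  apply Rplus_le_compat; auto with arith.
Qed.

Lemma rsum_nonneg n f : (forall k, (k < n)%nat -> 0 <= f k) -> 0 <= rsum n f.
Proof.
  intros E. rewrite <- (rsum_zero n (fun _ => 0)) by auto. now apply rsum_le.
Qed.

Lemma rsum_Rabs n f : Rabs (rsum n f) <= rsum n (fun k => Rabs (f k)).
Proof.
  induction n as [|n IH]; simpl; [rewrite Rabs_R0; lra|].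
  eapply Rle_trans; [apply Rabs_triang|lra].
Qed.

Lemma rsum_swap n m f :
  rsum n (fun i => rsum m (fun j => f i j)) = rsum m (fun j => rsum n (fun i => f i j)).
Proof.
  induction n as [|n IH]; simpl; [now rewrite rsum_zero|].
  now rewrite IH, <- rsum_plus.
Qed.

Lemma rsum_term_le n f k :
  (forall i, (i < n)%nat -> 0 <= f i) -> (k < n)%nat -> f k <= rsum n f.
Proof.
  induction n as [|n IH]; simpl; intros P Hk; [lia|].
  assert (0 <= rsum n f) by (apply rsum_nonneg; auto with arith).
  destruct (Nat.eq_dec k n) as [->|]; [lra|].
  assert (f k <= rsum n f) by (apply IH; auto with arith; lia).
  specialize (P n ltac:(lia)); lra.
Qed.

Lemma rsum_nonneg_eq0 n f k :
  (forall i, (i < n)%nat -> 0 <= f i) -> rsum n f <= 0 -> (k < n)%nat -> f k = 0.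
Proof.
  intros P S0 Hk. pose proof (rsum_term_le n f k P Hk). specialize (P k Hk). lra.
Qed.

Definition delta (i j : nat) : R := if Nat.eqb i j then 1 else 0.

Lemma delta_same i : delta i i = 1.
Proof. unfold delta; now rewrite Nat.eqb_refl. Qed.

Lemma delta_diff i j : i <> j -> delta i j = 0.
Proof. unfold delta; intros H. now rewrite (proj2 (Nat.eqb_neq i j) H). Qed.

Lemma delta_sym i j : delta i j = delta j i.
Proof. unfold delta; now rewrite Nat.eqb_sym. Qed.

Lemma rsum_delta n f k : (k < n)%nat -> rsum n (fun i => delta k i * f i) = f k.
Proof.
  induction n as [|n IH]; simpl; intros Hk; [lia|].
  destruct (Nat.eq_dec k n) as [->|].
  - rewrite delta_same, rsum_zero; [lra|].
    intros i Hi; rewrite delta_diff by lia; lra.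
  - rewrite IH, delta_diff by lia; lra.
Qed.

Lemma rsum_delta_out n f k : (n <= k)%nat -> rsum n (fun i => delta k i * f i) = 0.
Proof. intros Hk; apply rsum_zero; intros i Hi; rewrite delta_diff by lia; lra. Qed.

(** Swapping a double sum of deltas replaces an appeal to permutations: for an involution, [s c = e]
    and [s e = c] are equivalent. *)
Lemma rsum_invol n (s : nat -> nat) f :
  (forall c, (c < n)%nat -> (s c < n)%nat) -> (forall c, (c < n)%nat -> s (s c) = c) ->
  rsum n (fun c => f (s c)) = rsum n f.
Proof.
  intros Hs Hss.
  transitivity (rsum n (fun c => rsum n (fun e => delta (s c) e * f e))).
  { apply rsum_ext; intros c Hc; now rewrite rsum_delta by auto. }
  rewrite rsum_swap. apply rsum_ext; intros e He.
  rewrite rsum_scal_r.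
  rewrite (rsum_ext n _ (fun c => delta (s e) c * 1)).
  - rewrite (rsum_delta n (fun _ => 1)) by auto; lra.
  - intros c Hc. unfold delta.
    destruct (Nat.eqb_spec (s c) e) as [E|E], (Nat.eqb_spec (s e) c) as [E'|E']; try lra.
    + subst e; rewrite Hss in E' by auto; lia.
    + subst c; rewrite Hss in E by auto; lia.
Qed.

Lemma rsum_add n m f : rsum (n + m) f = rsum n f + rsum m (fun k => f (n + k)%nat).
Proof.
  induction m as [|m IH]; simpl; [rewrite Nat.add_0_r; lra|].
  rewrite Nat.add_succ_r; simpl; rewrite IH; lra.
Qed.

Lemma rsum_window N p m f :
  (p + m <= N)%nat ->
  (forall k, (k < N)%nat -> (k < p \/ p + m <= k)%nat -> f k = 0) ->
  rsum N f = rsum m (fun k => f (p + k)%nat).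
Proof.
  intros HN Hf.
  replace N with (p + m + (N - p - m))%nat by lia.
  rewrite !rsum_add, (rsum_zero p f), (rsum_zero (N - p - m)%nat).
  - lra.
  - intros k Hk; apply Hf; lia.
  - intros k Hk; apply Hf; lia.
Qed.

Lemma is_lim_seq_rsum n (u : nat -> nat -> R) (l : nat -> R) :
  (forall k, (k < n)%nat -> is_lim_seq (fun m => u m k) (l k)) ->
  is_lim_seq (fun m => rsum n (u m)) (rsum n l).
Proof.
  induction n as [|n IH]; simpl; intros H; [apply is_lim_seq_const|].
  apply (is_lim_seq_plus' (fun m => rsum n (u m)) (fun m => u m n)); auto with arith.
Qed.

Lemma is_derive_rsum n (u : nat -> R -> R) (du : nat -> R) t :
  (forall k, (k < n)%nat -> is_derive (u k) t (du k)) ->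
  is_derive (fun s => rsum n (fun k => u k s)) t (rsum n du).
Proof.
  induction n as [|n IH]; simpl; intros H; [apply @is_derive_const|].
  apply (is_derive_plus (fun s => rsum n (fun k => u k s)) (u n)); auto with arith.
Qed.

(** * Existence of finite-volume ground states *)

Lemma lt_pow2_iff c N :
  (c < 2 ^ N)%nat <-> (forall k, (N <= k)%nat -> Nat.testbit c k = false).
Proof.
  split.
  - intros Hc k Hk. destruct (Nat.eq_dec c 0) as [->|H0]; [apply Nat.bits_0|].
    apply Nat.bits_above_log2. apply Nat.log2_lt_pow2 in Hc; lia.
  - intros H. destruct (Nat.eq_dec c 0) as [->|H0].
    { pose proof (Nat.pow_nonzero 2 N); lia. }
    apply Nat.log2_lt_pow2; [lia|].
    destruct (le_lt_dec N (Nat.log2 c)) as [Hl|Hl]; [|lia].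
    pose proof (Nat.bit_log2 c H0) as B. rewrite (H _ Hl) in B; discriminate.
Qed.

Definition flip (j c : nat) : nat := Nat.lxor c (2 ^ j).

Lemma flip_testbit j c k :
  Nat.testbit (flip j c) k = if Nat.eqb k j then negb (Nat.testbit c k) else Nat.testbit c k.
Proof.
  unfold flip. rewrite Nat.lxor_spec, Nat.pow2_bits_eqb, (Nat.eqb_sym j k).
  now destruct (Nat.eqb k j), (Nat.testbit c k).
Qed.

Lemma flip_flip j c : flip j (flip j c) = c.
Proof.
  apply Nat.bits_inj; intros k. rewrite !flip_testbit.
  destruct (Nat.eqb k j); [apply Bool.negb_involutive|reflexivity].
Qed.

Lemma flip_comm j k c : flip j (flip k c) = flip k (flip j c).
Proof.
  apply Nat.bits_inj; intros l. rewrite !flip_testbit.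
  destruct (Nat.eqb l j), (Nat.eqb l k); reflexivity.
Qed.

Lemma flip_lt j c N : (j < N)%nat -> (c < 2 ^ N)%nat -> (flip j c < 2 ^ N)%nat.
Proof.
  rewrite !lt_pow2_iff. intros Hj Hc k Hk. rewrite flip_testbit.
  rewrite (proj2 (Nat.eqb_neq k j)) by lia; auto.
Qed.

Lemma flip2_flip k c : flip2 k c = flip k (flip (S k) c).
Proof.
  unfold flip2, flip. rewrite Nat.lxor_assoc. f_equal.
  rewrite Nat.add_nocarry_lxor; [apply Nat.lxor_comm|].
  apply Nat.bits_inj; intros l.
  rewrite Nat.land_spec, !Nat.pow2_bits_eqb, Nat.bits_0.
  destruct (Nat.eqb_spec k l), (Nat.eqb_spec (S k) l); simpl; auto; lia.
Qed.

Lemma rsum_flip j N f : (j < N)%nat ->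
  rsum (2 ^ N) (fun c => f (flip j c)) = rsum (2 ^ N) f.
Proof.
  intros Hj; apply rsum_invol; intros c Hc; [|apply flip_flip].
  now apply flip_lt.
Qed.

Lemma bounded_subseq_cv (u : nat -> R) :
  (forall m, Rabs (u m) <= 1) ->
  exists phi : nat -> nat, (forall m, (phi m < phi (S m))%nat) /\
    exists l : R, is_lim_seq (fun m => u (phi m)) l.
Proof.
  intros Hu.
  destruct (Bolzano_Weierstrass u (fun c => -1 <= c <= 1)) as [l Hl].
  - apply compact_P3.
  - intros m. apply Rabs_le_between, Hu.
  - assert (St : forall k N : nat, exists p, (N <= p)%nat /\ Rabs (u p - l) < / INR (S k)).
    { intros k N.
      assert (Hk : 0 < / INR (S k)) by (apply Rinv_0_lt_compat, lt_0_INR; lia).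
      destruct (Hl (disc l (mkposreal _ Hk)) N) as [p [Hp Hd]].
      - exists (mkposreal _ Hk); intros x Hx; exact Hx.
      - exists p; split; auto. }
    set (st := fun k N => proj1_sig (constructive_indefinite_description _ (St k N))).
    assert (Hst : forall k N, (N <= st k N)%nat /\ Rabs (u (st k N) - l) < / INR (S k)).
    { intros k N; exact (proj2_sig (constructive_indefinite_description _ (St k N))). }
    set (phi := fix phi m := match m with O => st 0%nat 0%nat | S k => st (S k) (S (phi k)) end).
    exists phi; split.
    { intros m; simpl; destruct (Hst (S m) (S (phi m))); lia. }
    exists l.
    assert (Hphi : forall m, Rabs (u (phi m) - l) < / INR (S m)).
    { intros [|m]; simpl phi; apply Hst. }
    apply is_lim_seq_spec; intros eps; destruct eps as [eps Heps]; simpl.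
    destruct (archimed_cor1 eps Heps) as [N [HN HN0]].
    exists N; intros m Hm. eapply Rlt_trans; [apply Hphi|].
    eapply Rle_lt_trans; [|exact HN].
    apply Rinv_le_contravar; [now apply lt_0_INR|apply le_INR; lia].
Qed.

Lemma bounded_vec_subseq_cv (d : nat) (u : nat -> nat -> R) :
  (forall m c, Rabs (u m c) <= 1) ->
  exists phi : nat -> nat, (forall m, (phi m < phi (S m))%nat) /\
    exists l : nat -> R, forall c, (c < d)%nat -> is_lim_seq (fun m => u (phi m) c) (l c).
Proof.
  intros Hu. induction d as [|d IH].
  - exists (fun m => m); split; [auto|]. exists (fun _ => 0); intros; lia.
  - destruct IH as [phi [Hphi [l Hl]]].
    destruct (bounded_subseq_cv (fun m => u (phi m) d)) as [psi [Hpsi [x Hx]]]; [auto|].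
    exists (fun m => phi (psi m)); split.
    { intros m. assert (Mono : forall a b, (a < b)%nat -> (phi a < phi b)%nat).
      { intros a b Hab; induction Hab; [auto|]. specialize (Hphi m0); lia. }
      apply Mono, Hpsi. }
    exists (fun c => if Nat.eqb c d then x else l c); intros c Hc.
    destruct (Nat.eqb_spec c d) as [->|E]; [exact Hx|].
    apply (is_lim_seq_subseq (fun m => u (phi m) c) (l c) psi).
    + now apply eventually_subseq.
    + apply Hl; lia.
Qed.

(** Vectors are functions on all of [nat], and coordinates from the dimension on are invisible to
    norm and energy. Setting them to 0 later turns operator identities into plain equalities of
    functions. *)
Definition trunc (d : nat) (f : nat -> R) (c : nat) : R := if Nat.ltb c d then f c else 0.

Lemma trunc_lt d f c : (c < d)%nat -> trunc d f c = f c.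
Proof. unfold trunc; intros Hc. now rewrite (proj2 (Nat.ltb_lt c d) Hc). Qed.

Lemma trunc_ge d f c : (d <= c)%nat -> trunc d f c = 0.
Proof. unfold trunc; intros Hc. now rewrite (proj2 (Nat.ltb_ge c d) Hc). Qed.

Lemma norm2_ext L f g : (forall c, (c < dim L)%nat -> f c = g c) -> norm2 L f = norm2 L g.
Proof. intros E; apply rsum_ext; intros; now rewrite E. Qed.

Lemma Hact_ext J h L f g c : (c < dim L)%nat ->
  (forall e, (e < dim L)%nat -> f e = g e) -> Hact J h L f c = Hact J h L g c.
Proof.
  intros Hc E. unfold Hact. rewrite (E c Hc). do 2 f_equal.
  apply rsum_ext; intros k Hk. apply E. rewrite flip2_flip.
  unfold dim in *; apply flip_lt; [lia|]. apply flip_lt; [lia|auto].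
Qed.

Lemma energy_ext J h L f g :
  (forall c, (c < dim L)%nat -> f c = g c) -> energy J h L f = energy J h L g.
Proof.
  intros E; apply rsum_ext; intros c Hc. rewrite (E c Hc), (Hact_ext J h L f g); auto.
Qed.

Lemma is_lim_seq_energy J h L (u : nat -> nat -> R) (l : nat -> R) :
  (forall c, is_lim_seq (fun m => u m c) (l c)) ->
  is_lim_seq (fun m => energy J h L (u m)) (energy J h L l).
Proof.
  intros H. unfold energy.
  apply (is_lim_seq_rsum _ (fun m c => u m c * Hact J h L (u m) c)); intros c _.
  apply (is_lim_seq_mult' (fun m => u m c)); [apply H|]. unfold Hact.
  apply (is_lim_seq_minus' (fun m => - J * rsum (nsites L - 1) (fun k => u m (flip2 k c)))).
  - apply (is_lim_seq_mult' (fun m => - J)); [apply is_lim_seq_const|].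
    apply (is_lim_seq_rsum _ (fun m k => u m (flip2 k c))); auto.
  - apply (is_lim_seq_mult' (fun m => h * rsum (nsites L) (fun k => spin c k)));
      [apply is_lim_seq_const|apply H].
Qed.

Lemma is_lim_seq_norm2 L (u : nat -> nat -> R) (l : nat -> R) :
  (forall c, is_lim_seq (fun m => u m c) (l c)) ->
  is_lim_seq (fun m => norm2 L (u m)) (norm2 L l).
Proof.
  intros H. unfold norm2.
  apply (is_lim_seq_rsum _ (fun m c => u m c ^ 2)); intros c _. simpl.
  apply (is_lim_seq_mult' (fun m => u m c) (fun m => u m c * 1)); [apply H|].
  apply (is_lim_seq_mult' (fun m => u m c) (fun m => 1)); [apply H|apply is_lim_seq_const].
Qed.

Lemma norm2_coord L f c : norm2 L f = 1 -> (c < dim L)%nat -> Rabs (f c) <= 1.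
Proof.
  intros Hf Hc.
  assert (H : f c ^ 2 <= 1).
  { rewrite <- Hf. apply (rsum_term_le (dim L) (fun c => f c ^ 2)); auto.
    intros; apply pow2_ge_0. }
  apply Rabs_le_between; nra.
Qed.

Lemma spin_sq c k : spin c k * spin c k = 1.
Proof. unfold spin; destruct (Nat.testbit c k); lra. Qed.

Lemma Rabs_spin c k : Rabs (spin c k) = 1.
Proof. unfold spin; destruct (Nat.testbit c k); split_Rabs; lra. Qed.

Lemma energy_bounded J h L : exists B, forall f, norm2 L f = 1 -> Rabs (energy J h L f) <= B.
Proof.
  exists (INR (dim L) * (Rabs J * INR (nsites L - 1) + Rabs h * INR (nsites L))).
  intros f Hf. rewrite <- rsum_const. unfold energy.
  eapply Rle_trans; [apply rsum_Rabs|]. apply rsum_le; intros c Hc.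
  rewrite Rabs_mult. pose proof (norm2_coord L f c Hf Hc) as Fc.
  assert (HH : Rabs (Hact J h L f c) <= Rabs J * INR (nsites L - 1) + Rabs h * INR (nsites L)).
  { unfold Hact. eapply Rle_trans; [apply Rabs_triang|].
    rewrite Rabs_Ropp, !Rabs_mult, Rabs_Ropp. apply Rplus_le_compat.
    - apply Rmult_le_compat_l; [apply Rabs_pos|].
      eapply Rle_trans; [apply rsum_Rabs|]. rewrite <- (Rmult_1_r (INR _)), <- rsum_const.
      apply rsum_le; intros k Hk. apply (norm2_coord L); auto. rewrite flip2_flip.
      unfold dim in *; apply flip_lt; [lia|]. apply flip_lt; [lia|auto].
    - assert (Rabs (rsum (nsites L) (fun k => spin c k)) <= INR (nsites L)).
      { eapply Rle_trans; [apply rsum_Rabs|]. rewrite <- (Rmult_1_r (INR _)), <- rsum_const.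
        apply rsum_le; intros k Hk. rewrite Rabs_spin; lra. }
      assert (0 <= Rabs h * Rabs (rsum (nsites L) (fun k => spin c k)))
        by (apply Rmult_le_pos; apply Rabs_pos).
      apply Rle_trans with (Rabs h * Rabs (rsum (nsites L) (fun k => spin c k)) * 1).
      + apply Rmult_le_compat_l; auto.
      + rewrite Rmult_1_r. apply Rmult_le_compat_l; [apply Rabs_pos|auto]. }
  pose proof (Rabs_pos (Hact J h L f c)). pose proof (Rabs_pos (f c)). nra.
Qed.

(** Compactness of the unit sphere in finite dimension. Existence matters because the hypothesis on
    [omega] speaks about sequences of ground states and yields information only once such a sequence
    is exhibited. *)
Lemma ground_state_exists J h L :
  exists psi, is_ground_state J h L psi /\ (forall c, (dim L <= c)%nat -> psi c = 0).
Proof.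
  destruct (energy_bounded J h L) as [B HB].
  (* [completeness] provides suprema, hence the sign: [- m] will be the ground state energy. *)
  set (E := fun y => exists f, norm2 L f = 1 /\ y = - energy J h L f).
  destruct (completeness E) as [m [Ub Lub]].
  - exists B; intros y [f [Hf ->]]. specialize (HB f Hf). apply Rabs_le_between in HB; lra.
  - exists (- energy J h L (delta 0)), (delta 0); split; [|reflexivity].
    unfold norm2. rewrite (rsum_ext _ _ (fun c => delta 0 c * delta 0 c)) by (intros; ring).
    rewrite rsum_delta; [apply delta_same|].
    unfold dim; pose proof (Nat.pow_nonzero 2 (nsites L)); lia.
  - assert (Ex : forall k : nat, exists f, norm2 L f = 1 /\ energy J h L f < - m + / INR (S k)).
    { intros k. apply NNPP; intros N.
      assert (Hk : 0 < / INR (S k)) by (apply Rinv_0_lt_compat, lt_0_INR; lia).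
      assert (m <= m - / INR (S k)); [|lra]. apply Lub.
      intros y [f [Hf ->]]. apply Rnot_lt_le; intros C. apply N. exists f; split; auto; lra. }
    set (v := fun k => proj1_sig (constructive_indefinite_description _ (Ex k))).
    assert (Hv : forall k, norm2 L (v k) = 1 /\ energy J h L (v k) < - m + / INR (S k)).
    { intros k; exact (proj2_sig (constructive_indefinite_description _ (Ex k))). }
    set (u := fun k => trunc (dim L) (v k)).
    assert (Hu : forall k, norm2 L (u k) = 1 /\ energy J h L (u k) < - m + / INR (S k)).
    { intros k. unfold u. rewrite (norm2_ext L _ (v k)), (energy_ext J h L _ (v k)); auto;
      intros; now apply trunc_lt. }
    destruct (bounded_vec_subseq_cv (dim L) u) as [phi [Hphi [l Hl]]].
    { intros k c. destruct (le_lt_dec (dim L) c) as [Hc|Hc].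
      - unfold u; rewrite trunc_ge, Rabs_R0 by auto; lra.
      - apply (norm2_coord L); auto; apply Hu. }
    exists (trunc (dim L) l).
    assert (Cv : forall c, is_lim_seq (fun k => u (phi k) c) (trunc (dim L) l c)).
    { intros c. destruct (le_lt_dec (dim L) c) as [Hc|Hc].
      - rewrite trunc_ge by auto. apply is_lim_seq_ext with (fun _ => 0); [|apply is_lim_seq_const].
        intros k; unfold u; now rewrite trunc_ge.
      - rewrite trunc_lt by auto. now apply Hl. }
    split; [split|intros; now apply trunc_ge].
    + pose proof (is_lim_seq_norm2 L _ _ Cv) as C1.
      apply is_lim_seq_unique in C1.
      rewrite (Lim_seq_ext _ (fun _ => 1)), Lim_seq_const in C1 by (intros; apply Hu).
      now injection C1.
    + intros g Hg. apply Rle_trans with (- m).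
      * pose proof (is_lim_seq_energy J h L _ _ Cv) as C1.
        assert (C2 : is_lim_seq (fun k => - m + / INR (S k)) (- m + 0)).
        { apply (is_lim_seq_plus' (fun _ => - m)); [apply is_lim_seq_const|].
          apply (is_lim_seq_incr_1 (fun k => / INR k)).
          replace (Finite 0) with (Rbar_inv p_infty) by reflexivity.
          apply is_lim_seq_inv; [apply is_lim_seq_INR|discriminate]. }
        rewrite Rplus_0_r in C2.
        apply (is_lim_seq_subseq _ _ phi (eventually_subseq phi Hphi)) in C2.
        exact (is_lim_seq_le _ _ (energy J h L (trunc (dim L) l)) (- m)
                 (fun k => Rlt_le _ _ (proj2 (Hu (phi k)))) C1 C2).
      * assert (- energy J h L g <= m); [|lra]. apply Ub. exists g; auto.
Qed.

(** * Jordan-Wigner transformation *)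

Fixpoint jw (j c : nat) : R :=
  match j with O => 1 | S k => jw k c * spin c k end.

(* Jordan-Wigner: the real Majorana operators A_j = s^z_0 ... s^z_{j-1} s^x_j and
   D_j = A_j s^z_j, so that A_j^2 = 1, D_j^2 = -1 and A_j D_j = s^z_j. *)
Definition majA (j : nat) (f : nat -> R) (c : nat) : R := jw j c * f (flip j c).
Definition majD (j : nat) (f : nat -> R) (c : nat) : R := - jw j c * spin c j * f (flip j c).

Lemma jw_sq j c : jw j c * jw j c = 1.
Proof.
  induction j as [|j IH]; simpl; [lra|].
  replace (jw j c * spin c j * (jw j c * spin c j))
    with ((jw j c * jw j c) * (spin c j * spin c j)) by ring.
  rewrite IH, spin_sq; ring.
Qed.

Lemma spin_flip j c k : spin (flip j c) k = if Nat.eqb k j then - spin c k else spin c k.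
Proof.
  unfold spin; rewrite flip_testbit.
  destruct (Nat.eqb k j); [|reflexivity]. destruct (Nat.testbit c k); simpl; lra.
Qed.

Lemma spin_flip_same j c : spin (flip j c) j = - spin c j.
Proof. now rewrite spin_flip, Nat.eqb_refl. Qed.

Lemma spin_flip_diff j c k : k <> j -> spin (flip j c) k = spin c k.
Proof. intros H; rewrite spin_flip. now rewrite (proj2 (Nat.eqb_neq k j) H). Qed.

Lemma jw_flip_le j c k : (k <= j)%nat -> jw k (flip j c) = jw k c.
Proof.
  induction k as [|k IH]; simpl; intros Hk; [reflexivity|].
  rewrite IH, spin_flip_diff by lia; reflexivity.
Qed.

Lemma jw_flip_gt j c k : (j < k)%nat -> jw k (flip j c) = - jw k c.
Proof.
  induction k as [|k IH]; simpl; intros Hk; [lia|].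
  destruct (Nat.eq_dec k j) as [->|].
  - rewrite jw_flip_le, spin_flip_same by lia; ring.
  - rewrite IH, spin_flip_diff by lia; ring.
Qed.

Lemma majA_majA_same j f : majA j (majA j f) = f.
Proof.
  extensionality c; unfold majA.
  rewrite jw_flip_le, flip_flip, <- Rmult_assoc, jw_sq by lia; ring.
Qed.

Lemma majD_majD_same j f : majD j (majD j f) = fun c => - f c.
Proof.
  extensionality c; unfold majD.
  rewrite jw_flip_le, flip_flip, spin_flip_same by lia.
  transitivity (- (jw j c * jw j c) * (spin c j * spin c j) * f c); [ring|].
  rewrite jw_sq, spin_sq; ring.
Qed.

Lemma majA_majD_same j f c : majA j (majD j f) c = spin c j * f c.
Proof.
  unfold majA, majD. rewrite jw_flip_le, flip_flip, spin_flip_same by lia.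
  transitivity ((jw j c * jw j c) * spin c j * f c); [ring|].
  rewrite jw_sq; ring.
Qed.

Lemma majA_majA_diff j k f : j <> k -> majA j (majA k f) = fun c => - majA k (majA j f) c.
Proof.
  intros H; extensionality c; unfold majA. rewrite (flip_comm j k).
  destruct (lt_dec j k).
  - rewrite (jw_flip_gt j c k), (jw_flip_le k c j) by lia; ring.
  - rewrite (jw_flip_le j c k), (jw_flip_gt k c j) by lia; ring.
Qed.

Lemma majD_majD_diff j k f : j <> k -> majD j (majD k f) = fun c => - majD k (majD j f) c.
Proof.
  intros H; extensionality c; unfold majD.
  rewrite (flip_comm j k), (spin_flip_diff j c k), (spin_flip_diff k c j) by lia.
  destruct (lt_dec j k).
  - rewrite (jw_flip_gt j c k), (jw_flip_le k c j) by lia; ring.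
  - rewrite (jw_flip_le j c k), (jw_flip_gt k c j) by lia; ring.
Qed.

Lemma majD_majA j k f : majD j (majA k f) = fun c => - majA k (majD j f) c.
Proof.
  extensionality c; unfold majA, majD. rewrite (flip_comm j k).
  destruct (lt_eq_lt_dec j k) as [[|<-]|].
  - rewrite (jw_flip_gt j c k), (jw_flip_le k c j), (spin_flip_diff k c j) by lia; ring.
  - rewrite !jw_flip_le, spin_flip_same by lia; ring.
  - rewrite (jw_flip_le j c k), (jw_flip_gt k c j), (spin_flip_diff k c j) by lia; ring.
Qed.

(** The sign strings of neighbouring sites cancel except for the sign at k, which the extra factor
    in D_k absorbs. This is why the bond term becomes quadratic in the Majorana operators. *)
Lemma flip2_maj k f c : f (flip2 k c) = - majA (S k) (majD k f) c.
Proof.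
  unfold majA, majD. rewrite flip2_flip. simpl.
  rewrite (jw_flip_le (S k) c k), (spin_flip_diff (S k) c k) by lia.
  transitivity ((jw k c * jw k c) * (spin c k * spin c k) * f (flip k (flip (S k) c))); [|ring].
  rewrite jw_sq, spin_sq; ring.
Qed.

(** * Inner product, adjoints and orthogonality of the Majorana vectors *)

Definition ip (d : nat) (f g : nat -> R) : R := rsum d (fun c => f c * g c).

Lemma ip_sym d f g : ip d f g = ip d g f.
Proof. apply rsum_ext; intros; ring. Qed.

Lemma ip_opp_r d f g : ip d f (fun c => - g c) = - ip d f g.
Proof. unfold ip. rewrite <- rsum_opp. apply rsum_ext; intros; ring. Qed.

Lemma ip_plus_r d f g g' : ip d f (fun c => g c + g' c) = ip d f g + ip d f g'.
Proof. unfold ip. rewrite <- rsum_plus. apply rsum_ext; intros; ring. Qed.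

Lemma ip_minus_r d f g g' : ip d f (fun c => g c - g' c) = ip d f g - ip d f g'.
Proof. unfold ip. rewrite <- rsum_minus. apply rsum_ext; intros; ring. Qed.

Lemma ip_scal_r d f a g : ip d f (fun c => a * g c) = a * ip d f g.
Proof. unfold ip. rewrite <- rsum_scal. apply rsum_ext; intros; ring. Qed.

Lemma ip_rsum_r d f n (g : nat -> nat -> R) :
  ip d f (fun c => rsum n (fun k => g k c)) = rsum n (fun k => ip d f (g k)).
Proof.
  unfold ip. rewrite rsum_swap. apply rsum_ext; intros. now rewrite rsum_scal.
Qed.

Lemma ip_minus_l d f f' g : ip d (fun c => f c - f' c) g = ip d f g - ip d f' g.
Proof. now rewrite ip_sym, ip_minus_r, !(ip_sym d g). Qed.

Lemma ip_plus_l d f f' g : ip d (fun c => f c + f' c) g = ip d f g + ip d f' g.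
Proof. now rewrite ip_sym, ip_plus_r, !(ip_sym d g). Qed.

Lemma ip_scal_l d a f g : ip d (fun c => a * f c) g = a * ip d f g.
Proof. now rewrite ip_sym, ip_scal_r, ip_sym. Qed.

Lemma ip_rsum_l d n (f : nat -> nat -> R) g :
  ip d (fun c => rsum n (fun k => f k c)) g = rsum n (fun k => ip d (f k) g).
Proof. rewrite ip_sym, ip_rsum_r. apply rsum_ext; intros; apply ip_sym. Qed.

Lemma ip_pos d f : 0 <= ip d f f.
Proof. apply rsum_nonneg; intros; nra. Qed.

Lemma ip_eq0 d f : ip d f f <= 0 -> forall c, (c < d)%nat -> f c = 0.
Proof.
  intros H c Hc.
  assert (f c * f c = 0); [|nra].
  apply (rsum_nonneg_eq0 d (fun c => f c * f c)); auto. intros; nra.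
Qed.

Lemma ip_majA N j f g : (j < N)%nat -> ip (2 ^ N) (majA j f) g = ip (2 ^ N) f (majA j g).
Proof.
  intros Hj. unfold ip. rewrite <- (rsum_flip j N (fun c => f c * majA j g c)) by auto.
  apply rsum_ext; intros c _. unfold majA. rewrite jw_flip_le, flip_flip by lia; ring.
Qed.

Lemma ip_majD N j f g : (j < N)%nat -> ip (2 ^ N) (majD j f) g = - ip (2 ^ N) f (majD j g).
Proof.
  intros Hj. unfold ip. rewrite <- (rsum_flip j N (fun c => f c * majD j g c)) by auto.
  rewrite <- rsum_opp.
  apply rsum_ext; intros c _. unfold majD.
  rewrite jw_flip_le, flip_flip, spin_flip_same by lia; ring.
Qed.

(** For distinct sites, self-adjointness and anticommutation make the inner product equal to its own
    negative. With the analogue for D this is the orthogonality behind Bessel's inequality. *)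
Lemma ip_majA_majA N i j f : (i < N)%nat -> (j < N)%nat ->
  ip (2 ^ N) (majA i f) (majA j f) = delta i j * ip (2 ^ N) f f.
Proof.
  intros Hi Hj. destruct (Nat.eq_dec i j) as [->|E].
  - rewrite delta_same, ip_majA, majA_majA_same by auto; ring.
  - rewrite delta_diff by auto.
    assert (ip (2 ^ N) (majA i f) (majA j f) = - ip (2 ^ N) (majA j f) (majA i f)).
    { rewrite !ip_majA, majA_majA_diff, ip_opp_r by auto; ring. }
    rewrite (ip_sym _ (majA j f)) in H; lra.
Qed.

Lemma ip_majD_majD N i j f : (i < N)%nat -> (j < N)%nat ->
  ip (2 ^ N) (majD i f) (majD j f) = delta i j * ip (2 ^ N) f f.
Proof.
  intros Hi Hj. destruct (Nat.eq_dec i j) as [->|E].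
  - rewrite delta_same, ip_majD, majD_majD_same, ip_opp_r by auto; ring.
  - rewrite delta_diff by auto.
    assert (ip (2 ^ N) (majD i f) (majD j f) = - ip (2 ^ N) (majD j f) (majD i f)).
    { rewrite !ip_majD, majD_majD_diff, ip_opp_r by auto; ring. }
    rewrite (ip_sym _ (majD j f)) in H; lra.
Qed.

Lemma majA_lin n j (a : nat -> R) (g : nat -> nat -> R) :
  majA j (fun c => rsum n (fun k => a k * g k c)) = fun c => rsum n (fun k => a k * majA j (g k) c).
Proof.
  extensionality c; unfold majA. rewrite <- rsum_scal. apply rsum_ext; intros; ring.
Qed.

Lemma majD_lin n j (a : nat -> R) (g : nat -> nat -> R) :
  majD j (fun c => rsum n (fun k => a k * g k c)) = fun c => rsum n (fun k => a k * majD j (g k) c).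
Proof.
  extensionality c; unfold majD. rewrite <- rsum_scal. apply rsum_ext; intros; ring.
Qed.

Definition combA (N : nat) (u : nat -> R) (f : nat -> R) (c : nat) : R :=
  rsum N (fun j => u j * majA j f c).
Definition combD (N : nat) (u : nat -> R) (f : nat -> R) (c : nat) : R :=
  rsum N (fun j => u j * majD j f c).

Definition hopM (J h : R) (N j k : nat) : R :=
  if andb (Nat.ltb j N) (Nat.ltb k N) then h * delta j k - J * delta j (S k) else 0.

Definition hamM (M : nat -> nat -> R) (N : nat) (f : nat -> R) (c : nat) : R :=
  rsum N (fun j => rsum N (fun k => - M j k * majA j (majD k f) c)).

Lemma hopM_in J h N j k : (j < N)%nat -> (k < N)%nat ->
  hopM J h N j k = h * delta j k - J * delta j (S k).
Proof.
  intros Hj Hk; unfold hopM.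
  now rewrite (proj2 (Nat.ltb_lt _ _) Hj), (proj2 (Nat.ltb_lt _ _) Hk).
Qed.

Lemma Hact_hamM J h L f : Hact J h L f = hamM (hopM J h (nsites L)) (nsites L) f.
Proof.
  extensionality c. unfold Hact, hamM. set (N := nsites L).
  rewrite rsum_swap.
  transitivity (rsum N (fun k => (if Nat.ltb k (N - 1) then J * majA (S k) (majD k f) c else 0)
                                 - h * spin c k * f c)).
  - rewrite rsum_minus. f_equal.
    + rewrite (rsum_window N 0 (N - 1)); [|lia|].
      * rewrite <- rsum_scal. apply rsum_ext; intros k Hk. simpl.
        rewrite (proj2 (Nat.ltb_lt _ _) Hk), flip2_maj; ring.
      * intros k Hk [|]; [lia|]. now rewrite (proj2 (Nat.ltb_ge k (N - 1))) by lia.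
    + rewrite (Rmult_assoc h), <- rsum_scal_r, <- rsum_scal.
      apply rsum_ext; intros; ring.
  - apply rsum_ext; intros k Hk.
    rewrite (rsum_ext N _ (fun j => delta k j * (- h * majA j (majD k f) c)
              + delta (S k) j * (J * majA j (majD k f) c))).
    + rewrite rsum_plus, rsum_delta by auto. rewrite majA_majD_same.
      destruct (Nat.ltb_spec k (N - 1)).
      * rewrite rsum_delta by lia; ring.
      * rewrite rsum_delta_out by lia; ring.
    + intros j Hj. rewrite hopM_in by auto.
      rewrite (delta_sym k j), (delta_sym (S k) j); ring.
Qed.

(** * Quadratic Hamiltonians: commutators, symmetry, eigenvalue equation *)

Section Ham.

Variables (M : nat -> nat -> R) (N : nat).
Let d := (2 ^ N)%nat.

(** The commutator of a quadratic form with a Majorana operator is linear: moving A_l to the left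
    through A_j D_k costs two signs unless j = l, so only row l of M survives. *)
Lemma hamM_majA l f c : (l < N)%nat ->
  hamM M N (majA l f) c = majA l (hamM M N f) c + 2 * rsum N (fun k => M l k * majD k f c).
Proof.
  intros Hl. unfold hamM at 1.
  transitivity (rsum N (fun j => majA l (fun e => rsum N (fun k => - M j k * majA j (majD k f) e)) c
     + delta l j * (2 * rsum N (fun k => M j k * majD k f c)))).
  - apply rsum_ext; intros j Hj. rewrite majA_lin, <- !rsum_scal, <- rsum_plus.
    apply rsum_ext; intros k Hk.
    change (fun c0 => majA j (majD k f) c0) with (majA j (majD k f)). rewrite majD_majA.
    assert (R1 : majA j (fun c => - majA l (majD k f) c) = fun c => - majA j (majA l (majD k f)) c).
    { extensionality e; unfold majA; ring. }
    rewrite R1. destruct (Nat.eq_dec l j) as [<-|E].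
    + rewrite delta_same, majA_majA_same. cbv beta; ring.
    + rewrite delta_diff, (majA_majA_diff j l) by auto. cbv beta; ring.
  - rewrite rsum_plus, rsum_delta by auto. f_equal.
    change (majA l (hamM M N f) c) with
      (jw l c * rsum N (fun j => rsum N (fun k => - M j k * majA j (majD k f) (flip l c)))).
    now rewrite <- rsum_scal.
Qed.

Lemma hamM_majD l f c : (l < N)%nat ->
  hamM M N (majD l f) c = majD l (hamM M N f) c + 2 * rsum N (fun j => M j l * majA j f c).
Proof.
  intros Hl. unfold hamM at 1.
  transitivity (rsum N (fun j => majD l (fun e => rsum N (fun k => - M j k * majA j (majD k f) e)) c
     + 2 * (M j l * majA j f c))).
  - apply rsum_ext; intros j Hj. rewrite majD_lin.
    rewrite <- (rsum_delta N (fun k => 2 * (M j k * majA j f c)) l Hl), <- rsum_plus.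
    apply rsum_ext; intros k Hk.
    change (fun c0 => majA j (majD k f) c0) with (majA j (majD k f)). rewrite majD_majA.
    destruct (Nat.eq_dec l k) as [<-|E].
    + rewrite delta_same, majD_majD_same. unfold majA; ring.
    + rewrite delta_diff, (majD_majD_diff k l) by auto. unfold majA; ring.
  - rewrite rsum_plus, rsum_scal. f_equal.
    change (majD l (hamM M N f) c) with (- jw l c * spin c l *
      rsum N (fun j => rsum N (fun k => - M j k * majA j (majD k f) (flip l c)))).
    now rewrite <- rsum_scal.
Qed.

Lemma hamM_lin n (a : nat -> R) (g : nat -> nat -> R) c :
  hamM M N (fun c => rsum n (fun k => a k * g k c)) c = rsum n (fun k => a k * hamM M N (g k) c).
Proof.
  unfold hamM.
  rewrite (rsum_ext n _ (fun i => rsum N (fun j => a i * rsum N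
     (fun k => - M j k * majA j (majD k (g i)) c)))) by (intros; now rewrite rsum_scal).
  rewrite (rsum_swap n N). apply rsum_ext; intros j _.
  rewrite (rsum_ext n _ (fun i => rsum N
     (fun k => a i * (- M j k * majA j (majD k (g i)) c)))) by (intros; now rewrite rsum_scal).
  rewrite (rsum_swap n N). apply rsum_ext; intros k _.
  rewrite majD_lin, majA_lin, <- rsum_scal. apply rsum_ext; intros i _.
  change (fun c0 => majD k (g i) c0) with (majD k (g i)); ring.
Qed.

Lemma hamM_sym f g : ip d f (hamM M N g) = ip d (hamM M N f) g.
Proof.
  unfold hamM. rewrite ip_rsum_r, ip_rsum_l. apply rsum_ext; intros j Hj.
  rewrite ip_rsum_r, ip_rsum_l. apply rsum_ext; intros k Hk.
  rewrite ip_scal_r, ip_scal_l. f_equal. unfold d.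
  rewrite <- ip_majA by auto.
  assert (ip (2 ^ N) (majA j f) (majD k g) = - ip (2 ^ N) (majD k (majA j f)) g)
    by (rewrite ip_majD by auto; ring).
  rewrite H, majD_majA, ip_sym, ip_opp_r, ip_sym; ring.
Qed.

Definition supp (f : nat -> R) := forall c, (d <= c)%nat -> f c = 0.

Lemma flip_ge j c : (j < N)%nat -> (d <= c)%nat -> (d <= flip j c)%nat.
Proof.
  intros Hj Hc. destruct (le_lt_dec d (flip j c)) as [|H]; [auto|].
  apply (flip_lt j) in H; auto. rewrite flip_flip in H; unfold d in *; lia.
Qed.

Lemma supp_majA j f : (j < N)%nat -> supp f -> supp (majA j f).
Proof. intros Hj Hf c Hc. unfold majA. rewrite Hf; [ring|]. now apply flip_ge. Qed.

Lemma supp_majD j f : (j < N)%nat -> supp f -> supp (majD j f).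
Proof. intros Hj Hf c Hc. unfold majD. rewrite Hf; [ring|]. now apply flip_ge. Qed.

Lemma supp_hamM f : supp f -> supp (hamM M N f).
Proof.
  intros Hf c Hc. unfold hamM.
  apply rsum_zero; intros j Hj; apply rsum_zero; intros k Hk.
  rewrite (supp_majA j (majD k f) Hj); [ring| |auto]. now apply supp_majD.
Qed.

Lemma supp_null f : supp f -> ip d f f <= 0 -> f = fun _ => 0.
Proof.
  intros Hf H; extensionality c. destruct (le_lt_dec d c); [now apply Hf|].
  now apply (ip_eq0 d).
Qed.

(* First variation of the Rayleigh quotient in the direction H psi - E psi. *)
Lemma ground_state_eigen psi E :
  supp psi -> ip d psi (hamM M N psi) = E * ip d psi psi ->
  (forall f, E * ip d f f <= ip d f (hamM M N f)) ->
  hamM M N psi = fun c => E * psi c.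
Proof.
  intros Hs HE Hmin.
  set (g := fun c => hamM M N psi c - E * psi c).
  assert (G0 : g = fun _ => 0).
  { apply supp_null.
    { intros c Hc; unfold g. rewrite supp_hamM, Hs by auto; ring. }
    assert (Var : forall e, 0 <= 2 * e * ip d g g + e ^ 2 * (ip d g (hamM M N g) - E * ip d g g)).
    { intros e. specialize (Hmin (fun c => psi c + e * g c)).
      assert (Hl : hamM M N (fun c => psi c + e * g c)
                   = fun c => hamM M N psi c + e * hamM M N g c).
      { extensionality c.
        pose proof (hamM_lin 2 (fun k => match k with O => 1 | _ => e end)
          (fun k => match k with O => psi | _ => g end) c) as K. simpl in K.
        rewrite Rplus_0_l, Rmult_1_l in K. rewrite <- K.
        f_equal. extensionality x; ring. }
      rewrite Hl, !ip_plus_l, !ip_plus_r, !ip_scal_l, !ip_scal_r in Hmin.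
      rewrite HE, (hamM_sym psi g), (ip_sym d (hamM M N psi) g), (ip_sym d psi g) in Hmin.
      assert (Gg : ip d g g = ip d g (hamM M N psi) - E * ip d g psi).
      { unfold g at 2. rewrite ip_minus_r, ip_scal_r; ring. }
      rewrite Gg at 1. nra. }
    set (a := ip d g g) in *. set (b := ip d g (hamM M N g) - E * a) in *.
    apply Rnot_lt_le; intros Ha.
    (* A step against the residual [g], short enough that the quadratic term cannot compensate the
       linear one: [b - 2 * (1 + Rabs b)] is negative whatever the sign of [b]. *)
    pose proof (Var (- a / (1 + Rabs b))) as V.
    assert (Hb : 0 < 1 + Rabs b) by (pose proof (Rabs_pos b); lra).
    replace (2 * (- a / (1 + Rabs b)) * a + (- a / (1 + Rabs b)) ^ 2 * b)
      with ((a / (1 + Rabs b)) ^ 2 * (b - 2 * (1 + Rabs b))) in V by (field; lra).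
    assert (0 < (a / (1 + Rabs b)) ^ 2) by (apply pow_lt, Rdiv_lt_0_compat; lra).
    pose proof (Rle_abs b). nra. }
  extensionality c. pose proof (f_equal (fun u => u c) G0) as K. unfold g in K. simpl in K. lra.
Qed.

End Ham.

(** * Matrix square roots by local iterations *)

Definition mat := nat -> nat -> R.
Definition mm (N : nat) (A B : mat) : mat := fun i j => rsum N (fun k => A i k * B k j).
Definition mv (N : nat) (A : mat) (v : nat -> R) : nat -> R := fun i => rsum N (fun k => A i k * v k).
Definition mtr (A : mat) : mat := fun i j => A j i.
Definition madd (A B : mat) : mat := fun i j => A i j + B i j.
Definition msub (A B : mat) : mat := fun i j => A i j - B i j.
Definition mscal (a : R) (A : mat) : mat := fun i j => a * A i j.
Definition mzero : mat := fun _ _ => 0.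
Definition mid (N : nat) : mat := fun i j => if Nat.ltb i N then delta i j else 0.
(** Matrices are functions on all pairs of indices. Vanishing outside the block makes the laws of
    the identity matrix equalities of functions, available for rewriting. *)
Definition inN (N : nat) (A : mat) := forall i j, (N <= i \/ N <= j)%nat -> A i j = 0.
(* Operator norm on l^infinity. *)
Definition rnorm (N : nat) (A : mat) (C : R) :=
  forall i, (i < N)%nat -> rsum N (fun j => Rabs (A i j)) <= C.

Ltac mext := let i := fresh "i" in let j := fresh "j" in extensionality i; extensionality j.

Section Matrices.
Variable N : nat.
Implicit Types A B C : mat.

Lemma mm_assoc A B C : mm N (mm N A B) C = mm N A (mm N B C).
Proof.
  mext; unfold mm.
  rewrite (rsum_ext N _ (fun k => rsum N (fun l => A i l * B l k * C k j)))
    by (intros; now rewrite rsum_scal_r).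
  rewrite rsum_swap. apply rsum_ext; intros l _. rewrite <- rsum_scal.
  apply rsum_ext; intros; ring.
Qed.

Lemma mm_add_l A B C : mm N (madd A B) C = madd (mm N A C) (mm N B C).
Proof. mext; unfold mm, madd. rewrite <- rsum_plus. apply rsum_ext; intros; ring. Qed.
Lemma mm_add_r A B C : mm N A (madd B C) = madd (mm N A B) (mm N A C).
Proof. mext; unfold mm, madd. rewrite <- rsum_plus. apply rsum_ext; intros; ring. Qed.
Lemma mm_sub_l A B C : mm N (msub A B) C = msub (mm N A C) (mm N B C).
Proof. mext; unfold mm, msub. rewrite <- rsum_minus. apply rsum_ext; intros; ring. Qed.
Lemma mm_sub_r A B C : mm N A (msub B C) = msub (mm N A B) (mm N A C).
Proof. mext; unfold mm, msub. rewrite <- rsum_minus. apply rsum_ext; intros; ring. Qed.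
Lemma mm_scal_l a A B : mm N (mscal a A) B = mscal a (mm N A B).
Proof. mext; unfold mm, mscal. rewrite <- rsum_scal. apply rsum_ext; intros; ring. Qed.
Lemma mm_scal_r a A B : mm N A (mscal a B) = mscal a (mm N A B).
Proof. mext; unfold mm, mscal. rewrite <- rsum_scal. apply rsum_ext; intros; ring. Qed.
Lemma mm_tr A B : mtr (mm N A B) = mm N (mtr B) (mtr A).
Proof. mext; unfold mm, mtr. apply rsum_ext; intros; ring. Qed.

Lemma mm_zero_r A : mm N A mzero = mzero.
Proof. mext; unfold mm, mzero. apply rsum_zero; intros; ring. Qed.
Lemma mm_zero_l A : mm N mzero A = mzero.
Proof. mext; unfold mm, mzero. apply rsum_zero; intros; ring. Qed.

Lemma mid_in i j : (i < N)%nat -> mid N i j = delta i j.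
Proof. unfold mid; intros H. now rewrite (proj2 (Nat.ltb_lt i N) H). Qed.

Lemma mid_tr : mtr (mid N) = mid N.
Proof.
  mext; unfold mtr, mid, delta. rewrite Nat.eqb_sym.
  destruct (Nat.eqb_spec i j) as [->|]; [reflexivity|].
  now destruct (Nat.ltb j N), (Nat.ltb i N).
Qed.

Lemma mm_id_l A : inN N A -> mm N (mid N) A = A.
Proof.
  intros HA; mext; unfold mm. destruct (le_lt_dec N i) as [H|H].
  - rewrite rsum_zero; [rewrite HA; auto|]. intros k Hk. unfold mid.
    rewrite (proj2 (Nat.ltb_ge i N) H); ring.
  - rewrite <- (rsum_delta N (fun k => A k j) i H). apply rsum_ext; intros k _.
    now rewrite mid_in.
Qed.

Lemma inN_tr A : inN N A -> inN N (mtr A).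
Proof. intros HA i j H; apply HA; tauto. Qed.

Lemma mm_id_r A : inN N A -> mm N A (mid N) = A.
Proof.
  intros HA. apply inN_tr in HA. apply mm_id_l in HA.
  apply (f_equal mtr) in HA. rewrite mm_tr, mid_tr in HA. exact HA.
Qed.

Lemma inN_mm A B : inN N A -> inN N B -> inN N (mm N A B).
Proof.
  intros HA HB i j [H|H]; apply rsum_zero; intros k _; [rewrite HA|rewrite HB]; auto; ring.
Qed.

Lemma inN_mid : inN N (mid N).
Proof.
  intros i j H. unfold mid. destruct (Nat.ltb_spec i N); [|reflexivity].
  apply delta_diff; lia.
Qed.

Lemma mv_mm A B v : mv N (mm N A B) v = mv N A (mv N B v).
Proof.
  extensionality i; unfold mv, mm.
  rewrite (rsum_ext N _ (fun k => rsum N (fun l => A i l * B l k * v k)))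
    by (intros; now rewrite rsum_scal_r).
  rewrite rsum_swap. apply rsum_ext; intros l _. rewrite <- rsum_scal.
  apply rsum_ext; intros; ring.
Qed.

Lemma rnorm_le A a b : a <= b -> rnorm N A a -> rnorm N A b.
Proof. intros H HA i Hi. specialize (HA i Hi); lra. Qed.

Lemma rnorm_mm A B a b : 0 <= b -> rnorm N A a -> rnorm N B b -> rnorm N (mm N A B) (a * b).
Proof.
  intros Hb HA HB i Hi. unfold mm.
  apply Rle_trans with (rsum N (fun j => rsum N (fun k => Rabs (A i k) * Rabs (B k j)))).
  - apply rsum_le; intros j Hj. eapply Rle_trans; [apply rsum_Rabs|].
    apply rsum_le; intros k Hk. rewrite Rabs_mult; lra.
  - rewrite rsum_swap. apply Rle_trans with (rsum N (fun k => Rabs (A i k) * b)).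
    + apply rsum_le; intros k Hk. rewrite rsum_scal.
      apply Rmult_le_compat_l; [apply Rabs_pos|now apply HB].
    + rewrite rsum_scal_r. apply Rmult_le_compat_r; [auto|now apply HA].
Qed.

Lemma rnorm_add A B a b : rnorm N A a -> rnorm N B b -> rnorm N (madd A B) (a + b).
Proof.
  intros HA HB i Hi. unfold madd.
  apply Rle_trans with (rsum N (fun j => Rabs (A i j) + Rabs (B i j))).
  - apply rsum_le; intros; apply Rabs_triang.
  - rewrite rsum_plus. specialize (HA i Hi); specialize (HB i Hi); lra.
Qed.

Lemma rnorm_scal c A a : rnorm N A a -> rnorm N (mscal c A) (Rabs c * a).
Proof.
  intros HA i Hi. unfold mscal.
  rewrite (rsum_ext N _ (fun j => Rabs c * Rabs (A i j))) by (intros; apply Rabs_mult).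
  rewrite rsum_scal. apply Rmult_le_compat_l; [apply Rabs_pos|now apply HA].
Qed.

Lemma rnorm_zero : rnorm N mzero 0.
Proof. intros i Hi. unfold mzero. rewrite rsum_zero; [lra|]. intros; apply Rabs_R0. Qed.

Lemma rnorm_mid : rnorm N (mid N) 1.
Proof.
  intros i Hi. rewrite (rsum_ext N _ (fun j => delta i j * 1)).
  - rewrite (rsum_delta N (fun _ => 1)) by auto; lra.
  - intros j _. rewrite mid_in by auto. unfold delta.
    destruct (Nat.eqb i j); rewrite ?Rabs_R0, ?Rabs_R1; ring.
Qed.

Lemma rnorm_entry A a i j : rnorm N A a -> (i < N)%nat -> (j < N)%nat -> Rabs (A i j) <= a.
Proof.
  intros HA Hi Hj. eapply Rle_trans; [|apply (HA i Hi)].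
  apply (rsum_term_le N (fun j => Rabs (A i j))); auto. intros; apply Rabs_pos.
Qed.

Definition mlim (Z : nat -> mat) : mat := fun i j => real (Lim_seq (fun m => Z m i j)).

Section Limit.
Variables (Z : nat -> mat) (C q : R).
Hypothesis (Hq : 0 <= q < 1) (HC : 0 <= C).
Hypothesis HZ : forall m, rnorm N (msub (Z (S m)) (Z m)) (C * q ^ m).

Lemma geom_tail m k : rnorm N (msub (Z (m + k)%nat) (Z m)) (C * q ^ m / (1 - q)).
Proof.
  (* The induction carries the exact partial geometric sum; the factor [1 - q ^ k] is dropped only
     afterwards. *)
  assert (H : rnorm N (msub (Z (m + k)%nat) (Z m)) (C * q ^ m * (1 - q ^ k) / (1 - q))).
  { induction k as [|k IH].
    - rewrite Nat.add_0_r. intros i Hi. rewrite rsum_zero.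
      + simpl; apply Req_le; field; lra.
      + intros j _. unfold msub. rewrite Rminus_diag; apply Rabs_R0.
    - replace (msub (Z (m + S k)%nat) (Z m))
        with (madd (msub (Z (S (m + k))) (Z (m + k)%nat)) (msub (Z (m + k)%nat) (Z m))).
      + replace (C * q ^ m * (1 - q ^ S k) / (1 - q))
          with (C * q ^ (m + k) + C * q ^ m * (1 - q ^ k) / (1 - q)).
        * apply rnorm_add; auto.
        * rewrite pow_add; simpl; field; lra.
      + rewrite Nat.add_succ_r. mext; unfold madd, msub; ring. }
  apply rnorm_le with (2 := H).
  apply Rmult_le_compat_r; [apply Rlt_le, Rinv_0_lt_compat; lra|].
  assert (0 <= q ^ k) by (apply pow_le; lra).
  assert (0 <= C * q ^ m) by (apply Rmult_le_pos; [lra|apply pow_le; lra]). nra.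
Qed.

Lemma mlim_cv i j : (i < N)%nat -> (j < N)%nat -> is_lim_seq (fun m => Z m i j) (mlim Z i j).
Proof.
  intros Hi Hj. apply Lim_seq_correct'. apply ex_lim_seq_cauchy_corr.
  intros eps; destruct eps as [eps Heps]; simpl.
  assert (L : is_lim_seq (fun m => C * q ^ m / (1 - q)) 0).
  { replace (Finite 0) with (Finite (C / (1 - q) * 0)) by (f_equal; ring).
    apply is_lim_seq_ext with (fun m => C / (1 - q) * q ^ m); [intros; field; lra|].
    apply (is_lim_seq_mult' (fun _ => C / (1 - q))); [apply is_lim_seq_const|].
    apply is_lim_seq_geom. rewrite Rabs_pos_eq; lra. }
  apply is_lim_seq_spec in L. destruct (L (mkposreal (eps / 2) ltac:(lra))) as [n0 Hn0].
  specialize (Hn0 n0 (Nat.le_refl n0)). simpl in Hn0. rewrite Rminus_0_r in Hn0.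
  apply Rabs_def2 in Hn0.
  exists n0. intros a b Ha Hb.
  pose proof (rnorm_entry _ _ i j (geom_tail n0 (a - n0)) Hi Hj) as Ea.
  pose proof (rnorm_entry _ _ i j (geom_tail n0 (b - n0)) Hi Hj) as Eb.
  unfold msub in Ea, Eb.
  replace (n0 + (a - n0))%nat with a in Ea by lia.
  replace (n0 + (b - n0))%nat with b in Eb by lia.
  apply Rabs_le_between in Ea; apply Rabs_le_between in Eb. apply Rabs_def1; lra.
Qed.

Lemma mlim_bound m : rnorm N (msub (mlim Z) (Z m)) (C * q ^ m / (1 - q)).
Proof.
  intros i Hi. unfold msub.
  assert (L : is_lim_seq (fun k => rsum N (fun j => Rabs (Z (m + k)%nat i j - Z m i j)))
                (rsum N (fun j => Rabs (mlim Z i j - Z m i j)))).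
  { apply (is_lim_seq_rsum N (fun k j => Rabs (Z (m + k)%nat i j - Z m i j))); intros j Hj.
    apply (is_lim_seq_abs _ (Finite _)).
    apply (is_lim_seq_minus' (fun k => Z (m + k)%nat i j)); [|apply is_lim_seq_const].
    apply is_lim_seq_ext with (fun k => Z (k + m)%nat i j); [intros; now rewrite Nat.add_comm|].
    apply (is_lim_seq_incr_n (fun k => Z k i j)). now apply mlim_cv. }
  exact (is_lim_seq_le _ _ (Finite _) (Finite _)
          (fun k => geom_tail m k i Hi) L (is_lim_seq_const _)).
Qed.
End Limit.

Lemma mlim_zero Z i j : (forall m, Z m i j = 0) -> mlim Z i j = 0.
Proof.
  intros H. unfold mlim. rewrite (Lim_seq_ext _ (fun _ => 0)) by auto. now rewrite Lim_seq_const.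
Qed.

Lemma is_lim_seq_mm (U V : nat -> mat) (A B : mat) i j :
  (forall k, (k < N)%nat -> is_lim_seq (fun m => U m i k) (A i k)) ->
  (forall k, (k < N)%nat -> is_lim_seq (fun m => V m k j) (B k j)) ->
  is_lim_seq (fun m => mm N (U m) (V m) i j) (mm N A B i j).
Proof.
  intros HU HV. unfold mm.
  apply (is_lim_seq_rsum N (fun m k => U m i k * V m k j)); intros k Hk.
  apply (is_lim_seq_mult' (fun m => U m i k)); auto.
Qed.

Lemma inN_ext A B : inN N A -> inN N B ->
  (forall i j, (i < N)%nat -> (j < N)%nat -> A i j = B i j) -> A = B.
Proof.
  intros HA HB H; mext.
  destruct (le_lt_dec N i); [rewrite HA, HB; auto|].
  destruct (le_lt_dec N j); [rewrite HA, HB; auto|]. auto.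
Qed.

Lemma is_lim_seq_eq (u : nat -> R) (a b : R) : is_lim_seq u a -> is_lim_seq u b -> a = b.
Proof.
  intros Ha Hb. apply is_lim_seq_unique in Ha. apply is_lim_seq_unique in Hb.
  rewrite Ha in Hb. now injection Hb.
Qed.

(* Fixed points of Y = (X + Y^2)/2 satisfy (1 - Y)^2 = 1 - X: the iteration computes the
   square root of 1 - X by operations that preserve locality. *)
Fixpoint sqrt_iter (X : mat) (m : nat) : mat :=
  match m with
  | O => mzero
  | S m => mscal (1/2) (madd X (mm N (sqrt_iter X m) (sqrt_iter X m)))
  end.

(** Partial sums of the Neumann series 1 + Y + Y^2 + ..., whose limit inverts 1 - Y. *)
Fixpoint neumann_iter (Y : mat) (m : nat) : mat :=
  match m with
  | O => mzero
  | S m => madd (mid N) (mm N Y (neumann_iter Y m))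
  end.

Section SquareRoot.
Variables (X : mat) (x : R).
Hypothesis (Hx : 0 <= x < 1) (HX : rnorm N X x) (XN : inN N X) (Xsym : mtr X = X).

Let Ym := sqrt_iter X.

Lemma sqrt_iter_norm m : rnorm N (Ym m) x.
Proof.
  induction m as [|m IH].
  - apply rnorm_le with 0; [lra|apply rnorm_zero].
  - simpl. apply rnorm_le with (Rabs (1/2) * (x + x * x)).
    + rewrite Rabs_pos_eq by lra. nra.
    + apply rnorm_scal, rnorm_add; auto. apply rnorm_mm; auto; lra.
Qed.

(** Difference of squares without commutation: A^2 - B^2 = A (A - B) + (A - B) B. Both outer factors
    stay in the ball of radius x and the prefactor is 1/2, so each step contracts by x. *)
Lemma sqrt_iter_diff m : rnorm N (msub (Ym (S m)) (Ym m)) (x * x ^ m).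
Proof.
  induction m as [|m IH].
  - replace (msub (Ym 1) (Ym 0)) with (mscal (1/2) X).
    + apply rnorm_le with (Rabs (1/2) * x); [rewrite Rabs_pos_eq by lra; simpl; lra|].
      now apply rnorm_scal.
    + unfold Ym; simpl. rewrite mm_zero_r. mext; unfold msub, mscal, madd, mzero; ring.
  - replace (msub (Ym (S (S m))) (Ym (S m))) with
      (mscal (1/2) (madd (mm N (Ym (S m)) (msub (Ym (S m)) (Ym m)))
                         (mm N (msub (Ym (S m)) (Ym m)) (Ym m)))).
    + apply rnorm_le with (Rabs (1/2) * (x * (x * x ^ m) + (x * x ^ m) * x)).
      { rewrite Rabs_pos_eq by lra. simpl; lra. }
      assert (0 <= x * x ^ m) by (apply Rmult_le_pos; [lra|apply pow_le; lra]).
      apply rnorm_scal, rnorm_add; apply rnorm_mm; auto using sqrt_iter_norm; lra.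
    + change (Ym (S (S m))) with (mscal (1/2) (madd X (mm N (Ym (S m)) (Ym (S m))))).
      change (Ym (S m)) with (mscal (1/2) (madd X (mm N (Ym m) (Ym m)))) at 6.
      rewrite mm_sub_l, mm_sub_r. mext; unfold madd, msub, mscal; ring.
Qed.

Definition sqrt_lim : mat := mlim Ym.
Let Y := sqrt_lim.

Lemma sqrt_iter_inN m : inN N (Ym m).
Proof.
  induction m as [|m IH]; intros i j H; [reflexivity|].
  unfold Ym; simpl; unfold mscal, madd. rewrite XN, inN_mm; auto; ring.
Qed.

Lemma sqrt_lim_inN : inN N Y.
Proof. intros i j H. apply mlim_zero. intros m; now apply sqrt_iter_inN. Qed.

Lemma sqrt_lim_cv i j : (i < N)%nat -> (j < N)%nat -> is_lim_seq (fun m => Ym m i j) (Y i j).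
Proof. apply (mlim_cv Ym x x); auto using sqrt_iter_diff; lra. Qed.

Lemma sqrt_lim_bound m : rnorm N (msub Y (Ym m)) (x * x ^ m / (1 - x)).
Proof. apply (mlim_bound Ym x x); auto using sqrt_iter_diff; lra. Qed.

Lemma sqrt_lim_norm : rnorm N Y x.
Proof.
  intros i Hi.
  refine (is_lim_seq_le (fun m => rsum N (fun j => Rabs (Ym m i j))) (fun _ => x)
    (Finite _) (Finite _) _ _ (is_lim_seq_const _)).
  - intros m; now apply sqrt_iter_norm.
  - apply (is_lim_seq_rsum N (fun m j => Rabs (Ym m i j))); intros j Hj.
    apply (is_lim_seq_abs _ (Finite _)). now apply sqrt_lim_cv.
Qed.

Lemma sqrt_lim_eq : Y = mscal (1/2) (madd X (mm N Y Y)).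
Proof.
  apply inN_ext; [apply sqrt_lim_inN| |].
  - intros i j H. unfold mscal, madd. rewrite XN, (inN_mm Y Y); auto using sqrt_lim_inN; ring.
  - intros i j Hi Hj. apply (is_lim_seq_eq (fun m => Ym (S m) i j)).
    + apply (is_lim_seq_incr_1 (fun m => Ym m i j)). now apply sqrt_lim_cv.
    + unfold mscal, madd.
      apply (is_lim_seq_mult' (fun _ => 1/2) (fun m => X i j + mm N (Ym m) (Ym m) i j));
        [apply is_lim_seq_const|].
      apply (is_lim_seq_plus' (fun _ => X i j)); [apply is_lim_seq_const|].
      apply is_lim_seq_mm; intros; now apply sqrt_lim_cv.
Qed.

Lemma sqrt_lim_sym : mtr Y = Y.
Proof.
  assert (S : forall m, mtr (Ym m) = Ym m).
  { induction m as [|m IH]; [reflexivity|].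
    change (Ym (S m)) with (mscal (1/2) (madd X (mm N (Ym m) (Ym m)))).
    transitivity (mscal (1/2) (madd (mtr X) (mtr (mm N (Ym m) (Ym m))))); [reflexivity|].
    now rewrite mm_tr, IH, Xsym. }
  mext. unfold mtr, Y, sqrt_lim, mlim. f_equal. apply Lim_seq_ext; intros m.
  change (mtr (Ym m) i j = Ym m i j). now rewrite S.
Qed.

Let Rm := neumann_iter Y.

Lemma neumann_iter_diff m : rnorm N (msub (Rm (S m)) (Rm m)) (1 * x ^ m).
Proof.
  induction m as [|m IH].
  - unfold Rm; simpl. rewrite mm_zero_r.
    replace (msub (madd (mid N) mzero) mzero) with (mid N)
      by (mext; unfold msub, madd, mzero; ring).
    rewrite Rmult_1_r; apply rnorm_mid.
  - replace (msub (Rm (S (S m))) (Rm (S m))) with (mm N Y (msub (Rm (S m)) (Rm m))).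
    + replace (1 * x ^ S m) with (x * (1 * x ^ m)) by (simpl; ring).
      apply rnorm_mm; auto using sqrt_lim_norm.
      rewrite Rmult_1_l; apply pow_le; lra.
    + rewrite mm_sub_r. mext; unfold msub.
      change (Rm (S (S m)) i j) with (mid N i j + mm N Y (Rm (S m)) i j).
      change (Rm (S m) i j) with (mid N i j + mm N Y (Rm m) i j); ring.
Qed.

Definition inv_lim : mat := mlim Rm.
Let Ri := inv_lim.

Lemma neumann_iter_inN m : inN N (Rm m).
Proof.
  induction m as [|m IH]; intros i j H; [reflexivity|].
  unfold Rm; simpl; unfold madd. rewrite inN_mid, inN_mm; auto using sqrt_lim_inN; ring.
Qed.

Lemma inv_lim_inN : inN N Ri.
Proof. intros i j H. apply mlim_zero. intros m; now apply neumann_iter_inN. Qed.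

Lemma inv_lim_cv i j : (i < N)%nat -> (j < N)%nat -> is_lim_seq (fun m => Rm m i j) (Ri i j).
Proof. apply (mlim_cv Rm 1 x); auto using neumann_iter_diff; lra. Qed.

Lemma inv_lim_bound m : rnorm N (msub Ri (Rm m)) (1 * x ^ m / (1 - x)).
Proof. apply (mlim_bound Rm 1 x); auto using neumann_iter_diff; lra. Qed.

Lemma inv_lim_eq : Ri = madd (mid N) (mm N Y Ri).
Proof.
  apply inN_ext; [apply inv_lim_inN| |].
  - intros i j H. unfold madd.
    rewrite inN_mid, inN_mm; auto using sqrt_lim_inN, inv_lim_inN; ring.
  - intros i j Hi Hj. apply (is_lim_seq_eq (fun m => Rm (S m) i j)).
    + apply (is_lim_seq_incr_1 (fun m => Rm m i j)). now apply inv_lim_cv.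
    + unfold madd.
      apply (is_lim_seq_plus' (fun _ => mid N i j) (fun m => mm N Y (Rm m) i j));
        [apply is_lim_seq_const|].
      apply (is_lim_seq_mm (fun _ => Y)); intros; [apply is_lim_seq_const|now apply inv_lim_cv].
Qed.

(** Transposition reverses products, so symmetry of the inverse needs the iterates to commute with
    Y. *)
Lemma neumann_iter_comm m : mm N Y (Rm m) = mm N (Rm m) Y.
Proof.
  induction m as [|m IH]; [unfold Rm; simpl; now rewrite mm_zero_r, mm_zero_l|].
  change (Rm (S m)) with (madd (mid N) (mm N Y (Rm m))).
  rewrite mm_add_l, mm_add_r, mm_id_l, mm_id_r by apply sqrt_lim_inN.
  now rewrite mm_assoc, <- IH.
Qed.

Lemma inv_lim_sym : mtr Ri = Ri.
Proof.
  assert (S : forall m, mtr (Rm m) = Rm m).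
  { induction m as [|m IH]; [reflexivity|].
    change (Rm (S m)) with (madd (mid N) (mm N Y (Rm m))).
    transitivity (madd (mtr (mid N)) (mtr (mm N Y (Rm m)))); [reflexivity|].
    now rewrite mm_tr, IH, mid_tr, sqrt_lim_sym, <- neumann_iter_comm. }
  mext. unfold mtr, Ri, inv_lim, mlim. f_equal. apply Lim_seq_ext; intros m.
  change (mtr (Rm m) i j = Rm m i j). now rewrite S.
Qed.

Lemma inv_lim_l : mm N (msub (mid N) Y) Ri = mid N.
Proof.
  rewrite mm_sub_l, mm_id_l by apply inv_lim_inN.
  rewrite inv_lim_eq at 1. mext; unfold msub, madd; ring.
Qed.

(** The other one-sided inverse, transposed: both factors are symmetric. *)
Lemma inv_lim_r : mm N Ri (msub (mid N) Y) = mid N.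
Proof.
  pose proof (f_equal mtr inv_lim_l) as E.
  rewrite mm_tr, inv_lim_sym in E.
  change (mtr (msub (mid N) Y)) with (msub (mtr (mid N)) (mtr Y)) in E.
  now rewrite mid_tr, sqrt_lim_sym in E.
Qed.

Lemma sqrt_lim_sq : mm N (msub (mid N) Y) (msub (mid N) Y) = msub (mid N) X.
Proof.
  assert (IW : inN N (msub (mid N) Y)).
  { intros i j H; unfold msub. rewrite inN_mid, sqrt_lim_inN; auto; ring. }
  rewrite mm_sub_l, mm_id_l, mm_sub_r, mm_id_r by auto using sqrt_lim_inN.
  pose proof sqrt_lim_eq as E. mext. unfold msub.
  assert (E' := f_equal (fun A => A i j) E). unfold mscal, madd in E'. lra.
Qed.

End SquareRoot.

End Matrices.

(** * Polar decomposition of the hopping matrix *)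

Section Polar.
Variables (J h : R).
Hypothesis (Hh : h <> 0) (HJ : Rabs J < Rabs h).

(** The diagonal entry of M^T M in the bulk; dividing by it leaves [hopX] with zero diagonal except
    at the last site. *)
Definition psq : R := h ^ 2 + J ^ 2.
(** The bulk row sum of [hopX]: two neighbours contributing |h J| / psq each. It equals 1 - (|h| -
    |J|)^2 / psq, so it stays below 1 uniformly in the volume; this is where the disordered regime
    enters quantitatively. *)
Definition contr : R := 2 * (Rabs h * Rabs J) / psq.

Lemma psq_pos : 0 < psq.
Proof. unfold psq. assert (0 < h ^ 2) by (apply pow2_gt_0; auto). nra. Qed.

Lemma contr_range : 0 <= contr < 1.
Proof.
  pose proof psq_pos. unfold contr. pose proof (Rabs_pos h). pose proof (Rabs_pos J). split.
  - apply Rdiv_le_0_compat; auto. nra.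
  - apply Rmult_lt_reg_r with psq; auto. unfold Rdiv.
    rewrite Rmult_assoc, Rinv_l, Rmult_1_r, Rmult_1_l by lra.
    unfold psq. rewrite <- (pow2_abs h), <- (pow2_abs J). nra.
Qed.

Definition hopX (N : nat) : mat :=
  msub (mid N) (mscal (/ psq) (mm N (mtr (hopM J h N)) (hopM J h N))).

Lemma hopM_inN N : inN N (hopM J h N).
Proof.
  intros i j H. unfold hopM.
  destruct (Nat.ltb_spec i N), (Nat.ltb_spec j N); simpl; try reflexivity; lia.
Qed.

Lemma hopMT_mul N i (v : nat -> R) : (i < N)%nat ->
  rsum N (fun k => hopM J h N k i * v k) = h * v i - (if Nat.ltb (S i) N then J * v (S i) else 0).
Proof.
  intros Hi.
  rewrite (rsum_ext N _ (fun k => delta i k * (h * v k) - delta (S i) k * (J * v k))).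
  - rewrite rsum_minus, rsum_delta by auto. f_equal.
    destruct (Nat.ltb_spec (S i) N); [now rewrite rsum_delta by auto|now rewrite rsum_delta_out].
  - intros k Hk. rewrite hopM_in, (delta_sym k i), (delta_sym k (S i)) by auto; ring.
Qed.

Lemma hopX_entry N i j : (i < N)%nat -> (j < N)%nat ->
  hopX N i j = / psq * (h * J * delta i (S j) + h * J * delta (S i) j
                        + (if Nat.ltb (S i) N then 0 else J ^ 2 * delta i j)).
Proof.
  intros Hi Hj. unfold hopX, msub, mscal, mm, mtr.
  rewrite (hopMT_mul N i (fun k => hopM J h N k j) Hi), mid_in, hopM_in by auto.
  pose proof psq_pos as P.
  assert (E : delta i j = / psq * ((h ^ 2 + J ^ 2) * delta i j)).
  { fold psq. field; lra. }
  rewrite E at 1. destruct (Nat.ltb_spec (S i) N).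
  - rewrite hopM_in by auto. replace (delta (S i) (S j)) with (delta i j) by reflexivity. ring.
  - rewrite (delta_diff (S i) j) by lia. ring.
Qed.

Lemma hopX_norm N : rnorm N (hopX N) contr.
Proof.
  intros i Hi.
  pose proof psq_pos as P. assert (IP : 0 < / psq) by now apply Rinv_0_lt_compat.
  pose proof (Rabs_pos h) as Ph. pose proof (Rabs_pos J) as PJ.
  assert (delta_abs : forall a b, Rabs (delta a b) = delta a b).
  { intros; unfold delta; destruct (Nat.eqb a b); rewrite ?Rabs_R1, ?Rabs_R0; reflexivity. }
  assert (D1 : rsum N (fun j => delta i (S j)) <= 1).
  { destruct i as [|i].
    - rewrite rsum_zero; [lra|]. intros; now apply delta_diff.
    - rewrite (rsum_ext N _ (fun j => delta i j * 1)) by (intros; unfold delta; simpl; ring).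
      rewrite (rsum_delta N (fun _ => 1)) by lia; lra. }
  set (b := if Nat.ltb (S i) N then 0 else J ^ 2).
  apply Rle_trans with (rsum N (fun j => / psq * (Rabs h * Rabs J * delta i (S j)
      + Rabs h * Rabs J * (delta (S i) j * 1) + b * (delta i j * 1)))).
  - apply rsum_le; intros j Hj. rewrite hopX_entry by auto.
    rewrite Rabs_mult, (Rabs_pos_eq (/ psq)) by lra.
    apply Rmult_le_compat_l; [lra|].
    eapply Rle_trans; [apply Rabs_triang|]. apply Rplus_le_compat.
    + eapply Rle_trans; [apply Rabs_triang|]. rewrite !Rabs_mult, !delta_abs; lra.
    + unfold b. destruct (Nat.ltb (S i) N); [rewrite Rabs_R0; lra|].
      rewrite Rabs_mult, delta_abs, <- RPow_abs, pow2_abs; lra.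
  - rewrite rsum_scal, !rsum_plus, !rsum_scal, (rsum_delta N (fun _ => 1) i) by auto.
    unfold contr. unfold Rdiv. rewrite Rmult_comm. apply Rmult_le_compat_r; [lra|].
    assert (Q : 0 <= Rabs h * Rabs J) by (apply Rmult_le_pos; lra).
    (* In the last row one neighbour is missing and the open boundary leaves a diagonal defect J^2
       in its place; |J| < |h| keeps it below the missing term. *)
    assert (Rabs J ^ 2 <= Rabs h * Rabs J) by nra.
    set (q := Rabs h * Rabs J) in *. set (s := rsum N (fun j => delta i (S j))) in *.
    assert (q * s <= q) by nra.
    unfold b. destruct (Nat.ltb_spec (S i) N).
    + rewrite (rsum_delta N (fun _ => 1) (S i)) by auto. lra.
    + rewrite (rsum_delta_out N (fun _ => 1) (S i)) by auto. rewrite <- (pow2_abs J). lra.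
Qed.

Lemma hopX_inN N : inN N (hopX N).
Proof.
  intros i j H. unfold hopX, msub, mscal.
  rewrite inN_mid, inN_mm; auto using hopM_inN; [ring|]. apply inN_tr, hopM_inN.
Qed.

Lemma hopX_sym N : mtr (hopX N) = hopX N.
Proof.
  unfold hopX. set (M := hopM J h N).
  transitivity (msub (mtr (mid N)) (mscal (/ psq) (mtr (mm N (mtr M) M)))); [reflexivity|].
  now rewrite mm_tr, mid_tr.
Qed.

Definition hopY (N : nat) : mat := sqrt_lim N (hopX N).
Definition hopR (N : nat) : mat := inv_lim N (hopX N).
(** With the positive factor P = sqrt(psq) W, this is P^-1 M^T, the transpose of the orthogonal
    factor O = M P^-1. *)
Definition hopG (N : nat) : mat := mscal (/ sqrt psq) (mm N (hopR N) (mtr (hopM J h N))).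
Definition hopO (N : nat) : mat := mtr (hopG N).
Definition hopW (N : nat) : mat := msub (mid N) (hopY N).

Lemma hopY_norm N : rnorm N (hopY N) contr.
Proof. apply sqrt_lim_norm; auto using contr_range, hopX_norm. Qed.

Lemma hopW_sq N :
  mm N (hopW N) (hopW N) = mscal (/ psq) (mm N (mtr (hopM J h N)) (hopM J h N)).
Proof.
  unfold hopW, hopY.
  rewrite (sqrt_lim_sq N (hopX N) contr); auto using contr_range, hopX_norm, hopX_inN.
  unfold hopX. mext; unfold msub; ring.
Qed.

Lemma hopW_hopR N : mm N (hopW N) (hopR N) = mid N.
Proof. apply (inv_lim_l N (hopX N) contr); auto using contr_range, hopX_norm, hopX_inN. Qed.

Lemma hopR_hopW N : mm N (hopR N) (hopW N) = mid N.
Proof.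
  apply (inv_lim_r N (hopX N) contr); auto using contr_range, hopX_norm, hopX_inN, hopX_sym.
Qed.

Lemma hopO_eq N : hopO N = mscal (/ sqrt psq) (mm N (hopM J h N) (hopR N)).
Proof.
  unfold hopO, hopG.
  transitivity (mscal (/ sqrt psq) (mtr (mm N (hopR N) (mtr (hopM J h N))))); [reflexivity|].
  rewrite mm_tr. unfold hopR.
  now rewrite (inv_lim_sym N (hopX N));
    auto using contr_range, hopX_norm, hopX_inN, hopX_sym.
Qed.

Lemma hopO_hopW N : mscal (sqrt psq) (mm N (hopO N) (hopW N)) = hopM J h N.
Proof.
  rewrite hopO_eq, mm_scal_l, mm_assoc, hopR_hopW, mm_id_r by apply hopM_inN.
  mext; unfold mscal. pose proof (sqrt_lt_R0 _ psq_pos). field; lra.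
Qed.

Lemma hopMT_hopO N : mm N (mtr (hopM J h N)) (hopO N) = mscal (sqrt psq) (hopW N).
Proof.
  rewrite hopO_eq, mm_scal_r, <- mm_assoc.
  pose proof (sqrt_lt_R0 _ psq_pos) as Q. pose proof psq_pos as P.
  replace (mm N (mtr (hopM J h N)) (hopM J h N)) with (mscal psq (mm N (hopW N) (hopW N))).
  - rewrite mm_scal_l, mm_assoc, hopW_hopR, mm_id_r.
    + mext; unfold mscal. rewrite <- (sqrt_sqrt psq) at 2 by lra. field; lra.
    + intros i j H. unfold hopW, msub. rewrite inN_mid by auto.
      unfold hopY. rewrite sqrt_lim_inN; auto using hopX_inN; ring.
  - rewrite hopW_sq. mext; unfold mscal. field; lra.
Qed.

(** M^T is upper bidiagonal with h on the diagonal: back substitution from the last site, [m]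
    bounding the distance to it. *)
Lemma hopMT_inj N (v : nat -> R) :
  (forall i, (i < N)%nat -> rsum N (fun k => hopM J h N k i * v k) = 0) ->
  forall i, (i < N)%nat -> v i = 0.
Proof.
  intros H.
  assert (K : forall m i, (i < N)%nat -> (N - 1 - i <= m)%nat -> v i = 0).
  { induction m as [|m IH]; intros i Hi Hm; specialize (H i Hi); rewrite hopMT_mul in H by auto.
    - rewrite (proj2 (Nat.ltb_ge (S i) N)) in H by lia. nra.
    - destruct (Nat.ltb_spec (S i) N) as [E|E]; [rewrite (IH (S i)) in H by lia|]; nra. }
  intros i Hi; apply (K (N - 1 - i)%nat); auto.
Qed.

(** O O^T = 1 does not come from multiplying out as O^T O = 1 would. Instead M^T O O^T = M^T by the
    polar relations, and the injective M^T is cancelled. *)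
Lemma hopO_hopG N i j : (i < N)%nat -> (j < N)%nat -> mm N (hopO N) (hopG N) i j = delta i j.
Proof.
  intros Hi Hj. rewrite <- (mid_in N i j Hi).
  cut (mm N (hopO N) (hopG N) i j - mid N i j = 0); [lra|].
  apply (hopMT_inj N (fun k => mm N (hopO N) (hopG N) k j - mid N k j)); auto.
  intros l Hl.
  rewrite (rsum_ext N _ (fun k => hopM J h N k l * mm N (hopO N) (hopG N) k j
                                  - hopM J h N k l * mid N k j)) by (intros; ring).
  rewrite rsum_minus.
  change (mm N (mtr (hopM J h N)) (mm N (hopO N) (hopG N)) l j
          - mm N (mtr (hopM J h N)) (mid N) l j = 0).
  rewrite mm_id_r by apply inN_tr, hopM_inN.
  rewrite <- mm_assoc, hopMT_hopO, mm_scal_l. unfold hopG.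
  rewrite mm_scal_r, <- mm_assoc, hopW_hopR, mm_id_l by apply inN_tr, hopM_inN.
  unfold mscal. pose proof (sqrt_lt_R0 _ psq_pos). field; lra.
Qed.

End Polar.

(** * Modes annihilating the ground state *)

Lemma norm2_ip L f : norm2 L f = ip (dim L) f f.
Proof. apply rsum_ext; intros; ring. Qed.

Lemma ground_state_min J h L psi : is_ground_state J h L psi ->
  forall f, energy J h L psi * ip (dim L) f f <= ip (dim L) f (Hact J h L f).
Proof.
  intros [_ Hm] f. pose proof (ip_pos (dim L) f) as P.
  destruct (Req_dec (ip (dim L) f f) 0) as [Z|Z].
  - assert (F0 := ip_eq0 (dim L) f ltac:(lra)).
    rewrite Z, Rmult_0_r. unfold ip. rewrite rsum_zero; [lra|].
    intros c Hc. rewrite F0 by auto; ring.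
  - set (s := / sqrt (ip (dim L) f f)).
    assert (Q : 0 < sqrt (ip (dim L) f f)) by (apply sqrt_lt_R0; lra).
    assert (S2 : s * s * ip (dim L) f f = 1).
    { unfold s. rewrite <- (sqrt_sqrt (ip (dim L) f f)) at 3 by lra. field; lra. }
    assert (Hs : Hact J h L (fun c => s * f c) = fun c => s * Hact J h L f c).
    { extensionality c. unfold Hact. rewrite rsum_scal; ring. }
    specialize (Hm (fun c => s * f c)).
    rewrite norm2_ip, ip_scal_l, ip_scal_r, <- Rmult_assoc in Hm. specialize (Hm S2).
    change (energy J h L (fun c => s * f c))
      with (ip (dim L) (fun c => s * f c) (Hact J h L (fun c => s * f c))) in Hm.
    rewrite Hs, ip_scal_l, ip_scal_r, <- Rmult_assoc in Hm.
    assert (S0 : 0 < s) by (apply Rinv_0_lt_compat; exact Q).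
    assert (SP : 0 < s * s) by nra.
    apply Rmult_le_reg_l with (s * s); auto.
    rewrite (Rmult_comm (energy J h L psi)), <- Rmult_assoc, S2; lra.
Qed.

Section Annihilation.
Variables (J h : R).
Hypothesis (Hh : h <> 0) (HJ : Rabs J < Rabs h).
Variables (L : nat) (psi : nat -> R).
Hypothesis (Hg : is_ground_state J h L psi).
Hypothesis (Hsupp : forall c, (dim L <= c)%nat -> psi c = 0).

Let N := nsites L.
Let M := hopM J h N.
Let O := hopO J h N.
Let Y := hopY J h N.
Let E := energy J h L psi.

Lemma ham_ground : hamM M N psi = fun c => E * psi c.
Proof.
  apply ground_state_eigen.
  - exact Hsupp.
  - unfold M, N. rewrite <- Hact_hamM. change (2 ^ nsites L)%nat with (dim L).
    rewrite <- norm2_ip, (proj1 Hg), Rmult_1_r. reflexivity.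
  - intros f. unfold M, N. rewrite <- Hact_hamM. exact (ground_state_min J h L psi Hg f).
Qed.

Definition mode (j : nat) (c : nat) : R :=
  rsum N (fun i => O i j * majA i psi c) - majD j psi c.
Definition annih (v : nat -> R) (c : nat) : R := rsum N (fun j => v j * mode j c).

Lemma annih_eq v c : annih v c = combA N (mv N O v) psi c - combD N v psi c.
Proof.
  unfold annih, mode, combA, combD, mv.
  rewrite (rsum_ext N _ (fun j => rsum N (fun i => v j * (O i j * majA i psi c))
            - v j * majD j psi c)) by (intros; rewrite rsum_scal; ring).
  rewrite rsum_minus, rsum_swap. f_equal.
  apply rsum_ext; intros i _. rewrite <- rsum_scal_r. apply rsum_ext; intros; ring.
Qed.

Lemma ham_combA u c :
  hamM M N (combA N u psi) c = E * combA N u psi c + 2 * combD N (mv N (mtr M) u) psi c.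
Proof.
  unfold combA. rewrite hamM_lin, <- rsum_scal. unfold combD, mv, mtr.
  rewrite (rsum_ext N (fun j => rsum N (fun k => M k j * u k) * majD j psi c)
    (fun j => rsum N (fun k => M k j * u k * majD j psi c)))
    by (intros; now rewrite rsum_scal_r).
  rewrite (rsum_swap N N), <- rsum_scal, <- rsum_plus.
  apply rsum_ext; intros l Hl.
  change (fun c0 => majA l psi c0) with (majA l psi).
  rewrite hamM_majA, ham_ground by auto.
  rewrite Rmult_plus_distr_l. f_equal; [unfold majA; ring|].
  rewrite <- !rsum_scal. apply rsum_ext; intros; ring.
Qed.

Lemma ham_combD v c :
  hamM M N (combD N v psi) c = E * combD N v psi c + 2 * combA N (mv N M v) psi c.
Proof.
  unfold combD. rewrite hamM_lin, <- rsum_scal. unfold combA, mv.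
  rewrite (rsum_ext N (fun j => rsum N (fun k => M j k * v k) * majA j psi c)
    (fun j => rsum N (fun k => M j k * v k * majA j psi c)))
    by (intros; now rewrite rsum_scal_r).
  rewrite (rsum_swap N N), <- rsum_scal, <- rsum_plus.
  apply rsum_ext; intros l Hl.
  change (fun c0 => majD l psi c0) with (majD l psi).
  rewrite hamM_majD, ham_ground by auto.
  rewrite Rmult_plus_distr_l. f_equal; [unfold majD; ring|].
  rewrite <- !rsum_scal. apply rsum_ext; intros; ring.
Qed.

Lemma hamM_minus f g c :
  hamM M N (fun c => f c - g c) c = hamM M N f c - hamM M N g c.
Proof.
  pose proof (hamM_lin M N 2 (fun k => match k with 0%nat => 1 | _ => -1 end)
    (fun k => match k with 0%nat => f | _ => g end) c) as K. simpl in K.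
  transitivity (0 + 1 * hamM M N f c + -1 * hamM M N g c); [|ring].
  rewrite <- K. f_equal. extensionality x; ring.
Qed.

(** Commutation with H sends A(u) to 2 D(M^T u) and D(v) to 2 A(M v). Since M^T O = P and M = O P,
    the combination A(O v) - D(v) reproduces itself with v replaced by P v and a factor -2: it
    lowers the energy. The right side spells out P = sqrt(psq) (1 - Y). *)
Lemma ham_annih v c :
  hamM M N (annih v) c
  = E * annih v c - 2 * sqrt (psq J h) * (annih v c - annih (mv N Y v) c).
Proof.
  assert (A0 : annih v = fun c => combA N (mv N O v) psi c - combD N v psi c)
    by (extensionality e; apply annih_eq).
  rewrite A0 at 1. rewrite hamM_minus, ham_combA, ham_combD.
  set (w := mv N (mscal (sqrt (psq J h)) (hopW J h N)) v).
  assert (E1 : mv N (mtr M) (mv N O v) = w).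
  { rewrite <- mv_mm. unfold M, O. rewrite hopMT_hopO by auto. reflexivity. }
  assert (E2 : mv N M v = mv N O w).
  { unfold w. rewrite <- mv_mm. unfold M, O. rewrite mm_scal_r, hopO_hopW by auto. reflexivity. }
  rewrite E1, E2.
  transitivity (E * annih v c - 2 * annih w c); [rewrite !annih_eq; ring|].
  replace (annih w c) with (sqrt (psq J h) * (annih v c - annih (mv N Y v) c)); [ring|].
  unfold annih. rewrite <- rsum_minus, <- rsum_scal. apply rsum_ext; intros j Hj.
  unfold w, mv, mscal, hopW, msub.
  rewrite (rsum_ext N (fun k => sqrt (psq J h) * (mid N j k - hopY J h N j k) * v k)
    (fun k => sqrt (psq J h) * (delta j k * v k - Y j k * v k)))
    by (intros; rewrite mid_in by auto; unfold Y; ring).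
  rewrite rsum_scal, rsum_minus, rsum_delta by auto. ring.
Qed.

(** No vector lies below the ground state energy, so with f and g the vectors of v and Y v the
    lowering relation forces <f, f - g> <= 0. Then <f, f> <= <f, g>, and |f - g|^2 >= 0
    concludes. *)
Lemma annih_le v : ip (dim L) (annih v) (annih v)
  <= ip (dim L) (annih (mv N Y v)) (annih (mv N Y v)).
Proof.
  set (d := dim L). set (f := annih v). set (g := annih (mv N Y v)).
  pose proof (ground_state_min J h L psi Hg f) as H. fold d E in H.
  rewrite Hact_hamM in H. fold N M in H.
  assert (Hf : hamM M N f = fun c => E * f c - (2 * sqrt (psq J h)) * (f c - g c)).
  { extensionality c. apply ham_annih. }
  rewrite Hf in H. rewrite ip_minus_r, !ip_scal_r, ip_minus_r in H.
  pose proof (sqrt_lt_R0 _ (psq_pos J h Hh)) as Q.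
  assert (H1 : ip d f f <= ip d f g) by nra.
  pose proof (ip_pos d (fun c => f c - g c)) as P.
  rewrite ip_minus_l, !ip_minus_r, (ip_sym d g f) in P. lra.
Qed.

(** A crude constant depending on the volume and on [psi] suffices: the volume stays fixed while the
    number of applications of Y tends to infinity. *)
Lemma annih_bound : exists K, forall v s, (forall j, (j < N)%nat -> Rabs (v j) <= s) ->
  ip (dim L) (annih v) (annih v) <= s ^ 2 * K.
Proof.
  exists (rsum (dim L) (fun c => rsum N (fun j => Rabs (mode j c)) ^ 2)).
  intros v s Hs. rewrite <- rsum_scal. apply rsum_le; intros c _.
  assert (B : Rabs (annih v c) <= s * rsum N (fun j => Rabs (mode j c))).
  { unfold annih. eapply Rle_trans; [apply rsum_Rabs|]. rewrite <- rsum_scal.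
    apply rsum_le; intros j Hj. rewrite Rabs_mult.
    apply Rmult_le_compat_r; [apply Rabs_pos|auto]. }
  pose proof (Rabs_pos (annih v c)).
  replace (annih v c * annih v c) with (Rabs (annih v c) ^ 2) by (rewrite pow2_abs; ring).
  rewrite <- Rpow_mult_distr. apply pow_incr; lra.
Qed.

(* Each application of Y contracts v but does not decrease |annih v|^2, hence annih v = 0. *)
Lemma annih_zero v c : combA N (mv N O v) psi c = combD N v psi c.
Proof.
  cut (annih v c = 0); [rewrite annih_eq; lra|].
  assert (Z : ip (dim L) (annih v) (annih v) <= 0).
  { destruct annih_bound as [K HK].
    set (x := contr J h). pose proof (contr_range J h Hh HJ) as Hx. fold x in Hx.
    set (s := rsum N (fun j => Rabs (v j))).
    assert (It : forall k, exists w, (forall j, (j < N)%nat -> Rabs (w j) <= x ^ k * s) /\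
        ip (dim L) (annih v) (annih v) <= ip (dim L) (annih w) (annih w)).
    { induction k as [|k [w [Hw Hi]]].
      - exists v; split; [|lra]. intros j Hj. rewrite pow_O, Rmult_1_l.
        apply (rsum_term_le N (fun j => Rabs (v j))); auto. intros; apply Rabs_pos.
      - exists (mv N Y w); split.
        + intros j Hj. unfold mv. eapply Rle_trans; [apply rsum_Rabs|].
          apply Rle_trans with (rsum N (fun k0 => Rabs (Y j k0)) * (x ^ k * s)).
          * rewrite <- rsum_scal_r. apply rsum_le; intros i Hi'. rewrite Rabs_mult.
            apply Rmult_le_compat_l; [apply Rabs_pos|auto].
          * simpl. rewrite Rmult_assoc. apply Rmult_le_compat_r.
            -- eapply Rle_trans; [apply Rabs_pos|apply (Hw j Hj)].
            -- exact (hopY_norm J h Hh HJ N j Hj).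
        + eapply Rle_trans; [exact Hi|apply annih_le]. }
    assert (Lm : is_lim_seq (fun k => (x ^ k * s) ^ 2 * K) ((0 * s) * ((0 * s) * 1) * K)).
    { assert (G : is_lim_seq (fun k => x ^ k * s) (0 * s)).
      { apply (is_lim_seq_mult' (fun k => x ^ k)); [|apply is_lim_seq_const].
        apply is_lim_seq_geom. rewrite Rabs_pos_eq; lra. }
      apply (is_lim_seq_mult' (fun k => (x ^ k * s) ^ 2)); [|apply is_lim_seq_const].
      apply (is_lim_seq_mult' (fun k => x ^ k * s)); [exact G|].
      apply (is_lim_seq_mult' (fun k => x ^ k * s) (fun _ => 1)); [exact G|apply is_lim_seq_const]. }
    replace 0 with ((0 * s) * ((0 * s) * 1) * K) by ring.
    refine (is_lim_seq_le (fun _ => ip (dim L) (annih v) (annih v)) _ (Finite _) (Finite _)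
      _ (is_lim_seq_const _) Lm).
    intros k. destruct (It k) as [w [Hw Hi]]. eapply Rle_trans; [exact Hi|now apply HK]. }
  destruct (le_lt_dec (dim L) c) as [Hc|Hc]; [|now apply (ip_eq0 (dim L))].
  apply rsum_zero; intros j Hj. unfold mode.
  rewrite (supp_majD N j psi) by auto.
  rewrite rsum_zero; [ring|]. intros i Hi. rewrite (supp_majA N i psi) by auto; ring.
Qed.

End Annihilation.

(** * Correlations in the tilted state *)

Lemma ex_derive_rsum n (u : nat -> R -> R) t :
  (forall k, (k < n)%nat -> ex_derive (u k) t) ->
  ex_derive (fun s => rsum n (fun k => u k s)) t.
Proof.
  intros H. exists (rsum n (fun k => Derive (u k) t)).
  apply is_derive_rsum; intros; now apply Derive_correct, H.
Qed.

(** The zeroth power is the unrestricted [delta]; powers are only read at indices below n, where it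
    is the identity. *)
Fixpoint mpow (n : nat) (A : mat) (k : nat) : mat :=
  match k with O => delta | S k => mm n (mpow n A k) A end.

(** * The Riccati equation and the powers of its solution *)

Section Riccati.
Variables (n : nat) (Q : R -> mat).
Hypothesis Qex : forall i j t, (i < n)%nat -> (j < n)%nat -> ex_derive (fun s => Q s i j) t.
Hypothesis Qcontr : forall t x,
  rsum n (fun j => rsum n (fun i => x i * Q t i j) ^ 2) <= rsum n (fun i => x i ^ 2).
Hypothesis QUV : forall t i k, (i < n)%nat -> (k < n)%nat ->
  rsum n (fun j => Q t i j * (cosh t * delta j k + sinh t * Q 0 j k))
  = sinh t * delta i k + cosh t * Q 0 i k.

Lemma cosh_sinh_sq t : cosh t ^ 2 - sinh t ^ 2 = 1.
Proof.
  unfold cosh, sinh.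
  transitivity (exp t * exp (- t)); [field|]. rewrite <- exp_plus, Rplus_opp_r; apply exp_0.
Qed.

(** A null row vector satisfies cosh t x = - sinh t (x Q_0). As Q_0 is a contraction, cosh^2 |x|^2
    <= sinh^2 |x|^2, which cosh^2 - sinh^2 = 1 allows only for x = 0. *)
Lemma cosh_sinh_contr_inj t x :
  (forall k, (k < n)%nat ->
     rsum n (fun j => x j * (cosh t * delta j k + sinh t * Q 0 j k)) = 0) ->
  forall k, (k < n)%nat -> x k = 0.
Proof.
  intros H.
  set (y := fun k => rsum n (fun j => x j * Q 0 j k)).
  assert (E : forall k, (k < n)%nat -> cosh t * x k = - sinh t * y k).
  { intros k Hk. specialize (H k Hk).
    rewrite (rsum_ext n _ (fun j => cosh t * (delta k j * x j) + sinh t * (x j * Q 0 j k))) in H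
      by (intros; rewrite (delta_sym k); ring).
    rewrite rsum_plus, !rsum_scal, rsum_delta in H by auto. fold (y k) in H. lra. }
  pose proof (Qcontr 0 x) as C. fold y in C.
  change (rsum n (fun k => y k ^ 2) <= rsum n (fun i => x i ^ 2)) in C.
  assert (S : cosh t ^ 2 * rsum n (fun i => x i ^ 2) = sinh t ^ 2 * rsum n (fun k => y k ^ 2)).
  { rewrite <- !rsum_scal. apply rsum_ext; intros k Hk.
    transitivity ((cosh t * x k) ^ 2); [ring|]. rewrite E by auto; ring. }
  pose proof (cosh_sinh_sq t) as CS. pose proof (pow2_ge_0 (sinh t)).
  assert (X0 : rsum n (fun i => x i ^ 2) <= 0) by nra.
  intros k Hk. assert (x k ^ 2 = 0); [|nra].
  apply (rsum_nonneg_eq0 n (fun i => x i ^ 2)); auto. intros; apply pow2_ge_0.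
Qed.

(* Differentiating Q U = V, where U' = V and V' = U, gives (Q' + Q^2 - 1) U = 0. *)
Lemma riccati t i j : (i < n)%nat -> (j < n)%nat ->
  is_derive (fun s => Q s i j) t (delta i j - mm n (Q t) (Q t) i j).
Proof.
  intros Hi Hj.
  set (dQ := fun j => Derive (fun s => Q s i j) t).
  assert (HdQ : forall j, (j < n)%nat -> is_derive (fun s => Q s i j) t (dQ j)).
  { intros l Hl; now apply Derive_correct, Qex. }
  assert (Dc : is_derive cosh t (sinh t)).
  { unfold cosh, sinh. auto_derive; auto. field. }
  assert (Ds : is_derive sinh t (cosh t)).
  { unfold cosh, sinh. auto_derive; auto. field. }
  assert (Z : dQ j - (delta i j - mm n (Q t) (Q t) i j) = 0).
  { apply (cosh_sinh_contr_inj t (fun j => dQ j - (delta i j - mm n (Q t) (Q t) i j))); auto.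
    intros k Hk.
    set (U := fun j => cosh t * delta j k + sinh t * Q 0 j k).
    set (V := fun j => sinh t * delta j k + cosh t * Q 0 j k).
    assert (D1 : is_derive
       (fun s => rsum n (fun j => Q s i j * (cosh s * delta j k + sinh s * Q 0 j k))) t
       (rsum n (fun j => dQ j * U j + Q t i j * V j))).
    { apply (is_derive_rsum n
        (fun j s => Q s i j * (cosh s * delta j k + sinh s * Q 0 j k))); intros l Hl.
      apply (is_derive_mult (fun s => Q s i l) (fun s => cosh s * delta l k + sinh s * Q 0 l k)).
      - now apply HdQ.
      - apply (is_derive_plus (fun s => cosh s * delta l k) (fun s => sinh s * Q 0 l k)).
        + apply (is_derive_ext (fun s => delta l k * cosh s)); [intros; apply Rmult_comm|].
          rewrite Rmult_comm. now apply is_derive_scal.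
        + apply (is_derive_ext (fun s => Q 0 l k * sinh s)); [intros; apply Rmult_comm|].
          rewrite Rmult_comm. now apply is_derive_scal.
      - intros; apply Rmult_comm. }
    assert (D2 : is_derive
       (fun s => rsum n (fun j => Q s i j * (cosh s * delta j k + sinh s * Q 0 j k))) t (U i)).
    { apply (is_derive_ext (fun s => sinh s * delta i k + cosh s * Q 0 i k)).
      - intros s. symmetry. now apply QUV.
      - apply (is_derive_plus (fun s => sinh s * delta i k) (fun s => cosh s * Q 0 i k)).
        + apply (is_derive_ext (fun s => delta i k * sinh s)); [intros; apply Rmult_comm|].
          rewrite Rmult_comm. now apply is_derive_scal.
        + apply (is_derive_ext (fun s => Q 0 i k * cosh s)); [intros; apply Rmult_comm|].
          rewrite Rmult_comm. now apply is_derive_scal. }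
    apply is_derive_unique in D1. apply is_derive_unique in D2. rewrite D1 in D2.
    rewrite rsum_plus in D2.
    change (rsum n (fun j => (dQ j - (delta i j - mm n (Q t) (Q t) i j)) * U j) = 0).
    rewrite (rsum_ext n _ (fun j => dQ j * U j + (mm n (Q t) (Q t) i j * U j - delta i j * U j)))
      by (intros; ring).
    rewrite rsum_plus, rsum_minus, (rsum_delta n U) by auto.
    replace (rsum n (fun j => mm n (Q t) (Q t) i j * U j)) with (rsum n (fun j => Q t i j * V j)).
    - lra.
    - change (mv n (Q t) V i = mv n (mm n (Q t) (Q t)) U i). rewrite mv_mm.
      apply rsum_ext; intros l Hl. f_equal. symmetry. now apply QUV. }
  replace (delta i j - mm n (Q t) (Q t) i j) with (dQ j) by lra. now apply HdQ.
Qed.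

Lemma is_derive_mpow k t i j : (i < n)%nat -> (j < n)%nat ->
  is_derive (fun s => mpow n (Q s) k i j) t
    (INR k * (mpow n (Q t) (pred k) i j - mpow n (Q t) (S k) i j)).
Proof.
  intros Hi. revert j. induction k as [|k IH]; intros j Hj.
  - simpl INR. rewrite Rmult_0_l. exact (is_derive_const (delta i j) t).
  - pose (A := mpow n (Q t)).
    replace (INR (S k) * (mpow n (Q t) (pred (S k)) i j - mpow n (Q t) (S (S k)) i j))
      with (rsum n (fun l => (INR k * (A (pred k) i l - A (S k) i l)) * Q t l j
                             + A k i l * (delta l j - mm n (Q t) (Q t) l j))).
    + change (fun s => mpow n (Q s) (S k) i j)
        with (fun s => rsum n (fun l => mpow n (Q s) k i l * Q s l j)).
      apply (is_derive_rsum n (fun l s => mpow n (Q s) k i l * Q s l j)); intros l Hl.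
      apply (is_derive_mult (fun s => mpow n (Q s) k i l) (fun s => Q s l j)).
      * now apply IH.
      * now apply riccati.
      * intros; apply Rmult_comm.
    + rewrite rsum_plus.
      assert (E1 : rsum n (fun l => INR k * (A (pred k) i l - A (S k) i l) * Q t l j)
                   = INR k * (A k i j - A (S (S k)) i j)).
      (* For k = 0, [pred] stays at 0 and multiplication by Q would not give the power on the right;
         the factor [INR 0] removes both sides. *)
      { destruct k as [|k].
        - simpl INR. rewrite Rmult_0_l. apply rsum_zero; intros; ring.
        - rewrite (rsum_ext n _ (fun l => INR (S k) * (A k i l * Q t l j - A (S (S k)) i l * Q t l j)))
            by (intros; simpl pred; ring).
          rewrite rsum_scal, rsum_minus. reflexivity. }
      assert (E2 : rsum n (fun l => A k i l * (delta l j - mm n (Q t) (Q t) l j))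
                   = A k i j - A (S (S k)) i j).
      { rewrite (rsum_ext n _ (fun l => delta j l * A k i l - A k i l * mm n (Q t) (Q t) l j))
          by (intros; rewrite (delta_sym j); ring).
        rewrite rsum_minus, rsum_delta by auto. f_equal.
        change (mm n (A k) (mm n (Q t) (Q t)) i j = A (S (S k)) i j).
        now rewrite <- mm_assoc. }
      rewrite E1, E2, S_INR. simpl pred. unfold A. ring.
Qed.

(** The contraction acts on rows, so every row of Q^k keeps l^2 norm at most 1, and a diagonal entry
    is dominated by its row. *)
Lemma mpow_diag k t i : (i < n)%nat -> Rabs (mpow n (Q t) k i i) <= 1.
Proof.
  intros Hi.
  assert (H : rsum n (fun j => mpow n (Q t) k i j ^ 2) <= 1).
  { induction k as [|k IH].
    - simpl mpow. rewrite (rsum_ext n _ (fun j => delta i j * delta i j)) by (intros; ring).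
      rewrite rsum_delta, delta_same by auto; lra.
    - eapply Rle_trans; [apply (Qcontr t (fun l => mpow n (Q t) k i l))|exact IH]. }
  assert (mpow n (Q t) k i i ^ 2 <= 1).
  { eapply Rle_trans; [|exact H].
    apply (rsum_term_le n (fun j => mpow n (Q t) k i j ^ 2)); auto. intros; apply pow2_ge_0. }
  apply Rabs_le_between; nra.
Qed.

End Riccati.

(** * The tilted ground state and its two-point matrix on the block *)

Section Correlations.
Variables (J h : R).
Hypothesis (Hh : h <> 0) (HJ : Rabs J < Rabs h).
Variables (L n : nat) (psi : nat -> R).
Hypothesis (HnL : (n <= L)%nat).
Hypothesis (Hg : is_ground_state J h L psi).
Hypothesis (Hsupp : forall c, (dim L <= c)%nat -> psi c = 0).

Let N := nsites L.
Let d := dim L.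
Let O := hopO J h N.
Let G := hopG J h N.

(** Half of the exponent goes to each side of the inner product, so that its squared norm is the
    exponential moment at t. *)
Definition tilt (t : R) (c : nat) : R := exp (t / 2 * magn L n c) * psi c.
Definition partition (t : R) : R := ip d (tilt t) (tilt t).
Definition corr (t : R) (i j : nat) : R := ip d (majA i (tilt t)) (majD j (tilt t)).
(** Row and column are exchanged relative to [corr], so that the value at t = 0 is the block of G =
    O^T. Index i stands for site i + 1, stored at bit [L + S i]. *)
Definition corrQ (t : R) : mat := fun i j => corr t (L + S j) (L + S i) / partition t.

Lemma site_lt i : (i < n)%nat -> (L + S i < N)%nat.
Proof. unfold N, nsites; lia. Qed.

Lemma partition_expect t : partition t = expect_exp L psi n t.
Proof.
  apply rsum_ext; intros c _. unfold tilt.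
  transitivity (psi c ^ 2 * (exp (t / 2 * magn L n c) * exp (t / 2 * magn L n c))); [ring|].
  rewrite <- exp_plus. do 2 f_equal. field.
Qed.

Lemma magn_bound c : Rabs (magn L n c) <= INR n.
Proof.
  unfold magn. eapply Rle_trans; [apply rsum_Rabs|].
  rewrite <- (Rmult_1_r (INR n)), <- rsum_const. apply rsum_le; intros; rewrite Rabs_spin; lra.
Qed.

(** The bound does not depend on the volume, so positivity survives the limit L to infinity and the
    logarithm of the limit is meaningful. *)
Lemma partition_lower t : exp (- (INR n * Rabs t)) <= partition t.
Proof.
  rewrite partition_expect. rewrite <- (Rmult_1_r (exp _)), <- (proj1 Hg).
  unfold norm2, expect_exp. rewrite <- rsum_scal. apply rsum_le; intros c _.
  rewrite Rmult_comm. apply Rmult_le_compat_l; [apply pow2_ge_0|].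
  assert (K : - (INR n * Rabs t) <= t * magn L n c).
  { pose proof (magn_bound c) as B. pose proof (Rabs_mult t (magn L n c)) as E.
    pose proof (Rabs_pos t). pose proof (Rle_abs (- (t * magn L n c))) as A.
    rewrite Rabs_Ropp in A. nra. }
  destruct K as [K|K]; [apply Rlt_le; now apply exp_increasing|rewrite K; lra].
Qed.

Lemma partition_pos t : 0 < partition t.
Proof. eapply Rlt_le_trans; [apply exp_pos|apply partition_lower]. Qed.

Lemma magn_flip_in i c : (i < n)%nat ->
  magn L n (flip (L + S i) c) = magn L n c - 2 * spin c (L + S i).
Proof.
  intros Hi. unfold magn.
  rewrite <- (rsum_delta n (fun k => 2 * spin c (L + S k)) i Hi), <- rsum_minus.
  apply rsum_ext; intros k Hk. destruct (Nat.eq_dec i k) as [<-|E].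
  - rewrite spin_flip_same, delta_same; ring.
  - rewrite spin_flip_diff, delta_diff by lia; ring.
Qed.

Lemma magn_flip_out j c : (j <= L \/ L + n < j)%nat -> magn L n (flip j c) = magn L n c.
Proof.
  intros Hj. apply rsum_ext; intros k Hk. apply spin_flip_diff; lia.
Qed.

Definition inb (j : nat) : bool := andb (Nat.ltb L j) (Nat.leb j (L + n)).
Definition cw (t : R) (j : nat) : R := if inb j then cosh t else 1.
Definition sw (t : R) (j : nat) : R := if inb j then sinh t else 0.

Lemma inb_site i : (i < n)%nat -> inb (L + S i) = true.
Proof.
  intros Hi. unfold inb. rewrite (proj2 (Nat.ltb_lt _ _)), (proj2 (Nat.leb_le _ _)) by lia.
  reflexivity.
Qed.

Lemma inb_out j : (j <= L \/ L + n < j)%nat -> inb j = false.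
Proof.
  intros Hj. unfold inb. destruct (Nat.ltb_spec L j), (Nat.leb_spec j (L + n)); simpl; auto; lia.
Qed.

(* Conjugation by exp(t/2 M) rotates hyperbolically the pair (A_j, D_j) for j in the block. *)
Lemma tilt_maj t j c :
  exp (t / 2 * magn L n c) * majA j psi c = cw t j * majA j (tilt t) c - sw t j * majD j (tilt t) c /\
  exp (t / 2 * magn L n c) * majD j psi c = cw t j * majD j (tilt t) c - sw t j * majA j (tilt t) c.
Proof.
  unfold majA, majD, tilt, cw, sw.
  destruct (le_lt_dec j L) as [H|H].
  { rewrite inb_out, magn_flip_out by lia. split; ring. }
  destruct (le_lt_dec j (L + n)) as [H'|H'].
  - replace j with (L + S (j - S L))%nat by lia. set (i := (j - S L)%nat).
    assert (Hi : (i < n)%nat) by (unfold i; lia).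
    rewrite inb_site, magn_flip_in by auto. set (j' := (L + S i)%nat).
    replace (t / 2 * (magn L n c - 2 * spin c j'))
      with (t / 2 * magn L n c + - (t * spin c j')) by field.
    rewrite exp_plus. set (e := exp (t / 2 * magn L n c)).
    unfold spin. destruct (Nat.testbit c j'); unfold cosh, sinh.
    + replace (- (t * 1)) with (- t) by ring.
      assert (X : exp t * exp (- t) = 1) by (rewrite <- exp_plus, Rplus_opp_r; apply exp_0).
      split.
      * transitivity (e * (jw j' c * psi (flip j' c)) * (exp t * exp (- t))); [rewrite X; ring|field].
      * transitivity (- e * (jw j' c * psi (flip j' c)) * (exp t * exp (- t))); [rewrite X; ring|field].
    + replace (- (t * -1)) with t by ring.
      assert (X : exp t * exp (- t) = 1) by (rewrite <- exp_plus, Rplus_opp_r; apply exp_0).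
      split.
      * transitivity (e * (jw j' c * psi (flip j' c)) * (exp t * exp (- t))); [rewrite X; ring|field].
      * transitivity (e * (jw j' c * psi (flip j' c)) * (exp t * exp (- t))); [rewrite X; ring|field].
  - rewrite inb_out, magn_flip_out by lia. split; ring.
Qed.

Lemma tilt_annih t v c :
  rsum N (fun j => (cw t j * mv N O v j + sw t j * v j) * majA j (tilt t) c)
  = rsum N (fun j => (cw t j * v j + sw t j * mv N O v j) * majD j (tilt t) c).
Proof.
  pose proof (annih_zero J h Hh HJ L psi Hg Hsupp v c) as Z. fold N O in Z.
  unfold combA, combD in Z.
  apply (f_equal (fun z => exp (t / 2 * magn L n c) * z)) in Z. rewrite <- !rsum_scal in Z.
  rewrite (rsum_ext N _ (fun j => mv N O v j *
     (cw t j * majA j (tilt t) c - sw t j * majD j (tilt t) c))) in Z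
    by (intros j _; rewrite <- (proj1 (tilt_maj t j c)); ring).
  rewrite (rsum_ext N (fun k => _ * (v k * _)) (fun j => v j *
     (cw t j * majD j (tilt t) c - sw t j * majA j (tilt t) c))) in Z
    by (intros j _; rewrite <- (proj2 (tilt_maj t j c)); ring).
  apply Rminus_diag_uniq. apply Rminus_diag_eq in Z. rewrite <- Z.
  rewrite <- !rsum_minus. apply rsum_ext; intros; ring.
Qed.

(** Pairing the tilted annihilation relation with D_i: orthogonality of the D_j collapses the right
    side to one term. *)
Lemma corr_eq t v i : (i < N)%nat ->
  rsum N (fun j => (cw t j * mv N O v j + sw t j * v j) * corr t j i)
  = (cw t i * v i + sw t i * mv N O v i) * partition t.
Proof.
  intros Hi.
  assert (E := f_equal (fun f => ip d f (majD i (tilt t)))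
     (functional_extensionality _ _ (tilt_annih t v))). cbv beta in E.
  rewrite !ip_rsum_l in E.
  rewrite (rsum_ext N _ (fun j => (cw t j * mv N O v j + sw t j * v j) * corr t j i)) in E
    by (intros j _; now rewrite ip_scal_l).
  rewrite E.
  rewrite (rsum_ext N _ (fun j => delta i j * ((cw t j * v j + sw t j * mv N O v j) * partition t))).
  - now rewrite rsum_delta.
  - intros j Hj. rewrite ip_scal_l. unfold d, dim. fold N.
    rewrite (ip_majD_majD N) by auto. rewrite (delta_sym j).
    unfold partition, d, dim. fold N. ring.
Qed.

Definition blockG : mat := fun i j => G (L + S i)%nat (L + S j)%nat.

(** Although G couples the block to the whole volume, the equations close on n sites: for v the
    column of G at a block site, O v is a unit vector supported in the block, and outside the block
    the weight [sw] of v itself vanishes. *)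
Lemma corrQ_UV t i k : (i < n)%nat -> (k < n)%nat ->
  rsum n (fun j => corrQ t i j * (cosh t * delta j k + sinh t * blockG j k))
  = sinh t * delta i k + cosh t * blockG i k.
Proof.
  intros Hi Hk.
  pose proof (site_lt i Hi) as Si. pose proof (site_lt k Hk) as Sk.
  set (v := fun j => G j (L + S k)%nat).
  assert (Ov : forall j, (j < N)%nat -> mv N O v j = delta j (L + S k)).
  { intros j Hj. exact (hopO_hopG J h Hh HJ N j (L + S k) Hj Sk). }
  pose proof (corr_eq t v (L + S i) Si) as E.
  rewrite (rsum_window N (S L) n) in E.
  - rewrite Ov in E by auto. unfold cw at 2, sw at 2 in E. rewrite inb_site in E by auto.
    pose proof (partition_pos t) as P.
    apply Rmult_eq_reg_r with (partition t); [|lra].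
    transitivity ((cosh t * v (L + S i)%nat + sinh t * delta (L + S i) (L + S k)) * partition t).
    + rewrite <- E, <- rsum_scal_r. apply rsum_ext; intros j Hj.
      replace (S L + j)%nat with (L + S j)%nat by lia.
      rewrite Ov by now apply site_lt. unfold cw, sw. rewrite inb_site by auto.
      replace (delta (L + S j) (L + S k)) with (delta j k).
      * unfold corrQ, blockG, v. field. lra.
      * unfold delta. destruct (Nat.eqb_spec j k), (Nat.eqb_spec (L + S j) (L + S k)); auto; lia.
    + replace (delta (L + S i) (L + S k)) with (delta i k).
      * unfold blockG, v. ring.
      * unfold delta. destruct (Nat.eqb_spec i k), (Nat.eqb_spec (L + S i) (L + S k)); auto; lia.
  - unfold N, nsites; lia.
  - intros j Hj Hout. rewrite Ov by auto. unfold sw. rewrite inb_out by lia.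
    rewrite delta_diff by lia. ring.
Qed.

Lemma corrQ_0 i k : (i < n)%nat -> (k < n)%nat -> corrQ 0 i k = blockG i k.
Proof.
  intros Hi Hk. pose proof (corrQ_UV 0 i k Hi Hk) as E.
  rewrite cosh_0, sinh_0 in E.
  rewrite (rsum_ext n _ (fun j => delta k j * corrQ 0 i j)) in E
    by (intros; rewrite (delta_sym k); ring).
  rewrite rsum_delta in E by auto. lra.
Qed.

(* Bessel's inequality: the vectors A_j chi are orthogonal, and so are the D_i chi. *)
Lemma corrQ_contr t x :
  rsum n (fun j => rsum n (fun i => x i * corrQ t i j) ^ 2) <= rsum n (fun i => x i ^ 2).
Proof.
  set (y := fun j => rsum n (fun i => x i * corrQ t i j)).
  pose proof (partition_pos t) as P.
  set (f := fun c => rsum n (fun i => x i * majD (L + S i) (tilt t) c)).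
  (* [g] is the orthogonal projection of [f] onto the span of the A_j vectors of the block, whence
     <g, f> = <g, g> below. *)
  set (g := fun c => rsum n (fun j => y j * majA (L + S j) (tilt t) c)).
  assert (dd : forall i j, delta (L + S i) (L + S j) = delta i j).
  { intros i j. unfold delta.
    destruct (Nat.eqb_spec i j), (Nat.eqb_spec (L + S i) (L + S j)); auto; lia. }
  assert (Hff : ip d f f = partition t * rsum n (fun i => x i ^ 2)).
  { unfold f at 1. rewrite ip_rsum_l, <- rsum_scal. apply rsum_ext; intros i Hi.
    rewrite ip_scal_l. unfold f. rewrite ip_rsum_r.
    rewrite (rsum_ext n _ (fun j => delta i j * (x j * partition t))).
    - rewrite rsum_delta by auto. ring.
    - intros j Hj. rewrite ip_scal_r. unfold d, dim. fold N.
      rewrite (ip_majD_majD N) by auto using site_lt. rewrite dd.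
      unfold partition, d, dim. fold N. ring. }
  assert (Hgg : ip d g g = partition t * rsum n (fun j => y j ^ 2)).
  { unfold g at 1. rewrite ip_rsum_l, <- rsum_scal. apply rsum_ext; intros i Hi.
    rewrite ip_scal_l. unfold g. rewrite ip_rsum_r.
    rewrite (rsum_ext n _ (fun j => delta i j * (y j * partition t))).
    - rewrite rsum_delta by auto. ring.
    - intros j Hj. rewrite ip_scal_r. unfold d, dim. fold N.
      rewrite (ip_majA_majA N) by auto using site_lt. rewrite dd.
      unfold partition, d, dim. fold N. ring. }
  assert (Hgf : ip d g f = partition t * rsum n (fun j => y j ^ 2)).
  { unfold g. rewrite ip_rsum_l, <- rsum_scal. apply rsum_ext; intros j Hj.
    rewrite ip_scal_l. unfold f. rewrite ip_rsum_r.
    rewrite (rsum_ext n _ (fun i => partition t * (x i * corrQ t i j))).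
    - rewrite rsum_scal. fold (y j). ring.
    - intros i Hi. rewrite ip_scal_r. unfold corrQ. fold (corr t (L + S j) (L + S i)). field. lra. }
  pose proof (ip_pos d (fun c => f c - g c)) as B.
  rewrite ip_minus_l, !ip_minus_r, (ip_sym d f g), Hff, Hgf, Hgg in B.
  apply Rmult_le_reg_l with (partition t); auto. fold y.
  change (partition t * rsum n (fun j => y j ^ 2) <= partition t * rsum n (fun i => x i ^ 2)). lra.
Qed.

Lemma ex_derive_partition t : ex_derive partition t.
Proof.
  unfold partition, ip, tilt.
  apply (ex_derive_rsum d (fun c s => exp (s / 2 * magn L n c) * psi c
                                     * (exp (s / 2 * magn L n c) * psi c))).
  intros c _. auto_derive; auto.
Qed.

Lemma corrQ_ex_derive i j t : ex_derive (fun s => corrQ s i j) t.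
Proof.
  unfold corrQ. apply ex_derive_div.
  - unfold corr, ip, majA, majD, tilt.
    apply (ex_derive_rsum d (fun c s => jw (L + S j) c *
       (exp (s / 2 * magn L n (flip (L + S j) c)) * psi (flip (L + S j) c)) *
       (- jw (L + S i) c * spin c (L + S i) *
       (exp (s / 2 * magn L n (flip (L + S i) c)) * psi (flip (L + S i) c))))).
    intros c _. auto_derive; auto.
  - apply ex_derive_partition.
  - pose proof (partition_pos t); lra.
Qed.

(** The logarithmic derivative is the tilted mean magnetization, and A_j D_j = sigma^z_j turns each
    of its terms into a diagonal correlation. *)
Lemma is_derive_ln_partition t :
  is_derive (fun s => ln (partition s)) t (rsum n (fun i => corrQ t i i)).
Proof.
  pose proof (partition_pos t) as P.
  assert (D : is_derive partition t (rsum n (fun i => corr t (L + S i) (L + S i)))).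
  { apply (is_derive_ext (fun s => rsum d (fun c => psi c ^ 2 * exp (s * magn L n c)))).
    { intros s. symmetry. apply partition_expect. }
    replace (rsum n (fun i => corr t (L + S i) (L + S i)))
      with (rsum d (fun c => psi c ^ 2 * (magn L n c * exp (t * magn L n c)))).
    - apply (is_derive_rsum d (fun c s => psi c ^ 2 * exp (s * magn L n c))); intros c _.
      auto_derive; auto. ring.
    - rewrite (rsum_ext n _ (fun i => rsum d (fun c =>
        spin c (L + S i) * (psi c ^ 2 * exp (t * magn L n c))))).
      + rewrite rsum_swap. apply rsum_ext; intros c _. rewrite rsum_scal_r.
        unfold magn at 1. ring.
      + intros i Hi. unfold corr, d, dim. fold N.
        rewrite (ip_majA N) by now apply site_lt. apply rsum_ext; intros c _.
        rewrite majA_majD_same. unfold tilt.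
        transitivity (spin c (L + S i) * (psi c ^ 2 *
          (exp (t / 2 * magn L n c) * exp (t / 2 * magn L n c)))); [ring|].
        rewrite <- exp_plus. do 3 f_equal. field. }
  replace (rsum n (fun i => corrQ t i i))
    with (rsum n (fun i => corr t (L + S i) (L + S i)) * / partition t)
    by (rewrite <- rsum_scal_r; reflexivity).
  apply (is_derive_comp ln partition); [|exact D].
  now apply is_derive_Reals, derivable_pt_lim_ln.
Qed.

Definition free_energy (t : R) : R := ln (partition t) / INR n.
Definition moment (k : nat) (t : R) : R := rsum n (fun i => mpow n (corrQ t) k i i) / INR n.

Lemma corrQ_UV_self t i k : (i < n)%nat -> (k < n)%nat ->
  rsum n (fun j => corrQ t i j * (cosh t * delta j k + sinh t * corrQ 0 j k))
  = sinh t * delta i k + cosh t * corrQ 0 i k.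
Proof.
  intros Hi Hk. rewrite (corrQ_0 i k), <- corrQ_UV by auto.
  apply rsum_ext; intros j Hj. now rewrite corrQ_0.
Qed.

Lemma moment_derive k t :
  is_derive (moment k) t (INR k * (moment (pred k) t - moment (S k) t)).
Proof.
  unfold moment, Rdiv.
  apply (is_derive_ext (fun s => / INR n * rsum n (fun i => mpow n (corrQ s) k i i)));
    [intros; apply Rmult_comm|].
  replace (INR k * (_ - _)) with (/ INR n * rsum n (fun i => INR k *
    (mpow n (corrQ t) (pred k) i i - mpow n (corrQ t) (S k) i i)))
    by (rewrite rsum_scal, rsum_minus; ring).
  apply is_derive_scal.
  apply (is_derive_rsum n (fun i s => mpow n (corrQ s) k i i)); intros i Hi.
  apply is_derive_mpow; auto using corrQ_ex_derive, corrQ_contr, corrQ_UV_self.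
Qed.

Lemma moment_bound k t : (0 < n)%nat -> Rabs (moment k t) <= 1.
Proof.
  intros Hn. unfold moment, Rdiv. assert (P : 0 < INR n) by now apply lt_0_INR.
  rewrite Rabs_mult, (Rabs_pos_eq (/ INR n)) by (apply Rlt_le, Rinv_0_lt_compat; auto).
  apply Rmult_le_reg_r with (INR n); auto. rewrite Rmult_assoc, Rinv_l by lra.
  rewrite Rmult_1_r, Rmult_1_l.
  eapply Rle_trans; [apply rsum_Rabs|].
  rewrite <- (Rmult_1_r (INR n)), <- rsum_const. apply rsum_le; intros i Hi.
  apply mpow_diag; auto using corrQ_contr.
Qed.

Lemma free_energy_derive t : is_derive free_energy t (moment 1 t).
Proof.
  unfold free_energy, Rdiv.
  apply (is_derive_ext (fun s => / INR n * ln (partition s))); [intros; apply Rmult_comm|].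
  replace (moment 1 t) with (/ INR n * rsum n (fun i => corrQ t i i)).
  - apply is_derive_scal, is_derive_ln_partition.
  - unfold moment, Rdiv. rewrite Rmult_comm. f_equal. apply rsum_ext; intros i Hi.
    simpl mpow. unfold mm. now rewrite rsum_delta.
Qed.

Lemma free_energy_0 : free_energy 0 = 0.
Proof.
  unfold free_energy. rewrite partition_expect. unfold expect_exp.
  rewrite (rsum_ext (dim L) _ (fun c => psi c ^ 2))
    by (intros; rewrite Rmult_0_l, exp_0; ring).
  change (ln (norm2 L psi) / INR n = 0). rewrite (proj1 Hg), ln_1. unfold Rdiv; ring.
Qed.

Lemma moment_0 k : moment k 0 = rsum n (fun i => mpow n blockG k i i) / INR n.
Proof.
  unfold moment. f_equal. apply rsum_ext; intros i Hi.
  assert (E : forall j, (j < n)%nat -> mpow n (corrQ 0) k i j = mpow n blockG k i j).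
  { induction k as [|k IH]; intros j Hj; [reflexivity|].
    simpl mpow. apply rsum_ext; intros l Hl. now rewrite IH, corrQ_0. }
  now apply E.
Qed.

End Correlations.

(** * Families of asymptotically Toeplitz matrices *)

(** Convergence in n uniformly over L >= n. This survives sending L to infinity at fixed n first,
    which is the order of the limits in the theorem. *)
Definition conv (u : nat -> nat -> R) (l : R) : Prop :=
  forall eps, 0 < eps -> exists n0, forall n L, (n0 <= n)%nat -> (n <= L)%nat ->
    Rabs (u n L - l) < eps.

Lemma conv_const a : conv (fun _ _ => a) a.
Proof. intros eps H; exists 0%nat; intros. rewrite Rminus_diag, Rabs_R0; auto. Qed.

Lemma conv_plus u v a b : conv u a -> conv v b -> conv (fun n L => u n L + v n L) (a + b).
Proof.
  intros Hu Hv eps He.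
  destruct (Hu (eps / 2) ltac:(lra)) as [n1 H1]. destruct (Hv (eps / 2) ltac:(lra)) as [n2 H2].
  exists (max n1 n2); intros n L Hn HL.
  specialize (H1 n L ltac:(lia) HL). specialize (H2 n L ltac:(lia) HL).
  apply Rabs_def2 in H1; apply Rabs_def2 in H2. apply Rabs_def1; lra.
Qed.

Lemma conv_scal c u a : conv u a -> conv (fun n L => c * u n L) (c * a).
Proof.
  intros Hu eps He.
  assert (P : 0 < 1 + Rabs c) by (pose proof (Rabs_pos c); lra).
  destruct (Hu (eps / (1 + Rabs c)) (Rdiv_lt_0_compat _ _ He P)) as [n1 H1].
  exists n1; intros n L Hn HL. specialize (H1 n L Hn HL).
  rewrite <- Rmult_minus_distr_l, Rabs_mult.
  apply Rmult_lt_compat_r with (r := 1 + Rabs c) in H1; auto.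
  unfold Rdiv in H1. rewrite Rmult_assoc, Rinv_l, Rmult_1_r in H1 by lra.
  pose proof (Rabs_pos (u n L - a)). pose proof (Rabs_pos c). nra.
Qed.

(** The limits of the approximants need not be known to converge: only the Cauchy property is
    transferred, and the diagonal L = n supplies the candidate limit. *)
Lemma conv_approx u :
  (forall eps, 0 < eps -> exists v l n0, conv v l /\
     forall n L, (n0 <= n)%nat -> (n <= L)%nat -> Rabs (u n L - v n L) <= eps) ->
  exists l, conv u l.
Proof.
  intros H.
  assert (Cau : forall eps, 0 < eps -> exists n0, forall n L n' L',
     (n0 <= n)%nat -> (n <= L)%nat -> (n0 <= n')%nat -> (n' <= L')%nat ->
     Rabs (u n L - u n' L') < eps).
  { intros eps He. destruct (H (eps / 8) ltac:(lra)) as [v [l [n0 [Hv Hu]]]].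
    destruct (Hv (eps / 8) ltac:(lra)) as [n1 H1].
    exists (max n0 n1); intros n L n' L' A B A' B'.
    pose proof (Hu n L ltac:(lia) B) as U. pose proof (Hu n' L' ltac:(lia) B') as U'.
    pose proof (H1 n L ltac:(lia) B) as V. pose proof (H1 n' L' ltac:(lia) B') as V'.
    apply Rabs_le_between in U; apply Rabs_le_between in U'.
    apply Rabs_def2 in V; apply Rabs_def2 in V'. apply Rabs_def1; lra. }
  destruct (Rcomplete.R_complete (fun m => u m m)) as [l Hl].
  { intros eps He. destruct (Cau eps He) as [n0 Hn0].
    exists n0; intros a b Ha Hb. apply Hn0; lia. }
  exists l; intros eps He.
  destruct (Cau (eps / 2) ltac:(lra)) as [n0 Hn0].
  destruct (Hl (eps / 2) ltac:(lra)) as [n1 H1].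
  exists n0; intros n L Hn HL.
  specialize (Hn0 n L (max n0 n1) (max n0 n1) Hn HL ltac:(lia) ltac:(lia)).
  specialize (H1 (max n0 n1) ltac:(lia)). unfold Rdist in H1.
  apply Rabs_def2 in Hn0; apply Rabs_def2 in H1. apply Rabs_def1; lra.
Qed.

Definition fam := nat -> nat -> mat.

Section Bulk.
(* Matrices of size sz n L with a distinguished window of n sites starting at off n L. *)
Variables (sz off : nat -> nat -> nat).
Hypothesis window_in : forall n L, (n <= L)%nat -> (off n L + n <= sz n L)%nat.

(** One width and one symbol serve all n and L. Only rows at distance w from the edges of the window
    are constrained, but along their whole length, even outside the window; this makes the notion
    stable under products. *)
Definition toeplitz_bulk (X : fam) : Prop :=
  exists (w : nat) (a : Z -> R),
    (forall z, (Z.of_nat w < Z.abs z)%Z -> a z = 0) /\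
    forall n L i j, (n <= L)%nat -> (w <= i)%nat -> (i + w < n)%nat -> (j < sz n L)%nat ->
      X n L (off n L + i)%nat j = a (Z.of_nat j - Z.of_nat (off n L + i))%Z.

Definition nbound (X : fam) (C : R) : Prop :=
  forall n L, (n <= L)%nat -> rnorm (sz n L) (X n L) C.

Definition fmm (X Y : fam) : fam := fun n L => mm (sz n L) (X n L) (Y n L).
Definition fadd (X Y : fam) : fam := fun n L => madd (X n L) (Y n L).
Definition fsub (X Y : fam) : fam := fun n L => msub (X n L) (Y n L).
Definition fscal (c : R) (X : fam) : fam := fun n L => mscal c (X n L).

Lemma toeplitz_add X Y : toeplitz_bulk X -> toeplitz_bulk Y -> toeplitz_bulk (fadd X Y).
Proof.
  intros [w [a [Ha HX]]] [w' [b [Hb HY]]].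
  exists (w + w')%nat, (fun z => a z + b z); split.
  - intros z Hz. rewrite Ha, Hb by lia; ring.
  - intros n L i j HL H1 H2 Hj. unfold fadd, madd. rewrite HX, HY by lia. reflexivity.
Qed.

Lemma toeplitz_scal c X : toeplitz_bulk X -> toeplitz_bulk (fscal c X).
Proof.
  intros [w [a [Ha HX]]]. exists w, (fun z => c * a z); split.
  - intros z Hz. rewrite Ha by lia; ring.
  - intros n L i j HL H1 H2 Hj. unfold fscal, mscal. rewrite HX by lia. reflexivity.
Qed.

Lemma toeplitz_sub X Y : toeplitz_bulk X -> toeplitz_bulk Y -> toeplitz_bulk (fsub X Y).
Proof.
  intros HX HY. replace (fsub X Y) with (fadd X (fscal (-1) Y)).
  - apply toeplitz_add; auto. now apply toeplitz_scal.
  - extensionality n; extensionality L; mext. unfold fadd, madd, fscal, mscal, fsub, msub; ring.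
Qed.

Lemma toeplitz_zero : toeplitz_bulk (fun _ _ => mzero).
Proof. exists 0%nat, (fun _ => 0); split; reflexivity. Qed.

Lemma toeplitz_delta : toeplitz_bulk (fun _ _ => delta).
Proof.
  exists 0%nat, (fun z => if Z.eqb z 0 then 1 else 0); split.
  - intros z Hz. now rewrite (proj2 (Z.eqb_neq z 0)) by lia.
  - intros n L i j HL _ _ Hj. unfold delta.
    destruct (Nat.eqb_spec (off n L + i) j), (Z.eqb_spec (Z.of_nat j - Z.of_nat (off n L + i)) 0);
      auto; lia.
Qed.

Lemma toeplitz_ext X Y :
  (forall n L i j, (n <= L)%nat -> (i < sz n L)%nat -> (j < sz n L)%nat -> X n L i j = Y n L i j) ->
  toeplitz_bulk X -> toeplitz_bulk Y.
Proof.
  intros E [w [a [Ha HX]]]. exists w, a; split; auto.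
  intros n L i j HL H1 H2 Hj. rewrite <- E; auto. specialize (window_in n L HL). lia.
Qed.

(** Row i of X reaches only rows within w of i; keeping distance w + w' from the edges places those
    rows in the bulk of Y. The new symbol is the convolution. *)
Lemma toeplitz_mm X Y : toeplitz_bulk X -> toeplitz_bulk Y -> toeplitz_bulk (fmm X Y).
Proof.
  intros [w [a [Ha HX]]] [w' [b [Hb HY]]].
  exists (w + w')%nat, (fun z => rsum (2 * w + 1) (fun e =>
     a (Z.of_nat e - Z.of_nat w)%Z * b (z - (Z.of_nat e - Z.of_nat w))%Z)); split.
  - intros z Hz. apply rsum_zero; intros e He. rewrite Hb by lia; ring.
  - intros n L i j HL H1 H2 Hj. unfold fmm, mm. specialize (window_in n L HL).
    set (o := off n L) in *.
    rewrite (rsum_window (sz n L) (o + i - w) (2 * w + 1)).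
    + apply rsum_ext; intros e He.
      rewrite HX by lia.
      replace (o + i - w + e)%nat with (o + (i - w + e))%nat by lia.
      unfold o; rewrite HY by lia. f_equal; f_equal; lia.
    + lia.
    + intros k Hk Hout. rewrite HX, Ha by lia. ring.
Qed.

Lemma nbound_le X a b : a <= b -> nbound X a -> nbound X b.
Proof. intros H HX n L HL. apply rnorm_le with a; auto. Qed.

Lemma nbound_add X Y a b : nbound X a -> nbound Y b -> nbound (fadd X Y) (a + b).
Proof. intros HX HY n L HL. apply rnorm_add; auto. Qed.

Lemma nbound_mm X Y a b : 0 <= b -> nbound X a -> nbound Y b -> nbound (fmm X Y) (a * b).
Proof. intros Hb HX HY n L HL. apply rnorm_mm; auto. Qed.

Lemma nbound_scal c X a : nbound X a -> nbound (fscal c X) (Rabs c * a).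
Proof. intros HX n L HL. apply rnorm_scal; auto. Qed.

Lemma nbound_ext X Y a :
  (forall n L i j, (n <= L)%nat -> (i < sz n L)%nat -> (j < sz n L)%nat -> X n L i j = Y n L i j) ->
  nbound X a -> nbound Y a.
Proof.
  intros E HX n L HL i Hi. rewrite (rsum_ext _ _ (fun j => Rabs (X n L i j))); [now apply HX|].
  intros j Hj. now rewrite E.
Qed.

(** The closure of the bulk Toeplitz families in the uniform row-sum norm. The bound on X itself is
    what makes products continuous. *)
Definition asym_toeplitz (X : fam) : Prop :=
  (exists C, 0 <= C /\ nbound X C) /\
  forall eps, 0 < eps -> exists Y, toeplitz_bulk Y /\ nbound (fsub X Y) eps.

Lemma asym_exact X C : 0 <= C -> nbound X C -> toeplitz_bulk X -> asym_toeplitz X.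
Proof.
  intros HC HX HT. split; [exists C; auto|].
  intros eps He. exists X; split; auto. intros n L HL i Hi.
  rewrite rsum_zero; [lra|]. intros j _. unfold fsub, msub. rewrite Rminus_diag; apply Rabs_R0.
Qed.

Lemma asym_add X Y : asym_toeplitz X -> asym_toeplitz Y -> asym_toeplitz (fadd X Y).
Proof.
  intros [[C [HC BX]] AX] [[C' [HC' BY]] AY]. split.
  - exists (C + C'); split; [lra|]. now apply nbound_add.
  - intros eps He. destruct (AX (eps / 2) ltac:(lra)) as [X' [TX EX]].
    destruct (AY (eps / 2) ltac:(lra)) as [Y' [TY EY]].
    exists (fadd X' Y'); split; [now apply toeplitz_add|].
    replace eps with (eps / 2 + eps / 2) by field.
    apply (nbound_ext (fadd (fsub X X') (fsub Y Y'))); [|now apply nbound_add].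
    intros; unfold fadd, fsub, madd, msub; ring.
Qed.

Lemma asym_scal c X : asym_toeplitz X -> asym_toeplitz (fscal c X).
Proof.
  intros [[C [HC BX]] AX]. split.
  - exists (Rabs c * C); split; [apply Rmult_le_pos; [apply Rabs_pos|auto]|].
    now apply nbound_scal.
  - intros eps He. assert (P : 0 < 1 + Rabs c) by (pose proof (Rabs_pos c); lra).
    destruct (AX (eps / (1 + Rabs c)) (Rdiv_lt_0_compat _ _ He P)) as [X' [TX EX]].
    exists (fscal c X'); split; [now apply toeplitz_scal|].
    apply nbound_le with (Rabs c * (eps / (1 + Rabs c))).
    + apply Rle_trans with ((1 + Rabs c) * (eps / (1 + Rabs c))).
      * apply Rmult_le_compat_r; [apply Rlt_le, Rdiv_lt_0_compat; auto|lra].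
      * apply Req_le. field. lra.
    + apply (nbound_ext (fscal c (fsub X X'))); [|now apply nbound_scal].
      intros; unfold fscal, fsub, mscal, msub; ring.
Qed.

Lemma asym_mm X Y : asym_toeplitz X -> asym_toeplitz Y -> asym_toeplitz (fmm X Y).
Proof.
  intros [[C [HC BX]] AX] [[C' [HC' BY]] AY]. split.
  - exists (C * C'); split; [nra|]. now apply nbound_mm.
  - intros eps He.
    (* From X Y - X' Y' = (X - X') Y + X' (Y - Y') the error is e1 C' + (C + e1) e1. The cap e1 <= 1
       bounds it by e1 (C + C' + 1). *)
    set (e1 := Rmin 1 (eps / (C + C' + 1))).
    assert (D : 0 < eps / (C + C' + 1)) by (apply Rdiv_lt_0_compat; lra).
    assert (P1 : 0 < e1) by (unfold e1; apply Rmin_glb_lt; lra).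
    assert (P2 : e1 <= 1) by apply Rmin_l.
    assert (P3 : e1 * (C + C' + 1) <= eps).
    { apply Rle_trans with (eps / (C + C' + 1) * (C + C' + 1)).
      - apply Rmult_le_compat_r; [lra|apply Rmin_r].
      - apply Req_le; field; lra. }
    destruct (AX e1 P1) as [X' [TX EX]]. destruct (AY e1 P1) as [Y' [TY EY]].
    exists (fmm X' Y'); split; [now apply toeplitz_mm|].
    assert (BX' : nbound X' (C + e1)).
    { replace e1 with (Rabs (-1) * e1) by (rewrite Rabs_left; lra).
      apply (nbound_ext (fadd X (fscal (-1) (fsub X X')))).
      - intros; unfold fadd, madd, fscal, mscal, fsub, msub; ring.
      - apply nbound_add; auto. now apply nbound_scal. }
    apply nbound_le with (e1 * C' + (C + e1) * e1); [nra|].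
    apply (nbound_ext (fadd (fmm (fsub X X') Y) (fmm X' (fsub Y Y')))).
    + intros n L i j _ _ _. unfold fadd, fmm, fsub.
      rewrite mm_sub_l, mm_sub_r. unfold madd, msub. ring.
    + apply nbound_add; apply nbound_mm; auto; lra.
Qed.

Lemma asym_limit X :
  (forall eps, 0 < eps -> exists Y, asym_toeplitz Y /\ nbound (fsub X Y) eps) -> asym_toeplitz X.
Proof.
  intros H. split.
  - destruct (H 1 ltac:(lra)) as [Y [[[C [HC BY]] _] E]].
    exists (1 + C); split; [lra|].
    apply (nbound_ext (fadd (fsub X Y) Y)); [|now apply nbound_add].
    intros; unfold fadd, madd, fsub, msub; ring.
  - intros eps He. destruct (H (eps / 2) ltac:(lra)) as [Y [[_ AY] E]].
    destruct (AY (eps / 2) ltac:(lra)) as [Y' [TY EY]].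
    exists Y'; split; auto. replace eps with (eps / 2 + eps / 2) by field.
    apply (nbound_ext (fadd (fsub X Y) (fsub Y Y'))); [|now apply nbound_add].
    intros; unfold fadd, madd, fsub, msub; ring.
Qed.

Lemma asym_geom_limit X (Y : nat -> fam) C q : 0 <= q < 1 ->
  (forall m, asym_toeplitz (Y m)) -> (forall m, nbound (fsub X (Y m)) (C * q ^ m / (1 - q))) ->
  asym_toeplitz X.
Proof.
  intros Hq HY HB. apply asym_limit; intros eps He.
  assert (Lm : is_lim_seq (fun m => C * q ^ m / (1 - q)) (C / (1 - q) * 0)).
  { apply is_lim_seq_ext with (fun m => C / (1 - q) * q ^ m); [intros; field; lra|].
    apply (is_lim_seq_mult' (fun _ => C / (1 - q))); [apply is_lim_seq_const|].
    apply is_lim_seq_geom. rewrite Rabs_pos_eq; lra. }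
  rewrite Rmult_0_r in Lm.
  apply is_lim_seq_spec in Lm. destruct (Lm (mkposreal eps He)) as [m Hm].
  specialize (Hm m (Nat.le_refl m)). simpl in Hm. rewrite Rminus_0_r in Hm.
  exists (Y m); split; auto. apply nbound_le with (C * q ^ m / (1 - q)); auto.
  apply Rabs_def2 in Hm; lra.
Qed.

Lemma rsum_edges n w : (w <= n)%nat ->
  rsum n (fun i => (if Nat.ltb i w then 1 else 0) + (if Nat.leb n (i + w) then 1 else 0))
  <= 2 * INR w.
Proof.
  intros Hw. rewrite rsum_plus.
  rewrite (rsum_window n 0 w), (rsum_window n (n - w) w); try lia.
  - rewrite double. apply Rplus_le_compat; rewrite <- (Rmult_1_r (INR w)), <- rsum_const;
      apply rsum_le; intros k _.
    + destruct (Nat.ltb _ _); lra.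
    + destruct (Nat.leb _ _); lra.
  - intros k Hk Ho. rewrite (proj2 (Nat.leb_gt n (k + w))) by lia; reflexivity.
  - intros k Hk Ho. rewrite (proj2 (Nat.ltb_ge k w)) by lia; reflexivity.
Qed.

Lemma asym_trace_conv X : asym_toeplitz X -> exists l,
  conv (fun n L => rsum n (fun i => X n L (off n L + i)%nat (off n L + i)%nat) / INR n) l.
Proof.
  intros [[C [HC BX]] AX]. apply conv_approx; intros eps He.
  destruct (AX (eps / 2) ltac:(lra)) as [Y [[w [a [Ha HY]]] EY]].
  set (K := C + Rabs (a 0%Z)).
  assert (HK : 0 <= K) by (unfold K; pose proof (Rabs_pos (a 0%Z)); lra).
  (* At most 2 w edge rows cost at most K each; from n >= m on, this total is at most half of eps
     times n. The added 1 keeps the denominator positive. *)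
  destruct (archimed_cor1 (eps / 2 / (2 * INR w * K + 1))) as [m [Hm Hm0]].
  { pose proof (pos_INR w). apply Rdiv_lt_0_compat; [lra|]. nra. }
  exists (fun _ _ => a 0%Z), (a 0%Z), (max m (S w)); split; [apply conv_const|].
  intros n L Hn HL. pose proof (window_in n L HL) as So. set (o := off n L) in *.
  assert (Pn : 0 < INR n) by (apply lt_0_INR; lia).
  replace (_ / INR n - a 0%Z)
    with (rsum n (fun i => X n L (o + i)%nat (o + i)%nat - a 0%Z) / INR n)
    by (rewrite rsum_minus, rsum_const; field; lra).
  unfold Rdiv. rewrite Rabs_mult, (Rabs_pos_eq (/ INR n)) by (apply Rlt_le, Rinv_0_lt_compat; auto).
  apply Rmult_le_reg_r with (INR n); auto. rewrite Rmult_assoc, Rinv_l, Rmult_1_r by lra.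
  eapply Rle_trans; [apply rsum_Rabs|].
  apply Rle_trans with (rsum n (fun i => eps / 2 + K *
     ((if Nat.ltb i w then 1 else 0) + (if Nat.leb n (i + w) then 1 else 0)))).
  - apply rsum_le; intros i Hi.
    assert (B1 : Rabs (X n L (o + i)%nat (o + i)%nat - a 0%Z) <= K).
    { unfold K. eapply Rle_trans; [apply Rabs_triang|]. rewrite Rabs_Ropp.
      apply Rplus_le_compat_r. apply (rnorm_entry (sz n L)); auto; lia. }
    destruct (Nat.ltb_spec i w), (Nat.leb_spec n (i + w)); try lra.
    assert (E : Y n L (o + i)%nat (o + i)%nat = a 0%Z).
    { unfold o; rewrite HY by lia. f_equal; lia. }
    rewrite <- E.
    pose proof (rnorm_entry (sz n L) _ _ (o + i) (o + i) (EY n L HL) ltac:(lia) ltac:(lia)) as F.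
    unfold fsub, msub in F. lra.
  - rewrite rsum_plus, rsum_const, rsum_scal.
    pose proof (rsum_edges n w ltac:(lia)) as Ed.
    set (s := rsum n _) in *.
    assert (HN : 2 * INR w * K + 1 <= eps / 2 * INR n).
    { assert (INR m <= INR n) by (apply le_INR; lia).
      assert (Pm : 0 < INR m) by now apply lt_0_INR.
      pose proof (pos_INR w).
      assert (Dp : 0 < 2 * INR w * K + 1) by nra.
      apply Rmult_lt_compat_r with (r := INR m * (2 * INR w * K + 1)) in Hm; [|nra].
      replace (/ INR m * (INR m * (2 * INR w * K + 1))) with (2 * INR w * K + 1) in Hm by (field; lra).
      replace (eps / 2 / (2 * INR w * K + 1) * (INR m * (2 * INR w * K + 1)))
        with (eps / 2 * INR m) in Hm by (field; lra).
      nra. }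
    assert (K * s <= 2 * INR w * K) by nra. lra.
Qed.

End Bulk.

(** Two settings for [Bulk]: the whole volume, whose window starts at bit [S L], that is at site 1,
    and the block taken as a matrix of its own. *)
Definition szV (n L : nat) : nat := nsites L.
Definition offV (n L : nat) : nat := S L.
Definition szB (n L : nat) : nat := n.
Definition offB (n L : nat) : nat := 0%nat.
Definition restr (X : fam) : fam := fun n L i j => X n L (L + S i)%nat (L + S j)%nat.

Lemma window_in_volume n L : (n <= L)%nat -> (offV n L + n <= szV n L)%nat.
Proof. unfold offV, szV, nsites; lia. Qed.

Lemma window_in_block n L : (n <= L)%nat -> (offB n L + n <= szB n L)%nat.
Proof. unfold offB, szB; lia. Qed.

(** The root and the inverse are formed in the volume, the powers in the block; this is the bridge.
    Restriction only drops terms from the row sums and keeps the symbol. *)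
Lemma asym_restr X : asym_toeplitz szV offV X -> asym_toeplitz szB offB (restr X).
Proof.
  assert (NB : forall Y a, nbound szV Y a -> nbound szB (restr Y) a).
  { intros Y a HY n L HL i Hi. unfold szB in Hi.
    eapply Rle_trans; [|apply (HY n L HL (L + S i)%nat); unfold szV, nsites; lia].
    unfold szB, szV, nsites, restr.
    replace (2 * L + 1)%nat with (S L + n + (L - n))%nat by lia.
    rewrite !rsum_add.
    assert (0 <= rsum (S L) (fun j => Rabs (Y n L (L + S i)%nat j)))
      by (apply rsum_nonneg; intros; apply Rabs_pos).
    assert (0 <= rsum (L - n) (fun k => Rabs (Y n L (L + S i)%nat (S L + n + k)%nat)))
      by (apply rsum_nonneg; intros; apply Rabs_pos).
    rewrite (rsum_ext n (fun j => Rabs (Y n L (L + S i)%nat (L + S j)%nat))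
      (fun k => Rabs (Y n L (L + S i)%nat (S L + k)%nat))).
    - lra.
    - intros k _. do 2 f_equal. lia. }
  intros [[C [HC BX]] AX]. split; [exists C; auto|].
  intros eps He. destruct (AX eps He) as [Y [[w [a [Ha HY]]] EY]].
  exists (restr Y); split.
  - exists w, a; split; auto. intros n L i j HL H1 H2 Hj. unfold szB in Hj. unfold restr, offB.
    specialize (HY n L i (L + S j)%nat HL H1 H2). unfold offV, szV, nsites in HY.
    replace (L + S (0 + i))%nat with (S L + i)%nat by lia.
    rewrite HY by lia. f_equal; lia.
  - apply (NB (fsub X Y) eps EY).
Qed.

(** * Bulk Toeplitz structure of the hopping matrix and of its polar factor *)

Section HopBulk.
Variables (J h : R).
Hypothesis (Hh : h <> 0) (HJ : Rabs J < Rabs h).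

Definition volfam (X : nat -> mat) : fam := fun _ L => X (nsites L).

Let fM := volfam (hopM J h).
Let fMt := volfam (fun N => mtr (hopM J h N)).

Lemma toeplitz_mid : toeplitz_bulk szV offV (volfam mid).
Proof.
  apply (toeplitz_ext szV offV window_in_volume (fun _ _ => delta)); [|apply toeplitz_delta].
  intros n L i j _ Hi _. unfold volfam. now rewrite mid_in.
Qed.

Lemma toeplitz_hopM : toeplitz_bulk szV offV fM.
Proof.
  exists 1%nat, (fun z => if Z.eqb z 0 then h else if Z.eqb z (-1) then - J else 0); split.
  - intros z Hz. destruct (Z.eqb_spec z 0); [lia|]. destruct (Z.eqb_spec z (-1)); [lia|auto].
  - intros n L i j HL H1 H2 Hj. pose proof (window_in_volume n L HL) as S0. unfold fM, volfam.
    rewrite hopM_in by (unfold szV in *; lia). unfold delta. set (o := offV n L).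
    destruct (Nat.eqb_spec (o + i) j), (Nat.eqb_spec (o + i) (S j)),
      (Z.eqb_spec (Z.of_nat j - Z.of_nat (o + i)) 0),
      (Z.eqb_spec (Z.of_nat j - Z.of_nat (o + i)) (-1)); try lia; ring.
Qed.

Lemma toeplitz_hopMt : toeplitz_bulk szV offV fMt.
Proof.
  exists 1%nat, (fun z => if Z.eqb z 0 then h else if Z.eqb z 1 then - J else 0); split.
  - intros z Hz. destruct (Z.eqb_spec z 0); [lia|]. destruct (Z.eqb_spec z 1); [lia|auto].
  - intros n L i j HL H1 H2 Hj. pose proof (window_in_volume n L HL) as S0. unfold fMt, volfam, mtr.
    rewrite hopM_in by (unfold szV in *; lia). unfold delta. set (o := offV n L).
    destruct (Nat.eqb_spec j (o + i)), (Nat.eqb_spec j (S (o + i))),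
      (Z.eqb_spec (Z.of_nat j - Z.of_nat (o + i)) 0),
      (Z.eqb_spec (Z.of_nat j - Z.of_nat (o + i)) 1); try lia; ring.
Qed.

Lemma nbound_hopMt : nbound szV fMt (Rabs h + Rabs J).
Proof.
  intros n L HL i Hi. unfold szV in *. set (N := nsites L) in *.
  apply Rle_trans with (rsum N (fun j => delta i j * Rabs h + delta (S i) j * Rabs J)).
  - apply rsum_le; intros j Hj. unfold fMt, volfam, mtr. fold N. rewrite hopM_in by auto.
    rewrite (delta_sym i j), (delta_sym (S i) j).
    eapply Rle_trans; [apply Rabs_triang|]. rewrite Rabs_Ropp, !Rabs_mult.
    unfold delta. destruct (Nat.eqb j i), (Nat.eqb j (S i));
      rewrite ?Rabs_R1, ?Rabs_R0; lra.
  - rewrite rsum_plus, (rsum_delta N (fun _ => Rabs h) i Hi).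
    destruct (le_lt_dec N (S i)).
    + rewrite (rsum_delta_out N (fun _ => Rabs J)) by auto. pose proof (Rabs_pos J); lra.
    + rewrite (rsum_delta N (fun _ => Rabs J)) by auto. lra.
Qed.

Lemma toeplitz_hopX : toeplitz_bulk szV offV (volfam (hopX J h)).
Proof.
  apply (toeplitz_sub szV offV (volfam mid)); [apply toeplitz_mid|].
  apply (toeplitz_scal szV offV (/ psq J h) (fmm szV fMt fM)).
  apply toeplitz_mm; [exact window_in_volume|apply toeplitz_hopMt|apply toeplitz_hopM].
Qed.

Lemma asym_hopY : asym_toeplitz szV offV (volfam (hopY J h)).
Proof.
  pose proof (contr_range J h Hh HJ) as Hx.
  apply (asym_geom_limit szV offV _ (fun m => volfam (fun N => sqrt_iter N (hopX J h N) m))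
    (contr J h) (contr J h)); auto.
  - intros m. apply (asym_exact szV offV _ (contr J h)); [lra| |].
    + intros n L HL. apply sqrt_iter_norm; auto using hopX_norm.
    + induction m as [|m IH]; [apply toeplitz_zero|].
      apply (toeplitz_scal szV offV (1/2) (fadd (volfam (hopX J h))
        (fmm szV (volfam (fun N => sqrt_iter N (hopX J h N) m))
                 (volfam (fun N => sqrt_iter N (hopX J h N) m))))).
      apply toeplitz_add; [apply toeplitz_hopX|]. apply toeplitz_mm; auto. exact window_in_volume.
  - intros m n L HL. apply sqrt_lim_bound; auto using hopX_norm.
Qed.

(** Unlike the iterates leading to [hopY], which are exactly Toeplitz in the bulk, these are
    polynomials in a matrix that is Toeplitz only up to small errors; hence the product rule for the
    closure. *)
Lemma asym_hopR : asym_toeplitz szV offV (volfam (hopR J h)).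
Proof.
  pose proof (contr_range J h Hh HJ) as Hx.
  apply (asym_geom_limit szV offV _ (fun m => volfam (fun N => neumann_iter N (hopY J h N) m))
    1 (contr J h)); auto.
  - intros m. induction m as [|m IH].
    + apply (asym_exact szV offV _ 0); [lra| |apply toeplitz_zero].
      intros n L HL. apply rnorm_zero.
    + apply (asym_add szV offV (volfam mid)
        (fmm szV (volfam (hopY J h)) (volfam (fun N => neumann_iter N (hopY J h N) m)))).
      * apply (asym_exact szV offV _ 1); [lra| |apply toeplitz_mid].
        intros n L HL. apply rnorm_mid.
      * apply asym_mm; auto using window_in_volume, asym_hopY.
  - intros m n L HL. apply inv_lim_bound; auto using hopX_norm.
Qed.

Lemma asym_blockG : asym_toeplitz szB offB (fun n L => blockG J h L).
Proof.
  apply (asym_restr (fun n L => hopG J h (nsites L))).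
  apply (asym_scal szV offV (/ sqrt (psq J h)) (fmm szV (volfam (hopR J h)) fMt)).
  apply asym_mm; auto using window_in_volume, asym_hopR.
  apply (asym_exact szV offV _ (Rabs h + Rabs J)); auto using nbound_hopMt, toeplitz_hopMt.
  pose proof (Rabs_pos h). pose proof (Rabs_pos J). lra.
Qed.

Lemma block_moments_conv k : exists l,
  conv (fun n L => rsum n (fun i => mpow n (blockG J h L) k i i) / INR n) l.
Proof.
  apply (asym_trace_conv szB offB window_in_block (fun n L => mpow n (blockG J h L) k)).
  induction k as [|k IH].
  - apply (asym_exact szB offB _ 1); [lra| |apply toeplitz_delta].
    apply (nbound_ext szB (fun n _ => mid n)).
    + intros n L i j _ Hi _. now apply mid_in.
    + intros n L HL. apply rnorm_mid.
  - apply (asym_mm szB offB window_in_block (fun n L => mpow n (blockG J h L) k)); auto using asym_blockG.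
Qed.

End HopBulk.

(** * Analytic continuation of the limit *)

(** A binomial coefficient is at most 2^(j+k). The double induction is Pascal's rule with
    denominators cleared. *)
Lemma fact_add_le j k : INR (fact (j + k)) <= 2 ^ (j + k) * (INR (fact j) * INR (fact k)).
Proof.
  assert (P : forall m, 0 < INR (fact m)) by (intros; apply INR_fact_lt_0).
  revert k. induction j as [|j IHj]; intros k.
  - simpl. pose proof (P k). pose proof (pow_R1_Rle 2 k ltac:(lra)). nra.
  - induction k as [|k IHk].
    + rewrite Nat.add_0_r. pose proof (P (S j)). pose proof (pow_R1_Rle 2 (S j) ltac:(lra)).
      simpl (fact 0). simpl (INR 1). nra.
    + specialize (IHj (S k)). rewrite Nat.add_succ_r in IHj.
      rewrite Nat.add_succ_l in IHk. rewrite Nat.add_succ_l, Nat.add_succ_r.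
      assert (F : forall m, INR (fact (S m)) = (INR m + 1) * INR (fact m)).
      { intros m. change (fact (S m)) with (S m * fact m)%nat. now rewrite mult_INR, S_INR. }
      rewrite (F (S (j + k))), (F j), (F k), S_INR, plus_INR.
      rewrite (F k) in IHj. rewrite (F j) in IHk.
      set (x := INR (fact (S (j + k)))) in *.
      change (2 ^ S (S (j + k))) with (2 * 2 ^ S (j + k)).
      pose proof (pos_INR j). pose proof (pos_INR k).
      apply Rle_trans with ((INR j + 1) * x + (INR k + 1) * x); [lra|].
      apply Rle_trans with
        ((INR j + 1) * (2 ^ S (j + k) * (INR (fact j) * ((INR k + 1) * INR (fact k))))
         + (INR k + 1) * (2 ^ S (j + k) * ((INR j + 1) * INR (fact j) * INR (fact k)))).
      * apply Rplus_le_compat; apply Rmult_le_compat_l; lra.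
      * apply Req_le; ring.
Qed.

Section DerivTable.
Variable T : nat -> R -> R.
Hypothesis Td : forall j t, is_derive (T j) t (INR j * (T (pred j) t - T (S j) t)).
Hypothesis Tb : forall j t, Rabs (T j t) <= 1.

(** The k-th derivative of T_j, written through the hierarchy as a finite combination of the T_i, so
    that bounds and convergence become inductions on k. *)
Fixpoint dtab (k j : nat) (t : R) : R :=
  match k with
  | O => T j t
  | S k => INR j * (dtab k (pred j) t - dtab k (S j) t)
  end.

Lemma dtab_derive k : forall j t, is_derive (dtab k j) t (dtab (S k) j t).
Proof.
  induction k as [|k IH]; intros j t; [apply Td|].
  apply (is_derive_scal (fun t => dtab k (pred j) t - dtab k (S j) t)).
  apply (is_derive_minus (dtab k (pred j)) (dtab k (S j))); apply IH.
Qed.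

(** Each derivative multiplies by the current index and moves it by one, so the weights grow at most
    like (j+1)...(j+k), while the two neighbours account for 2^k. The factor j! on the left avoids
    division. *)
Lemma dtab_bound_fact k : forall j t,
  Rabs (dtab k j t) * INR (fact j) <= 2 ^ k * INR (fact (j + k)).
Proof.
  assert (F : forall m, INR (fact (S m)) = (INR m + 1) * INR (fact m)).
  { intros m. change (fact (S m)) with (S m * fact m)%nat. now rewrite mult_INR, S_INR. }
  assert (P : forall m, 0 < INR (fact m)) by (intros; apply INR_fact_lt_0).
  induction k as [|k IH]; intros j t.
  - rewrite Nat.add_0_r. simpl. pose proof (P j). specialize (Tb j t). nra.
  - destruct j as [|j].
    + simpl dtab. rewrite Rmult_0_l, Rabs_R0, Rmult_0_l.
      apply Rmult_le_pos; [apply pow_le; lra|apply Rlt_le, P].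
    + change (dtab (S k) (S j) t) with (INR (S j) * (dtab k j t - dtab k (S (S j)) t)).
      rewrite Rabs_mult, (Rabs_pos_eq (INR (S j))) by apply pos_INR.
      set (a := dtab k j t). set (b := dtab k (S (S j)) t).
      pose proof (IH j t) as Ha. fold a in Ha.
      pose proof (IH (S (S j)) t) as Hb. fold b in Hb.
      replace (S j + S k)%nat with (S (S (j + k))) by lia.
      replace (S (S j) + k)%nat with (S (S (j + k))) in Hb by lia.
      assert (Tr : Rabs (a - b) <= Rabs a + Rabs b).
      { eapply Rle_trans; [apply Rabs_triang|]. rewrite Rabs_Ropp; lra. }
      pose proof (pos_INR j) as Pj. pose proof (pos_INR k) as Pk.
      rewrite (F (S j)), (F j), S_INR in Hb. rewrite (F j), S_INR.
      assert (P2 : 0 < 2 ^ k) by (apply pow_lt; lra).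
      set (y := INR (fact j)) in *. pose proof (P j : 0 < y) as Py.
      pose proof (P (j + k)%nat) as Pf.
      set (z := INR (fact (S (S (j + k))))) in *.
      assert (Hz : (INR j + 1) * (INR j + 1) * INR (fact (j + k)) <= z).
      { unfold z. rewrite (F (S (j + k))), (F (j + k)%nat), S_INR, plus_INR.
        rewrite <- Rmult_assoc. apply Rmult_le_compat_r; [lra|]. nra. }
      assert (H1 : (INR j + 1) * (INR j + 1) * (Rabs a * y) <= 2 ^ k * z).
      { apply Rle_trans with ((INR j + 1) * (INR j + 1) * (2 ^ k * INR (fact (j + k)))).
        - apply Rmult_le_compat_l; [nra|auto].
        - rewrite (Rmult_comm (2 ^ k)), <- Rmult_assoc, Rmult_comm.
          apply Rmult_le_compat_l; lra. }
      assert (H2 : (INR j + 1) * ((INR j + 1) * (Rabs b * y)) <= 2 ^ k * z).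
      { eapply Rle_trans; [|exact Hb].
        assert (0 <= Rabs b * y) by (apply Rmult_le_pos; [apply Rabs_pos|lra]).
        replace (Rabs b * ((INR j + 1 + 1) * ((INR j + 1) * y)))
          with ((INR j + 1 + 1) * ((INR j + 1) * (Rabs b * y))) by ring.
        apply Rmult_le_compat_r; [|lra]. apply Rmult_le_pos; lra. }
      apply Rle_trans with ((INR j + 1) * (Rabs a + Rabs b) * ((INR j + 1) * y)).
      * apply Rmult_le_compat_r; [apply Rmult_le_pos; lra|].
        apply Rmult_le_compat_l; lra.
      * replace (2 ^ S k * z) with (2 ^ k * z + 2 ^ k * z) by (simpl; ring).
        eapply Rle_trans; [|apply Rplus_le_compat; [exact H1|exact H2]].
        apply Req_le; ring.
Qed.

Lemma dtab_bound k j t : Rabs (dtab k j t) <= 2 ^ j * 4 ^ k * INR (fact k).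
Proof.
  pose proof (dtab_bound_fact k j t) as H. pose proof (fact_add_le j k) as G.
  assert (P : 0 < INR (fact j)) by apply INR_fact_lt_0.
  apply Rmult_le_reg_r with (INR (fact j)); auto.
  eapply Rle_trans; [exact H|].
  apply Rle_trans with (2 ^ k * (2 ^ (j + k) * (INR (fact j) * INR (fact k)))).
  - apply Rmult_le_compat_l; [apply pow_le; lra|auto].
  - apply Req_le. replace 4 with (2 * 2) by ring. rewrite Rpow_mult_distr, pow_add. ring.
Qed.

End DerivTable.

(** * Taylor estimates under factorial growth of the derivatives *)

Lemma increment_bound (u du : R -> R) t0 t m K : 0 <= K ->
  (forall s, is_derive u s (du s)) -> u t0 = 0 ->
  (forall s, Rabs (s - t0) <= Rabs (t - t0) -> Rabs (du s) <= K * Rabs (s - t0) ^ m) ->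
  Rabs (u t) <= K * Rabs (t - t0) ^ S m / INR (S m).
Proof.
  intros HK Hu U0 Hdu.
  assert (Pm : 0 < INR (S m)) by (apply lt_0_INR; lia).
  (* Compare u with the primitive of K x^m along the segment s -> t0 + s (t - t0). *)
  set (d := t - t0) in *.
  assert (Key : forall e : R, (e = 1 \/ e = -1) ->
    e * u t <= K * Rabs d ^ S m / INR (S m)).
  { intros e He.
    set (f := fun s => K * Rabs d ^ S m / INR (S m) * s ^ S m - e * u (t0 + s * d)).
    set (df := fun s => K * Rabs d ^ S m * s ^ m - e * (d * du (t0 + s * d))).
    assert (Df : forall s, is_derive f s (df s)).
    { intros s. unfold f, df.
      apply (is_derive_minus (fun s => K * Rabs d ^ S m / INR (S m) * s ^ S m)
        (fun s => e * u (t0 + s * d))).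
      - replace (K * Rabs d ^ S m * s ^ m)
          with (K * Rabs d ^ S m / INR (S m) * (INR (S m) * 1 * s ^ pred (S m)))
          by (simpl pred; field; lra).
        apply (is_derive_scal (fun s => s ^ S m)).
        apply (is_derive_pow (fun s => s)). apply @is_derive_id.
      - apply (is_derive_scal (fun s => u (t0 + s * d))).
        apply (is_derive_comp u (fun s => t0 + s * d)); [apply Hu|].
        auto_derive; auto. ring. }
    destruct (MVT_gen f 0 1 df) as [s [Hs E]].
    - intros; apply Df.
    - intros x _. apply continuity_pt_filterlim.
      apply (ex_derive_continuous f x). eexists; apply Df.
    - rewrite Rmin_left, Rmax_right in Hs by lra.
      assert (D0 : 0 <= df s).
      { unfold df.
        assert (A : Rabs (t0 + s * d - t0) = s * Rabs d).
        { replace (t0 + s * d - t0) with (s * d) by ring.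
          rewrite Rabs_mult, Rabs_pos_eq; lra. }
        pose proof (Rabs_pos d) as Pd.
        specialize (Hdu (t0 + s * d)). rewrite A in Hdu. specialize (Hdu ltac:(nra)).
        rewrite Rpow_mult_distr in Hdu.
        assert (B : e * (d * du (t0 + s * d)) <= Rabs d * Rabs (du (t0 + s * d))).
        { rewrite <- Rabs_mult. destruct He as [-> | ->]; split_Rabs; lra. }
        assert (C : Rabs d * Rabs (du (t0 + s * d)) <= Rabs d * (K * (s ^ m * Rabs d ^ m)))
          by (apply Rmult_le_compat_l; auto).
        simpl. lra. }
      unfold f in E.
      replace (t0 + 1 * d) with t in E by (unfold d; ring).
      replace (t0 + 0 * d) with t0 in E by ring.
      rewrite U0, pow1, pow_i in E by lia. lra. }
  apply Rabs_le. pose proof (Key 1 ltac:(auto)). pose proof (Key (-1) ltac:(auto)). lra.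
Qed.

Definition taylor_sum (d : nat -> R -> R) (m : nat) (t0 t : R) : R :=
  rsum m (fun k => d k t0 * (t - t0) ^ k / INR (fact k)).

(** The derivative of a Taylor remainder is the remainder, one order lower, of the derivative; so
    the induction runs over all sequences [d] and is applied to the shifted one. *)
Lemma taylor_bound m : forall (d : nat -> R -> R) t0 t K, 0 <= K ->
  (forall k s, is_derive (d k) s (d (S k) s)) ->
  (forall s, Rabs (d m s) <= K) ->
  Rabs (d 0%nat t - taylor_sum d m t0 t) <= K * Rabs (t - t0) ^ m / INR (fact m).
Proof.
  induction m as [|m IH]; intros d t0 t K HK Hd HB.
  - unfold taylor_sum; simpl. rewrite Rminus_0_r. specialize (HB t). lra.
  - assert (Ts : forall s : R, is_derive (fun s => taylor_sum d (S m) t0 s) s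
       (taylor_sum (fun k => d (S k)) m t0 s)).
    { clear. intros s. induction m as [|m IH].
      - apply (is_derive_ext (fun _ => d 0%nat t0)).
        + intros x. unfold taylor_sum; simpl. change (d 0%nat t0 = 0 + d 0%nat t0 * 1 / 1). field.
        + exact (is_derive_const (d 0%nat t0) s).
      - apply (is_derive_plus (fun s => taylor_sum d (S m) t0 s)
          (fun s => d (S m) t0 * (s - t0) ^ S m / INR (fact (S m)))); [exact IH|].
        pose proof (INR_fact_lt_0 m). pose proof (lt_0_INR (S m) ltac:(lia)).
        assert (F : INR (fact (S m)) = INR (S m) * INR (fact m)).
        { change (fact (S m)) with (S m * fact m)%nat. apply mult_INR. }
        rewrite F.
        replace (d (S m) t0 * (s - t0) ^ m / INR (fact m))
          with (d (S m) t0 / (INR (S m) * INR (fact m)) * (INR (S m) * 1 * (s - t0) ^ pred (S m)))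
          by (simpl pred; field; lra).
        assert (Ex : forall x : R, d (S m) t0 / (INR (S m) * INR (fact m)) * (x - t0) ^ S m
          = d (S m) t0 * (x - t0) ^ S m / (INR (S m) * INR (fact m))) by (intros; field; lra).
        apply (is_derive_ext _ _ _ _ Ex).
        apply (is_derive_scal (fun s => (s - t0) ^ S m)).
        apply (is_derive_pow (fun s => s - t0)). auto_derive; auto. }
    replace (K * Rabs (t - t0) ^ S m / INR (fact (S m)))
      with (K / INR (fact m) * Rabs (t - t0) ^ S m / INR (S m)).
    + apply (increment_bound (fun s => d 0%nat s - taylor_sum d (S m) t0 s)
        (fun s => d 1%nat s - taylor_sum (fun k => d (S k)) m t0 s)).
      * apply Rdiv_le_0_compat; [auto|apply INR_fact_lt_0].
      * intros s. apply (is_derive_minus (d 0%nat)); auto.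
      * unfold taylor_sum.  change (S m) with (1 + m)%nat. rewrite rsum_add. simpl rsum at 1.
        rewrite rsum_zero; [simpl; field|].
        intros k _. rewrite Rminus_diag. simpl. unfold Rdiv; ring.
      * intros s _. replace (K / INR (fact m) * Rabs (s - t0) ^ m)
          with (K * Rabs (s - t0) ^ m / INR (fact m)) by (unfold Rdiv; ring).
        apply (IH (fun k => d (S k))); auto.
    + change (fact (S m)) with (S m * fact m)%nat. rewrite mult_INR.
      pose proof (INR_fact_lt_0 m). pose proof (lt_0_INR (S m) ltac:(lia)). field. lra.
Qed.

(** The factorials cancel and leave (4 |t - t0|)^m. The step 1/8 is half the radius 1/4 guaranteed
    by the bounds, whence the ratio 1/2. *)
Lemma taylor_bound_fact (d : nat -> R -> R) C m t0 t : 0 <= C ->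
  (forall k s, is_derive (d k) s (d (S k) s)) ->
  (forall s, Rabs (d m s) <= C * 4 ^ m * INR (fact m)) -> Rabs (t - t0) <= 1/8 ->
  Rabs (d 0%nat t - taylor_sum d m t0 t) <= C * (1/2) ^ m.
Proof.
  intros HC Hd HB Ht.
  pose proof (INR_fact_lt_0 m) as P.
  assert (P4 : 0 < 4 ^ m) by (apply pow_lt; lra).
  eapply Rle_trans; [apply (taylor_bound m d t0 t (C * 4 ^ m * INR (fact m))); auto|].
  - apply Rmult_le_pos; [|lra]. apply Rmult_le_pos; lra.
  - replace (C * 4 ^ m * INR (fact m) * Rabs (t - t0) ^ m / INR (fact m))
      with (C * (4 ^ m * Rabs (t - t0) ^ m)) by (field; lra).
    rewrite <- Rpow_mult_distr. apply Rmult_le_compat_l; auto.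
    apply pow_incr. pose proof (Rabs_pos (t - t0)). lra.
Qed.

Lemma half_pow_small C eps : 0 <= C -> 0 < eps -> exists m, (0 < m)%nat /\ C * (1/2) ^ m < eps.
Proof.
  intros HC He.
  assert (Lm : is_lim_seq (fun m => C * (1/2) ^ m) (C * 0)).
  { apply (is_lim_seq_mult' (fun _ => C)); [apply is_lim_seq_const|].
    apply is_lim_seq_geom. rewrite Rabs_pos_eq; lra. }
  rewrite Rmult_0_r in Lm. apply is_lim_seq_spec in Lm.
  destruct (Lm (mkposreal eps He)) as [m Hm]. specialize (Hm (S m) ltac:(lia)).
  rewrite Rminus_0_r in Hm. apply Rabs_def2 in Hm. exists (S m); split; [lia|]. apply Hm.
Qed.

Lemma conv_rsum m (u : nat -> nat -> nat -> R) l :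
  (forall k, (k < m)%nat -> conv (u k) (l k)) ->
  conv (fun n L => rsum m (fun k => u k n L)) (rsum m l).
Proof.
  induction m as [|m IH]; simpl; intros H; [apply conv_const|].
  apply (conv_plus (fun n L => rsum m (fun k => u k n L)) (u m)); auto with arith.
Qed.

(** * Convergence and analyticity of limits under uniform derivative bounds *)

Section Continuation.
(* d n L k is the k-th derivative of the member (n, L) of the family. *)
Variable d : nat -> nat -> nat -> R -> R.
Variable C : R.
Hypothesis HC : 0 <= C.
Hypothesis Hd : forall n L k s, (0 < n)%nat -> (n <= L)%nat -> is_derive (d n L k) s (d n L (S k) s).
(** Only derivatives of positive order are bounded uniformly in s: the free energy itself may grow
    like |s|. *)
Hypothesis HB : forall n L m s, (0 < n)%nat -> (n <= L)%nat -> (0 < m)%nat ->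
  Rabs (d n L m s) <= C * 4 ^ m * INR (fact m).

Lemma taylor_conv t0 t (A : nat -> R) m :
  (forall k, conv (fun n L => d n L k t0) (A k)) ->
  conv (fun n L => taylor_sum (d n L) m t0 t) (rsum m (fun k => A k * (t - t0) ^ k / INR (fact k))).
Proof.
  intros HA.
  apply (conv_rsum m (fun k n L => d n L k t0 * (t - t0) ^ k / INR (fact k))); intros k _.
  set (c := (t - t0) ^ k / INR (fact k)).
  assert (E : forall z, z * (t - t0) ^ k / INR (fact k) = c * z) by (intros; unfold c, Rdiv; ring).
  rewrite E. intros eps He. destruct (conv_scal c _ _ (HA k) eps He) as [n0 H].
  exists n0; intros n L Hn HL. rewrite E. now apply H.
Qed.

(** Taylor polynomials at t0 have convergent coefficients and approximate every member of the family
    with the same error, which is the situation of [conv_approx]. *)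
Lemma continuation t0 t : Rabs (t - t0) <= 1/8 ->
  (forall k, exists a, conv (fun n L => d n L k t0) a) ->
  exists l, conv (fun n L => d n L 0%nat t) l.
Proof.
  intros Ht Hc.
  set (A := fun k => proj1_sig (constructive_indefinite_description _ (Hc k))).
  assert (HA : forall k, conv (fun n L => d n L k t0) (A k))
    by (intros k; exact (proj2_sig (constructive_indefinite_description _ (Hc k)))).
  apply conv_approx; intros eps He.
  destruct (half_pow_small C eps HC He) as [m [Hm Hs]].
  exists (fun n L => taylor_sum (d n L) m t0 t),
    (rsum m (fun k => A k * (t - t0) ^ k / INR (fact k))), 1%nat; split.
  - now apply taylor_conv.
  - intros n L Hn HL. apply Rle_trans with (C * (1/2) ^ m); [|lra].
    apply taylor_bound_fact; auto with arith.
Qed.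

(** The coefficients are limits of derivatives, not derivatives of the limit: the uniform remainder
    bound passes to the limit and identifies the power series without differentiating F. *)
Lemma limit_analytic (F : R -> R) :
  (forall t, conv (fun n L => d n L 0%nat t) (F t)) ->
  (forall k t, exists a, conv (fun n L => d n L k t) a) ->
  real_analytic F.
Proof.
  intros HF Hc t0. exists (1/8); split; [lra|].
  set (A := fun k => proj1_sig (constructive_indefinite_description _ (Hc k t0))).
  assert (HA : forall k, conv (fun n L => d n L k t0) (A k))
    by (intros k; exact (proj2_sig (constructive_indefinite_description _ (Hc k t0)))).
  exists (fun k => A k / INR (fact k)). intros t Ht.
  assert (Rem : forall m, (0 < m)%nat ->
    Rabs (F t - rsum m (fun k => A k * (t - t0) ^ k / INR (fact k))) <= C * (1/2) ^ m).
  { intros m Hm. apply Rnot_lt_le; intros Lt.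
    set (S := rsum m (fun k => A k * (t - t0) ^ k / INR (fact k))) in *.
    set (g := Rabs (F t - S) - C * (1/2) ^ m).
    assert (Pg : 0 < g) by (unfold g; lra).
    destruct (HF t (g / 2) ltac:(lra)) as [n1 H1].
    destruct (taylor_conv t0 t A m HA (g / 2) ltac:(lra)) as [n2 H2].
    set (n := (1 + n1 + n2)%nat).
    specialize (H1 n n ltac:(unfold n; lia) ltac:(lia)).
    specialize (H2 n n ltac:(unfold n; lia) ltac:(lia)). fold S in H2.
    pose proof (taylor_bound_fact (d n n) C m t0 t HC (fun k s => Hd n n k s ltac:(unfold n; lia) ltac:(lia))
      (fun s => HB n n m s ltac:(unfold n; lia) ltac:(lia) Hm) ltac:(lra)) as H3.
    assert (Rabs (F t - S) < g / 2 + C * (1/2) ^ m + g / 2); [|unfold g in *; lra].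
    apply Rabs_def2 in H1. apply Rabs_def2 in H2. apply Rabs_le_between in H3.
    apply Rabs_def1; lra. }
  intros eps He. destruct (half_pow_small C eps HC He) as [m [Hm Hs]].
  exists m; intros N HN. unfold Rdist.
  assert (Sm : forall f N, sum_f_R0 f N = rsum (S N) f).
  { intros f M; induction M as [|M IH]; simpl; [lra|]. rewrite IH. reflexivity. }
  rewrite Sm, Rabs_minus_sym.
  rewrite (rsum_ext (S N) _ (fun k => A k * (t - t0) ^ k / INR (fact k)))
    by (intros; unfold Rdiv; ring).
  eapply Rle_lt_trans; [apply Rem; lia|].
  eapply Rle_lt_trans; [|exact Hs]. apply Rmult_le_compat_l; auto.
  replace (S N) with (m + (S N - m))%nat by lia. rewrite pow_add.
  assert (0 < (1/2) ^ m) by (apply pow_lt; lra).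
  assert (B : (1/2) ^ (S N - m) <= 1).
  { apply Rle_trans with (1 ^ (S N - m)); [apply pow_incr; lra|rewrite pow1; lra]. }
  nra.
Qed.

End Continuation.

(** * Propagation of convergence along the moment hierarchy *)

Section MomentHierarchy.
Variables (f : nat -> nat -> R -> R) (T : nat -> nat -> nat -> R -> R).
Hypothesis Hf : forall n L t, (0 < n)%nat -> (n <= L)%nat -> is_derive (f n L) t (T n L 1%nat t).
Hypothesis Hf0 : forall n L, (0 < n)%nat -> (n <= L)%nat -> f n L 0 = 0.
Hypothesis HT : forall n L j t, (0 < n)%nat -> (n <= L)%nat ->
  is_derive (T n L j) t (INR j * (T n L (pred j) t - T n L (S j) t)).
Hypothesis HTb : forall n L j t, (0 < n)%nat -> (n <= L)%nat -> Rabs (T n L j t) <= 1.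
Hypothesis HT0 : forall j, exists l, conv (fun n L => T n L j 0) l.

Lemma dtab_conv t : (forall j, exists l, conv (fun n L => T n L j t) l) ->
  forall k j, exists l, conv (fun n L => dtab (T n L) k j t) l.
Proof.
  intros H k. induction k as [|k IH]; intros j; [apply H|].
  destruct (IH (pred j)) as [a Ha]. destruct (IH (S j)) as [b Hb].
  exists (INR j * (a + -1 * b)). intros eps He.
  destruct (conv_scal (INR j) _ _ (conv_plus _ _ _ _ Ha (conv_scal (-1) _ _ Hb)) eps He) as [n0 Hn].
  exists n0; intros n L A B. specialize (Hn n L A B). simpl dtab.
  replace (dtab (T n L) k (pred j) t - dtab (T n L) k (S j) t)
    with (dtab (T n L) k (pred j) t + -1 * dtab (T n L) k (S j) t) by ring. exact Hn.
Qed.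

Definition dfree (n L k : nat) : R -> R :=
  match k with O => f n L | S k => dtab (T n L) k 1 end.

Lemma dfree_derive n L k s : (0 < n)%nat -> (n <= L)%nat ->
  is_derive (dfree n L k) s (dfree n L (S k) s).
Proof. intros A B. destruct k; [now apply Hf|]. apply dtab_derive; auto. Qed.

Lemma dfree_bound n L m s : (0 < n)%nat -> (n <= L)%nat -> (0 < m)%nat ->
  Rabs (dfree n L m s) <= 2 * 4 ^ m * INR (fact m).
Proof.
  intros A B Hm. destruct m as [|m]; [lia|]. simpl dfree.
  eapply Rle_trans; [apply dtab_bound; auto|]. rewrite pow_1.
  assert (P4 : 0 < 4 ^ m) by (apply pow_lt; lra).
  pose proof (INR_fact_lt_0 m). assert (INR (fact m) <= INR (fact (S m))) by (apply le_INR, fact_le; lia).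
  simpl (4 ^ S m). apply Rmult_le_compat; nra.
Qed.

Lemma moments_conv t0 t : Rabs (t - t0) <= 1/8 ->
  (forall j, exists l, conv (fun n L => T n L j t0) l) ->
  forall j, exists l, conv (fun n L => T n L j t) l.
Proof.
  intros Ht H0 j.
  apply (continuation (fun n L k => dtab (T n L) k j) (2 ^ j)) with t0; auto.
  - apply pow_le; lra.
  - intros; apply dtab_derive; auto.
  - intros; apply dtab_bound; auto.
  - intros k. now apply dtab_conv.
Qed.

Lemma free_energy_conv t0 t : Rabs (t - t0) <= 1/8 ->
  (forall j, exists l, conv (fun n L => T n L j t0) l) ->
  (exists l, conv (fun n L => f n L t0) l) -> exists l, conv (fun n L => f n L t) l.
Proof.
  intros Ht H0 Hf'.
  apply (continuation dfree 2) with t0; auto using dfree_derive, dfree_bound; [lra|].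
  intros [|k]; [exact Hf'|]. now apply (dtab_conv t0).
Qed.

(** The derivatives of f at a point involve moments of all orders, so the convergence of every T_j
    has to travel along with that of f from one step to the next. *)
Lemma moments_free_energy_conv t :
  (forall j, exists l, conv (fun n L => T n L j t) l) /\ (exists l, conv (fun n L => f n L t) l).
Proof.
  assert (St : forall (m : nat) (e : R), -1 <= e <= 1 ->
    (forall j, exists l, conv (fun n L => T n L j (INR m * e / 8)) l) /\
    (exists l, conv (fun n L => f n L (INR m * e / 8)) l)).
  { intros m e He. induction m as [|m [IH1 IH2]].
    - simpl INR. replace (0 * e / 8) with 0 by field. split; auto.
      exists 0. intros eps Hp. exists 1%nat; intros n L A B.
      rewrite Hf0, Rminus_diag, Rabs_R0 by lia; auto.
    - assert (D : Rabs (INR (S m) * e / 8 - INR m * e / 8) <= 1/8).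
      { rewrite S_INR. apply Rabs_le; split; lra. }
      split; [now apply (moments_conv (INR m * e / 8))|now apply (free_energy_conv (INR m * e / 8))]. }
  (* With m > 8 |t| steps of signed length e / 8, the choice e = 8 t / m lies in [-1, 1] and ends at
     t. *)
  destruct (INR_unbounded (8 * Rabs t)) as [m Hm].
  assert (Pm : 0 < INR m) by (pose proof (Rabs_pos t); lra).
  replace t with (INR m * (8 * t / INR m) / 8) by (field; lra).
  apply St. apply Rabs_le_between. unfold Rdiv.
  rewrite Rabs_mult, (Rabs_pos_eq (/ INR m)) by (apply Rlt_le, Rinv_0_lt_compat; auto).
  apply Rmult_le_reg_r with (INR m); auto.
  rewrite Rmult_assoc, Rinv_l, Rabs_mult, (Rabs_pos_eq 8) by lra. lra.
Qed.

Lemma free_limit_analytic : exists F,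
  (forall t, conv (fun n L => f n L t) (F t)) /\ real_analytic F.
Proof.
  set (F := fun t => proj1_sig (constructive_indefinite_description _ (proj2 (moments_free_energy_conv t)))).
  assert (HF : forall t, conv (fun n L => f n L t) (F t))
    by (intros t; exact (proj2_sig (constructive_indefinite_description _ (proj2 (moments_free_energy_conv t))))).
  exists F; split; auto.
  apply (limit_analytic dfree 2); auto using dfree_derive, dfree_bound; [lra|].
  intros [|k] t; [exact (proj2 (moments_free_energy_conv t))|]. apply (dtab_conv t (proj1 (moments_free_energy_conv t))).
Qed.

End MomentHierarchy.

(* omega n t stands for omega(exp(t * sum_{i=1}^n sigma^z_i)), where omega is
   the weak-* limit of the finite-volume ground states. *)
Theorem theorem4 (J h : R) (Hh : h <> 0) (Hdis : Rabs (J / h) < 1)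
  (omega : nat -> R -> R)
  (Homega : forall psi : nat -> nat -> R,
      (forall L : nat, is_ground_state J h L (psi L)) ->
      forall (n : nat) (t : R),
        Un_cv (fun L => expect_exp L (psi L) n t) (omega n t)) :
  exists F : R -> R,
    (forall t : R, Un_cv (fun m => ln (omega (S m) t) / INR (S m)) (F t)) /\
    real_analytic F.
Proof.
  assert (HJ : Rabs J < Rabs h).
  { unfold Rdiv in Hdis. rewrite Rabs_mult, Rabs_inv in Hdis.
    assert (P : 0 < Rabs h) by now apply Rabs_pos_lt.
    apply Rmult_lt_compat_r with (r := Rabs h) in Hdis; auto.
    rewrite Rmult_assoc, Rinv_l in Hdis by lra. lra. }
  set (psi := fun L => proj1_sig (constructive_indefinite_description _ (ground_state_exists J h L))).
  assert (Hpsi : forall L, is_ground_state J h L (psi L) /\ (forall c, (dim L <= c)%nat -> psi L c = 0))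
    by (intros L; exact (proj2_sig (constructive_indefinite_description _ (ground_state_exists J h L)))).
  destruct (free_limit_analytic (fun n L => free_energy L n (psi L)) (fun n L => moment L n (psi L)))
    as [F [HF HA]].
  - intros n L t Hn HL. now apply (free_energy_derive J h); try apply Hpsi.
  - intros n L Hn HL. now apply (free_energy_0 J h); apply Hpsi.
  - intros n L j t Hn HL. apply (moment_derive J h); auto; apply Hpsi.
  - intros n L j t Hn HL. apply (moment_bound J h); auto; apply Hpsi.
  - intros j. destruct (block_moments_conv J h Hh HJ j) as [l Hl].
    exists l. intros eps He. destruct (Hl eps He) as [n0 H0]. exists n0; intros n L A B.
    rewrite (moment_0 J h); auto; apply Hpsi.
  - exists F; split; auto. intros t eps He.
    destruct (HF t (eps / 2) ltac:(lra)) as [n0 H0].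
    exists n0. intros m Hm. unfold Rdist.
    assert (Cv : is_lim_seq (fun L => free_energy L (S m) (psi L) t) (ln (omega (S m) t) / INR (S m))).
    { pose proof (Homega psi (fun L => proj1 (Hpsi L)) (S m) t) as C.
      apply is_lim_seq_Reals in C.
      (* The logarithm must be continuous at the limit; the lower bound uniform in the volume keeps
         the limit away from 0. *)
      assert (Pos : 0 < omega (S m) t).
      { apply Rlt_le_trans with (exp (- (INR (S m) * Rabs t))); [apply exp_pos|].
        refine (is_lim_seq_le (fun _ => exp (- (INR (S m) * Rabs t))) _ (Finite _) (Finite _)
          _ (is_lim_seq_const _) C).
        intros L. rewrite <- partition_expect. apply (partition_lower J h), Hpsi. }
      unfold free_energy, Rdiv.
      apply (is_lim_seq_mult' (fun L => ln (partition L (S m) (psi L) t)) (fun _ => / INR (S m)));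
        [|apply is_lim_seq_const].
      apply (is_lim_seq_continuous ln (fun L => partition L (S m) (psi L) t)).
      - apply derivable_continuous_pt. eexists. now apply derivable_pt_lim_ln.
      - apply is_lim_seq_ext with (2 := C). intros L. symmetry. apply partition_expect. }
    (* Sending L to infinity preserves only weak inequalities, so the estimate is taken with half of
       eps. *)
    assert (Le : Rabs (ln (omega (S m) t) / INR (S m) - F t) <= eps / 2); [|lra].
    assert (Cv2 : is_lim_seq (fun L => Rabs (free_energy L (S m) (psi L) t - F t))
                    (Rabs (ln (omega (S m) t) / INR (S m) - F t))).
    { apply (is_lim_seq_abs _ (Finite _)).
      apply (is_lim_seq_minus' (fun L => free_energy L (S m) (psi L) t)); [exact Cv|apply is_lim_seq_const]. }
    refine (is_lim_seq_le_loc _ (fun _ => eps / 2) (Finite _) (Finite _) _ Cv2 (is_lim_seq_const _)).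
    exists (S m). intros L HL. apply Rlt_le, H0; lia.
Qed.
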